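(* Let $\overline{X}\in\mathbf{S}^n$ be a real symmetric matrix, let $\bar{x}:=\lambda(\overline{X})\in\mathbb{R}^n$, and let $M\subset\mathbb{R}^n$ be a set that is locally symmetric around $\bar{x}$. Then $M$ is a $C^{\infty}$ manifold around $\bar{x}$ if and only if the spectral set $\lambda^{-1}(M):=\{X\in\mathbf{S}^n:\lambda(X)\in M\}$ is a $C^{\infty}$ manifold around $\overline{X}$.
   Context: $\mathbf{S}^n$ is the space of real $n\times n$ symmetric matrices with the trace inner product $\langle X,Y\rangle=\mathrm{tr}(XY)$, and $\mathbb{R}^n$ carries its standard inner product. The map $\lambda\colon\mathbf{S}^n\to\mathbb{R}^n$ sends $X$ to the vector of its eigenvalues (with multiplicity) in nonincreasing order. $\Sigma^n$ is the group of coordinate permutations of $\mathbb{R}^n$, and $\mathrm{Fix}(x):=\{\sigma\in\Sigma^n:\sigma x=x\}$. A set $M\subset\mathbb{R}^n$ is locally symmetric around $\bar{x}$ if for all $x$ near $\bar{x}$ and all $\sigma\in\mathrm{Fix}(\bar{x})$ one has $x\in M\iff\sigma x\in M$. A subset $Q$ of a Euclidean space is a $C^p$ manifold around a point $\bar{z}\in Q$ if there is an open neighborhood $U$ of $\bar{z}$ such that $Q\cap U$ is an embedded $C^p$ submanifold. *)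

(* Defs.v *)
From HB Require Import structures.
From mathcomp Require Import all_boot all_order all_algebra all_fingroup.
From mathcomp Require Import all_classical all_reals all_analysis.
From mathcomp Require Import ring lra.
From mathcomp Require complex.

Set Implicit Arguments.
Unset Strict Implicit.
Unset Printing Implicit Defensive.

Import Order.TTheory GRing.Theory Num.Theory.
Import numFieldNormedType.Exports.

Local Open Scope classical_set_scope.
Local Open Scope ring_scope.

Section SymmetricMatrices.
Variables (R : realType) (n : nat).

Record sym_matrix := SymMatrix {
  sym_mx :> 'M[R]_n;
  sym_mxP : sym_mx \is symmetricmx }.

HB.instance Definition _ := [isSub for sym_mx].
HB.instance Definition _ := [Choice of sym_matrix by <:].

Lemma symmetricE (X : 'M[R]_n) : (X \is symmetricmx) = (X^T == X).
Proof.
by rewrite is_hermitianmxE expr0 scale1r map_mx_id// eq_sym.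
Qed.

Lemma symmetricmx_submod_closed :
  submod_closed (symmetricmx : {pred 'M[R]_n}).
Proof.
split=> [|a X Y]; rewrite !symmetricE ?trmx0//.
by move=> /eqP hX /eqP hY; rewrite linearP /= hX hY.
Qed.

HB.instance Definition _ := GRing.isSubmodClosed.Build R 'M[R]_n
  (symmetricmx : {pred 'M[R]_n}) symmetricmx_submod_closed.
HB.instance Definition _ := [SubChoice_isSubLmodule of sym_matrix by <:].

Lemma sym_tr (X : sym_matrix) : (X : 'M[R]_n)^T = X.
Proof. by apply/eqP; rewrite -symmetricE sym_mxP. Qed.

(* sym_matrix is normed by the trace inner product; 'rV[R]_n keeps the
   library's sup norm, which has the same topology and differentiability as
   the Euclidean norm. *)
Definition trdot (X Y : sym_matrix) : R := \tr (X *m Y).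

Definition frob (X : sym_matrix) : R := Num.sqrt (trdot X X).

Lemma trdotE X Y : trdot X Y = \sum_i \sum_j X i j * Y i j.
Proof.
rewrite /trdot /mxtrace; apply: eq_bigr => i _; rewrite mxE.
by apply: eq_bigr => j _; rewrite -[in Y j i](sym_tr Y) mxE.
Qed.

Lemma trdotC X Y : trdot X Y = trdot Y X.
Proof. exact: mxtrace_mulC. Qed.

Lemma trdotDl X Y Z : trdot (X + Y) Z = trdot X Z + trdot Y Z.
Proof. by rewrite /trdot /= mulmxDl mxtraceD. Qed.

Lemma trdotZl a X Z : trdot (a *: X) Z = a * trdot X Z.
Proof. by rewrite /trdot /= -scalemxAl mxtraceZ. Qed.

Lemma trdot_ge0 X : 0 <= trdot X X.
Proof.
rewrite trdotE; apply: sumr_ge0 => i _; apply: sumr_ge0 => j _.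
by rewrite -expr2 sqr_ge0.
Qed.

Lemma trdot_eq0 X : trdot X X = 0 -> X = 0.
Proof.
have ge0 i j : 0 <= X i j * X i j by rewrite -expr2 sqr_ge0.
rewrite trdotE => /eqP; rewrite psumr_eq0; last first.
  by move=> i _; exact: sumr_ge0.
move=> /allP X0; apply/val_inj/matrixP => i j /=; rewrite mxE.
have := X0 i; rewrite mem_index_enum => /(_ isT) /=.
rewrite psumr_eq0// => /allP /(_ j); rewrite mem_index_enum => /(_ isT) /=.
by rewrite mulf_eq0 orbb => /eqP.
Qed.

Lemma frob_sqr X : frob X ^+ 2 = trdot X X.
Proof. by rewrite sqr_sqrtr// trdot_ge0. Qed.

Lemma frob_ge0 X : 0 <= frob X. Proof. exact: sqrtr_ge0. Qed.

Lemma frob_eq0 X : frob X = 0 -> X = 0.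
Proof. by move=> X0; apply: trdot_eq0; rewrite -frob_sqr X0 expr0n. Qed.

Lemma frobZ a X : frob (a *: X) = `|a| * frob X.
Proof.
rewrite /frob trdotZl trdotC trdotZl mulrA -expr2.
by rewrite sqrtrM ?sqr_ge0// sqrtr_sqr.
Qed.

Lemma trdot_CauchySchwarz X Y : trdot X Y <= frob X * frob Y.
Proof.
have [/frob_eq0 ->|Y0] := eqVneq (frob Y) 0.
  have -> : trdot X 0 = 0 by rewrite /trdot /= mulmx0 mxtrace0.
  by rewrite mulr_ge0 ?frob_ge0.
have [/frob_eq0 ->|X0] := eqVneq (frob X) 0.
  have -> : trdot 0 Y = 0 by rewrite /trdot /= mul0mx mxtrace0.
  by rewrite mulr_ge0 ?frob_ge0.
have Xp : 0 < frob X by rewrite lt_def X0 frob_ge0.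
have Yp : 0 < frob Y by rewrite lt_def Y0 frob_ge0.
have := trdot_ge0 (frob Y *: X + (- frob X) *: Y).
rewrite trdotDl !trdotZl ![trdot _ (_ + _)]trdotC !trdotDl !trdotZl.
rewrite (trdotC Y X) -!frob_sqr => h.
suff : 0 <= (frob X * frob Y) * (frob X * frob Y - trdot X Y).
  by rewrite pmulr_rge0 ?mulr_gt0// subr_ge0.
lra.
Qed.

Lemma ler_frobD X Y : frob (X + Y) <= frob X + frob Y.
Proof.
rewrite -(@ler_pXn2r _ 2)// ?nnegrE ?addr_ge0 ?frob_ge0//.
rewrite sqrrD !frob_sqr trdotDl ![trdot _ (_ + _)]trdotC !trdotDl (trdotC Y X).
have := trdot_CauchySchwarz X Y; lra.
Qed.

HB.instance Definition _ :=
  Lmodule_isNormed.Build R sym_matrix ler_frobD frobZ frob_eq0.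

End SymmetricMatrices.

Lemma char_poly_similar (F : fieldType) m (P A : 'M[F]_m) :
  P \in unitmx -> char_poly (invmx P *m A *m P) = char_poly A.
Proof.
move=> uP; rewrite /char_poly /char_poly_mx.
pose Q := map_mx (@polyC F) P; pose Q' := map_mx (@polyC F) (invmx P).
have QQ : Q' *m Q = 1%:M by rewrite -map_mxM mulVmx// map_mx1.
rewrite !map_mxM -/Q -/Q'.
have -> : 'X%:M - Q' *m map_mx (@polyC F) A *m Q
        = Q' *m ('X%:M - map_mx (@polyC F) A) *m Q.
  rewrite mulmxBr mulmxBl; congr (_ - _).
  by rewrite scalar_mxC -mulmxA QQ mulmx1.
by rewrite !det_mulmx mulrC mulrA -det_mulmx (mulmx1C QQ) det1 mul1r.
Qed.

Module Import SymSpectrum.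
Import complex.

Lemma sym_char_poly_split (R : realType) (n : nat) (X : sym_matrix R n) :
  exists d : 'rV[R]_n, char_poly X = \prod_(i < n) ('X - (d 0 i)%:P).
Proof.
pose toC := (real_complex R : {rmorphism R -> complex R}).
pose A := map_mx toC X.
have Ah : A \is hermsymmx.
  apply: realsym_hermsym.
    apply/is_hermitianmxP; rewrite expr0 scale1r map_mx_id//.
    by rewrite /A map_trmx sym_tr.
  by apply/mxOverP => i j; rewrite mxE complex_real.
have /hermitian_normalmx/orthomx_spectralP AE := Ah.
have /mxOverP dr := hermitian_spectral_diag_real Ah.
pose d : 'rV[R]_n := \row_j Re (spectral_diag A 0 j).
exists d; apply: (map_poly_inj toC).
rewrite map_char_poly -/A AE char_poly_similar ?spectral_unit//.
rewrite char_poly_trig ?diag_mx_is_trig// rmorph_prod.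
apply: eq_bigr => i _; rewrite rmorphB /= map_polyX map_polyC /= !mxE eqxx mulr1n.
congr (_ - _%:P).
have := dr 0 i; move: (spectral_diag A 0 i) => z.
by move=> /RRe_real.
Qed.

End SymSpectrum.

Section Eigenvalues.
Variables (R : realType) (n : nat).

Definition is_eigvals (X : sym_matrix R n) (v : 'rV[R]_n) : Prop :=
  (forall i j : 'I_n, (i <= j)%N -> v 0 j <= v 0 i) /\
  char_poly X = \prod_(i < n) ('X - (v 0 i)%:P).

(* The default value 0 of xget is never used, see eigvalsP; is_eigvals
   determines v, see is_eigvals_inj. *)
Definition eigvals (X : sym_matrix R n) : 'rV[R]_n :=
  xget 0 [set v | is_eigvals X v].

Lemma is_eigvals_inj (X : sym_matrix R n) (v w : 'rV[R]_n) :
  is_eigvals X v -> is_eigvals X w -> v = w.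
Proof.
move=> [vs vE] [ws wE].
pose s (u : 'rV[R]_n) := [seq u 0 i | i <- enum 'I_n].
have sorted_s (u : 'rV[R]_n) : (forall i j : 'I_n, (i <= j)%N -> u 0 j <= u 0 i) ->
    sorted >=%O (s u).
  move=> us; rewrite sorted_map.
  have := iota_sorted 0 n; rewrite -val_enum_ord sorted_map.
  by apply: sub_sorted => i j /=; exact: us.
have : s v = s w.
  apply: (sorted_eq ge_trans ge_anti); [exact: sorted_s|exact: sorted_s|].
  by apply: prod_XsubC_eq; rewrite !big_map -!enumT !big_enum /= -vE.
by move=> /eq_in_map vw; apply/rowP => i; apply: vw; rewrite mem_enum.
Qed.

Lemma eigvalsP (X : sym_matrix R n) : is_eigvals X (eigvals X).
Proof.
suff [v vP] : exists v, is_eigvals X v by exact: (xgetPex 0 (ex_intro _ v vP)).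
have [d dE] := sym_char_poly_split X.
pose s := sort >=%O [seq d 0 i | i <- enum 'I_n].
have ss : size s = n by rewrite size_sort size_map size_enum_ord.
exists (\row_i s`_i); split=> [i j ij|].
  rewrite !mxE; apply: (@sorted_leq_nth _ >=%O); rewrite ?inE ?ss//.
  - by move=> x y z; exact: ge_trans.
  - exact: lexx.
  - by apply: sort_sorted => x y; exact: le_total.
rewrite dE; under [RHS]eq_bigr do rewrite mxE.
rewrite -(big_mkord xpredT (fun i => 'X - (s`_i)%:P)) -[X in index_iota _ X]ss.
rewrite -(big_nth 0 xpredT (fun x => 'X - x%:P)).
rewrite (perm_big [seq d 0 i | i <- enum 'I_n]) ?perm_sort//=.
by rewrite big_map big_enum.
Qed.

End Eigenvalues.

Section LocalSymmetry.
Variables (R : realType) (n : nat).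

Definition Fix (x : 'rV[R]_n) : {set 'S_n} := [set s | col_perm s x == x].

Definition locally_symmetric (M : set 'rV[R]_n) (xbar : 'rV[R]_n) : Prop :=
  \forall x \near xbar, forall s, s \in Fix xbar ->
    (M x <-> M (col_perm s x)).

End LocalSymmetry.

Section Smooth.
Variables (R : realType).

(* For finite-dimensional E, requiring 'D_v f to be C^k for every direction v
   is the usual condition that the map x |-> 'd f x be C^k. *)
Fixpoint Ck (E F : normedModType R) (k : nat) (U : set E) (f : E -> F) : Prop :=
  match k with
  | 0 => forall x, U x -> {for x, continuous f}
  | k'.+1 => (forall x, U x -> differentiable f x) /\
             (forall v, Ck k' U ('D_v f))
  end.

Definition smooth (E F : normedModType R) (U : set E) (f : E -> F) : Prop :=
  forall k, Ck k U f.

(* phi restricts to a diffeomorphism from the open set U onto the open set V,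
   with inverse psi; values outside of U and V are irrelevant. *)
Definition smooth_diffeo (E F : normedModType R) (U : set E) (V : set F)
    (phi : E -> F) (psi : F -> E) : Prop :=
  [/\ open U /\ open V, smooth U phi, smooth V psi,
      (forall x, U x -> V (phi x) /\ psi (phi x) = x) &
      (forall y, V y -> U (psi y) /\ phi (psi y) = y)].

Definition linear_subspace (E : lmodType R) (L : set E) : Prop :=
  L 0 /\ forall (a : R) u v, L u -> L v -> L (a *: u + v).

(* Embedded submanifolds of a finite-dimensional space E, in terms of
   straightening (slice) charts of E. Taking as model a linear subspace L of E
   rather than R^k x {0} saves the choice of a basis; that L does not depend
   on z expresses that Q has pure dimension dim L. *)
Definition embedded_submanifold (E : normedModType R) (Q : set E) : Prop :=
  exists2 L : set E, linear_subspace L &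
    forall z, Q z ->
      exists (U V : set E) (phi psi : E -> E),
        [/\ U z, smooth_diffeo U V phi psi &
            forall x, U x -> (Q x <-> L (phi x))].

Definition manifold_around (E : normedModType R) (Q : set E) (z : E) : Prop :=
  Q z /\ exists U : set E, [/\ open U, U z & embedded_submanifold (Q `&` U)].

End Smooth.

(* Main.v *)
Require Import Defs.
From HB Require Import structures.
From mathcomp Require Import all_boot all_order all_algebra all_fingroup.
From mathcomp Require Import all_classical all_reals all_analysis.
From mathcomp Require Import ring lra.

Import Order.TTheory GRing.Theory Num.Theory.
Import numFieldNormedType.Exports.

Local Open Scope classical_set_scope.
Local Open Scope ring_scope.

(** Eigenvalues are not smooth functions of a symmetric matrix where they
    collide, but a smooth function of the eigenvalues that is invariant under
    the permutations exchanging the colliding ones is smooth in the matrix.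
    To use this, a manifold near a point [z] is described by an equation
    [y = 0], where [y] is smooth, its differential at [z] is a projector [P],
    and [P (y x) = y x]: every manifold has such equations
    ([equation_of_manifold]) and the zero set of such a [y] is a manifold
    ([manifold_of_equation]), by the inverse function theorem. If a finite
    group of linear maps fixes [z] and preserves the manifold near [z], then
    averaging makes [y] equivariant ([equivariant_equation]). Each implication
    carries an equivariant equation from one side to the other. Conjugating by
    an orthogonal matrix reduces to the case [Xbar = diag xb], where [xb] is
    the vector of eigenvalues.

    From matrices to vectors ([manifold_of_spectral]): the spectral set is
    invariant under conjugation by diagonal sign matrices, and the matrices
    fixed by all these conjugations are the diagonal ones. An equivariant [y]
    thus sends diagonal matrices to diagonal matrices, and its restriction to
    them is an equation of [M]: for [x] near [xb] the ordered eigenvalues of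
    [diag x] are [s x] for some permutation [s] that fixes [xb], so that
    [diag x] is in the spectral set exactly when [x] is in [M].

    From vectors to matrices ([spectral_of_manifold]): let [y] be an equation
    of [M] that is equivariant under the permutations fixing [xb]. Its lift
    [Y (U^T diag(x) U) = U^T diag(y x) U] is smooth ([spectral_lift]). Indeed
    [y_i(x) = y_j(x)] where [x_i = x_j], so dividing by the factors of the
    Vandermonde determinant gives [y_i(x) = sum_k a_k(x) x_i ^ k] with smooth
    invariant [a_k] ([smooth_interpolation]); hence
    [Y X = sum_k a_k(lambda X) X ^ k], and [a_k (lambda X)] is smooth
    ([spectral_smooth]). The zero set of [Y] is the spectral set, but the
    values of [Y] turn with the eigenvectors of [X], so they do not stay in
    the range of one projector. They do on matrices that are block-diagonal
    along the eigenspaces of [diag xb]. Near [diag xb], every symmetric matrix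
    is [kappa Z], an orthogonal conjugate of the block-diagonal part of [Z],
    where [kappa] is a local diffeomorphism ([kappa_diff]); so the equation of
    the spectral set is [Y] of the block-diagonal part, read through
    [kappa]. *)

Set Implicit Arguments.
Unset Strict Implicit.
Unset Printing Implicit Defensive.

(** * Smooth maps between finite-dimensional spaces *)

Lemma near_ballP (R : realType) (E : normedModType R) (x : E) (P : set E) :
  (\forall y \near x, P y) <->
  exists2 d : R, 0 < d & forall y, `|y - x| < d -> P y.
Proof.
split=> [/nbhs_ballP[d d0 dP]|[d d0 dP]].
  by exists d => // y yx; apply: dP; rewrite -ball_normE /= distrC.
by apply/nbhs_ballP; exists d => // y; rewrite -ball_normE /= distrC => /dP.
Qed.

Section LinearPredicate.
Variables (R : realType) (E F : lmodType R) (L : E -> F).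
Hypothesis linL : linear L.

Lemma is_linear0 : L 0 = 0.
Proof. by have := linL (-1) 0 0; rewrite scaler0 addr0 scaleN1r addNr. Qed.

Lemma is_linearD x y : L (x + y) = L x + L y.
Proof. by rewrite -[x]scale1r linL !scale1r. Qed.

Lemma is_linearZ a x : L (a *: x) = a *: L x.
Proof. by rewrite -[a *: x]addr0 linL is_linear0 addr0. Qed.

Lemma is_linearB x y : L (x - y) = L x - L y.
Proof. by rewrite -scaleN1r is_linearD is_linearZ scaleN1r. Qed.

Lemma is_linear_sum (I : Type) (r : seq I) (f : I -> E) :
  L (\sum_(i <- r) f i) = \sum_(i <- r) L (f i).
Proof. exact: (big_morph L is_linearD is_linear0). Qed.

End LinearPredicate.

Section Differential.
Variables (R : realType) (E F : normedModType R).

Lemma diff_near (f : E -> F) x : differentiable f x -> forall e : R, 0 < e ->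
  \forall y \near x, `|f y - f x - 'd f x (y - x)| <= e * `|y - x|.
Proof.
move=> df e e0; have /eqadd_some_oP fE := diff_locally df.
have /near_ballP[d d0 fd] := fE _ e0.
apply/near_ballP; exists d => // y yx.
have := fd (y - x); rewrite subr0 => /(_ yx).
by rewrite !fctE /= subrK opprD addrA.
Qed.

Lemma diff_nearP (f L : E -> F) x : linear L -> continuous L ->
  (forall e : R, 0 < e ->
     \forall y \near x, `|f y - f x - L (y - x)| <= e * `|y - x|) ->
  differentiable f x /\ 'd f x = L :> (E -> F).
Proof.
move=> linL cL fL.
pose Lm := GRing.isLinear.Build R E F *:%R L linL.
pose L' : {linear E -> F} := HB.pack L Lm.
have fE : f \o shift x = cst (f x) + (L' : E -> F) +o_ 0 id.
  apply/eqaddoP => e e0; have /near_ballP[d d0 fd] := fL e e0.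
  apply/near_ballP; exists d => // y; rewrite subr0 => yd.
  have := fd (y + x); rewrite addrK => /(_ yd).
  by rewrite !fctE /= opprD addrA.
have dE : 'd f x = L :> (E -> F) by apply: (@diff_unique _ _ _ _ L').
by split=> //; apply/diff_locallyP; rewrite dE; split.
Qed.

Lemma near_eq_differentiable (f g : E -> F) x :
  (\forall y \near x, f y = g y) -> differentiable f x -> differentiable g x.
Proof.
move=> fg df; have fgx := nbhs_singleton fg.
have [] // := @diff_nearP g ('d f x) x.
- by move=> a u v; rewrite linearP.
- exact: diff_continuous.
move=> e e0; have := diff_near df e0; apply: filterS2 fg => y fgy.
by rewrite fgy fgx.
Qed.

End Differential.

(** Finite dimension, in the only form in which it is used. The family [e]
    spans but need not be free, so that no basis has to be chosen; the
    coordinates turn all questions about maps on [F] into questions about real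
    functions. *)
Definition framed (R : realType) (F : normedModType R) :=
  exists m (e : 'I_m -> F) (c : 'I_m -> F -> R),
    [/\ forall i, linear (c i), forall i, continuous (c i) &
        forall y, y = \sum_i c i y *: e i].

Section Ck.
Variables (R : realType).
Implicit Types (E F G : normedModType R).

Lemma CkW E F k (U V : set E) (f : E -> F) : V `<=` U -> Ck k U f -> Ck k V f.
Proof.
move=> VU; elim: k f => [|k IH] f /=; first by move=> h x /VU; exact: h.
by case=> h1 h2; split=> [x /VU|v]; [exact: h1|exact/IH/h2].
Qed.

(** The function is global and its derivatives are taken in the whole space, so
    the condition on [U] is a condition at each point separately. *)
Lemma Ck_pointwise E F k (U : set E) (f : E -> F) :
  (forall x, U x -> Ck k [set x] f) -> Ck k U f.
Proof.
elim: k f => [|k IH] f /= h; first by move=> x Ux; exact: h Ux _ erefl.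
split=> [x Ux|v]; first by have [+ _] := h x Ux; exact.
by apply: IH => x Ux; have [_] := h x Ux; exact.
Qed.

Lemma CkS E F k (U : set E) (f : E -> F) : Ck k.+1 U f -> Ck k U f.
Proof.
elim: k f => [|k IH] f /= [h1 h2].
  by move=> x Ux; exact/differentiable_continuous/h1.
by split=> // v; apply: IH; exact: h2.
Qed.

(** Openness is what makes this true: a directional derivative at a point of
    [U] depends on the values of the function around that point. *)
Lemma Ck_ext E F k (U : set E) (f g : E -> F) : open U ->
  (forall x, U x -> f x = g x) -> Ck k U f -> Ck k U g.
Proof.
move=> oU; elim: k f g => [|k IH] f g fg /=.
  move=> h x Ux; have fgx : \forall y \near x, f y = g y.
    by apply: filterS (open_nbhs_nbhs (conj oU Ux)) => y; exact: fg.
  have fgE := nbhs_singleton fgx; have hx : f @ x --> f x by exact: h.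
  have -> : {for x, continuous g} = (g @ x --> f x) by rewrite fgE.
  apply: cvg_trans hx; apply: near_eq_cvg; exact: fgx.
have fgx x : U x -> \forall y \near x, f y = g y.
  by move=> Ux; apply: filterS (open_nbhs_nbhs (conj oU Ux)) => y; exact: fg.
case=> h1 h2; split=> [x Ux|v].
  exact: near_eq_differentiable (fgx x Ux) (h1 x Ux).
by apply: IH (h2 v) => x Ux; exact/near_eq_derive/fgx.
Qed.

Lemma Ck_cst E F k (U : set E) (a : F) : Ck k U (cst a : E -> F).
Proof.
elim: k a => [|k IH] a /=; first by move=> x _; exact: cvg_cst.
split=> [x _|v]; first exact: differentiable_cst.
suff -> : 'D_v (cst a : E -> F) = cst 0 by exact: IH.
by apply/funext => x; rewrite derive_cst.
Qed.

Lemma Ck_add E F k (U : set E) (f g : E -> F) : open U ->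
  Ck k U f -> Ck k U g -> Ck k U (f + g).
Proof.
move=> oU; elim: k f g => [|k IH] f g /=.
  by move=> hf hg x Ux; apply: cvgD; [exact: hf|exact: hg].
move=> [hf1 hf2] [hg1 hg2]; split=> [x Ux|v].
  by apply: differentiableD; [exact: hf1|exact: hg1].
apply: (@Ck_ext _ _ _ _ ('D_v f + 'D_v g)) => // [x Ux|]; last exact: IH.
by rewrite deriveD //; apply: diff_derivable; [exact: hf1|exact: hg1].
Qed.

Lemma Ck_sum E F k (U : set E) (I : Type) (r : seq I) (f : I -> E -> F) : open U ->
  (forall i, Ck k U (f i)) -> Ck k U (fun x => \sum_(i <- r) f i x).
Proof.
move=> oU hf; elim: r => [|i r IH].
  by under eq_fun do rewrite big_nil; exact: Ck_cst.
by under eq_fun do rewrite big_cons; exact: Ck_add.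
Qed.

Lemma diff_linear E F (L : E -> F) x : linear L -> continuous L ->
  differentiable L x /\ 'd L x = L :> (E -> F).
Proof.
move=> linL cL; apply: diff_nearP => // e e0; near=> y.
by rewrite (is_linearB linL) subrr normr0 mulr_ge0 // ltW.
Unshelve. all: by end_near. Qed.

Lemma Ck_comp_linear E F G k (U : set E) (f : E -> F) (L : F -> G) :
  open U -> linear L -> continuous L -> Ck k U f -> Ck k U (L \o f).
Proof.
move=> oU linL cL; elim: k f => [|k IH] f /=.
  by move=> hf x Ux; apply: continuous_comp; [exact: hf|exact: cL].
move=> [h1 h2]; split=> [x Ux|v].
  by apply: differentiable_comp; [exact: h1|case: (diff_linear (f x) linL cL)].
apply: (@Ck_ext _ _ _ _ (L \o 'D_v f)) => // [x Ux|]; last exact: IH.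
have [dL dLE] := diff_linear (f x) linL cL.
have df := h1 x Ux.
have dc : differentiable (L \o f) x := differentiable_comp df dL.
by rewrite (deriveE v dc) diff_comp // dLE /= (deriveE v df).
Qed.

Lemma Ck_linear E F k (U : set E) (L : E -> F) : 
  linear L -> continuous L -> Ck k U L.
Proof.
move=> linL cL; case: k => [|k] /=; first by move=> x _; exact: cL.
split=> [x _|v]; first by case: (diff_linear x linL cL).
rewrite (_ : 'D_v L = cst (L v)); first exact: Ck_cst.
apply/funext => x; have [dL dLE] := diff_linear x linL cL.
by rewrite deriveE // dLE.
Qed.

(** The Leibniz rule, obtained from the differential of a continuous bilinear
    map. *)
Lemma diff_scale E F (a : E -> R) (f : E -> F) x :
  differentiable a x -> differentiable f x ->
  differentiable (fun y => a y *: f y) x /\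
  'd (fun y => a y *: f y) x =
    (fun v => 'd a x v *: f x + a x *: 'd f x v) :> (E -> F).
Proof.
move=> da df.
have bil : bilinear_for (GRing.Scale.Law.clone _ _ *:%R _)
    (GRing.Scale.Law.clone _ _ *:%R _) ( *:%R : R -> F -> F).
  split=> [u'|u] b y z /=; first by rewrite scalerDl scalerA.
  by rewrite scalerDr !scalerA mulrC.
pose bM := bilinear_isBilinear.Build R R F F _ _ ( *:%R : R -> F -> F) bil.
pose bL : {bilinear R -> F -> F} := HB.pack ( *:%R : R -> F -> F) bM.
have cb : continuous (fun p : R * F => bL p.1 p.2).
  by move=> p; exact: (@scale_continuous R F p).
have dp := differentiable_pair da df.
pose h := (fun p : R * F => bL p.1 p.2) \o (fun y => (a y, f y)).
have dh : differentiable h x.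
  by apply: differentiable_comp => //; exact: differentiable_bilin.
split; first exact: dh.
rewrite -[LHS]/(GRing.Linear.sort ('d h x)) /h diff_comp //; last first.
  exact: differentiable_bilin.
by rewrite diff_bilin // diff_pair //; apply/funext => v /=; rewrite addrC.
Qed.

(** The induction is on the order: the Leibniz rule writes the derivative as a
    sum of products whose factors are one order less smooth. Sums of products
    in coordinates then give composition, determinants and inverses. *)
Lemma Ck_scale E F k (U : set E) (a : E -> R) (f : E -> F) : open U ->
  Ck k U a -> Ck k U f -> Ck k U (fun x => a x *: f x).
Proof.
move=> oU; elim: k a f => [|k IH] a f.
  by move=> ha hf x Ux; apply: cvgZ; [exact: ha|exact: hf].
move=> Ca Cf; have [/= ha1 ha2] := Ca; have [/= hf1 hf2] := Cf; split=> [x Ux|v].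
  by have [] := diff_scale (ha1 x Ux) (hf1 x Ux).
apply: (@Ck_ext _ _ _ _ ((fun x => 'D_v a x *: f x) + (fun x => a x *: 'D_v f x))) => //.
  move=> x Ux; have [d1 d2] := diff_scale (ha1 x Ux) (hf1 x Ux).
  rewrite [RHS]deriveE // d2 !fctE !deriveE //; [exact: hf1|exact: ha1].
have CDa : Ck k U ('D_v a) by exact: ha2.
have CDf : Ck k U ('D_v f) by exact: hf2.
by apply: Ck_add => //; apply: IH => //; exact: CkS.
Qed.

Lemma framed_linear_Ck F G k (U : set F) (L : F -> G) : framed F ->
  open U -> linear L -> Ck k U L.
Proof.
move=> [m [e [c [linc cc yE]]]] oU linL.
have LE y : L y = \sum_i c i y *: L (e i).
  rewrite {1}(yE y) (is_linear_sum linL); apply: eq_bigr => i _.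
  by rewrite (is_linearZ linL).
rewrite (_ : L = fun y => \sum_i c i y *: L (e i)); last exact/funext.
apply: Ck_sum => // i; apply: (@Ck_scale _ _ _ _ (c i) (cst (L (e i)))) => //.
  exact: Ck_linear.
exact: Ck_cst.
Qed.

Lemma framed_continuous F G (L : F -> G) : framed F -> linear L -> continuous L.
Proof.
move=> fF linL x.
by have := @framed_linear_Ck F G 0 setT L fF openT linL; exact.
Qed.

(** The directional derivatives of [g \o f] are combinations, with the
    coordinates of the derivative of [f] as coefficients, of the derivatives
    of [g] along the finitely many vectors of a frame of the middle space. *)
Lemma Ck_comp E F G k (U : set E) (V : set F) (f : E -> F) (g : F -> G) :
  framed F -> open U -> open V -> (forall x, U x -> V (f x)) ->
  Ck k U f -> Ck k V g -> Ck k U (g \o f).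
Proof.
move=> [m [e [c [linc cc yE]]]] oU oV fUV; elim: k f g fUV => [|k IH] f g fUV.
  move=> hf hg x Ux; apply: continuous_comp; [exact: hf|exact/hg/fUV].
move=> Cf Cg; have [/= f1 f2] := Cf; have [/= g1 g2] := Cg.
have dc x : U x -> differentiable (g \o f) x.
  by move=> Ux; apply: differentiable_comp; [exact: f1|exact/g1/fUV].
split=> // v.
apply: (@Ck_ext _ _ _ _ (fun x => \sum_i (c i ('D_v f x)) *: 'D_(e i) g (f x))) => //.
  move=> x Ux; have dg := g1 _ (fUV _ Ux); have df := f1 x Ux.
  rewrite (deriveE v (dc x Ux)) diff_comp // /= -(deriveE v df).
  rewrite [in RHS](yE ('D_v f x)) linear_sum; apply: eq_bigr => i _.
  by rewrite linearZ (deriveE (e i) dg).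
apply: Ck_sum => // i; apply: Ck_scale => //.
  apply: (@Ck_comp_linear E F R k U ('D_v f) (c i)) => //.
  exact: f2.
apply: (IH f ('D_(e i) g)) => //; first exact: CkS.
exact: g2.
Qed.

Lemma Ck_coord E F k (U : set E) (f : E -> F) m (e : 'I_m -> F) (c : 'I_m -> F -> R) :
  (forall y, y = \sum_i c i y *: e i) -> open U ->
  (forall i, Ck k U (c i \o f)) -> Ck k U f.
Proof.
move=> yE oU cf; rewrite (_ : f = fun x => \sum_i c i (f x) *: e i); last first.
  by apply/funext => x; exact: yE.
apply: Ck_sum => // i.
apply: (@Ck_scale _ _ _ _ (c i \o f) (cst (e i))) => //; exact: Ck_cst.
Qed.

Lemma Ck_mul E k (U : set E) (f g : E -> R) : open U ->
  Ck k U f -> Ck k U g -> Ck k U (fun x => f x * g x).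
Proof. exact: (@Ck_scale E R). Qed.

Lemma Ck_prod E k (U : set E) (I : Type) (r : seq I) (f : I -> E -> R) : open U ->
  (forall i, Ck k U (f i)) -> Ck k U (fun x => \prod_(i <- r) f i x).
Proof.
move=> oU hf; elim: r => [|i r IH].
  by under eq_fun do rewrite big_nil; exact: Ck_cst.
by under eq_fun do rewrite big_cons; exact: Ck_mul.
Qed.

Lemma Ck_exp E k (U : set E) (f : E -> R) n : open U ->
  Ck k U f -> Ck k U (fun x => f x ^+ n).
Proof.
move=> oU hf; elim: n => [|n IH].
  by under eq_fun do rewrite expr0; exact: Ck_cst.
by under eq_fun do rewrite exprS; exact: Ck_mul.
Qed.

Lemma Ck_scale_cst E F k (U : set E) (a : R) (f : E -> F) : open U ->
  Ck k U f -> Ck k U (fun x => a *: f x).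
Proof.
move=> oU hf; apply: (@Ck_scale _ _ _ _ (cst a) f) => //; exact: Ck_cst.
Qed.

Lemma Ck_opp E F k (U : set E) (f : E -> F) : open U ->
  Ck k U f -> Ck k U (fun x => - f x).
Proof.
move=> oU hf; rewrite (_ : (fun _ => _) = (fun x => -1 *: f x)).
  exact: Ck_scale_cst.
by apply/funext => x; rewrite scaleN1r.
Qed.

Lemma Ck_sub E F k (U : set E) (f g : E -> F) : open U ->
  Ck k U f -> Ck k U g -> Ck k U (fun x => f x - g x).
Proof. by move=> oU hf hg; apply: Ck_add => //; exact: Ck_opp. Qed.

Lemma Ck_inv E k (U : set E) (f : E -> R) : open U ->
  (forall x, U x -> f x != 0) -> Ck k U f -> Ck k U (fun x => (f x)^-1).
Proof.
move=> oU f0; elim: k => [|k IH].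
  by move=> hf x Ux; apply: cvgV; [exact: f0|exact: hf].
move=> Cf; have [/= f1 f2] := Cf.
split=> [x Ux|v]; first by apply: differentiableV; [exact: f1|exact: f0].
apply: (@Ck_ext _ _ _ _ (fun x => - ((f x)^-1 * (f x)^-1 * 'D_v f x))) => //.
  move=> x Ux; rewrite [RHS]deriveV; [|exact: f0|exact/diff_derivable/f1].
  by rewrite scaleNr expr2 invfM.
have If := IH (CkS Cf).
apply: Ck_opp => //; apply: Ck_mul => //; first exact: Ck_mul.
exact: f2.
Qed.

Lemma framed_rV n : framed 'rV[R]_n.
Proof.
exists n, (fun i => delta_mx 0 i), (fun i (y : 'rV[R]_n) => y 0 i); split.
- by move=> i a u v; rewrite !mxE.
- by move=> i; exact: coord_continuous.
- by move=> y; rewrite {1}[y]row_sum_delta.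
Qed.

Lemma framed_R : framed R.
Proof.
exists 1%N, (fun=> 1), (fun=> id); split => //.
- by move=> _ x; exact: cvg_id.
- by move=> y; rewrite big_ord1 [RHS]mulr1.
Qed.

Lemma Ck_rV E k (U : set E) n (f : E -> 'rV[R]_n) : open U ->
  (forall j, Ck k U (fun x => f x 0 j)) -> Ck k U f.
Proof.
move=> oU cf.
apply: (@Ck_coord _ _ _ _ _ _ (fun i => delta_mx 0 i) (fun i (y : 'rV_n) => y 0 i)) => //.
by move=> y; rewrite {1}[y]row_sum_delta.
Qed.

Lemma Ck_rV_coord E k (U : set E) n (f : E -> 'rV[R]_n) j : open U ->
  Ck k U f -> Ck k U (fun x => f x 0 j).
Proof.
move=> oU cf; apply: (@Ck_comp_linear _ _ R _ _ f (fun y : 'rV_n => y 0 j)) => //.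
- by move=> a u v; rewrite !mxE.
- exact: coord_continuous.
Qed.

Lemma Ck_id E k (U : set E) : Ck k U (id : E -> E).
Proof. by apply: Ck_linear => // x; exact: cvg_id. Qed.

Lemma Ck_crd k n (U : set 'rV[R]_n) j : open U -> Ck k U (fun x => x 0 j).
Proof. by move=> oU; apply: (@Ck_rV_coord _ _ _ _ id) => //; exact: Ck_id. Qed.

Lemma Ck_det E k (U : set E) m (A : E -> 'M[R]_m) : open U ->
  (forall i j, Ck k U (fun x => A x i j)) -> Ck k U (fun x => \det (A x)).
Proof.
move=> oU hA; rewrite /determinant; apply: Ck_sum => // s.
by apply: Ck_mul => //; [exact: Ck_cst|apply: Ck_prod => // i].
Qed.

Lemma Ck_adj E k (U : set E) m (A : E -> 'M[R]_m) : open U ->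
  (forall i j, Ck k U (fun x => A x i j)) -> forall i j, Ck k U (fun x => (\adj (A x)) i j).
Proof.
move=> oU hA i j; rewrite (_ : (fun _ => _) = (fun x => cofactor (A x) j i)); last first.
  by apply/funext => x; rewrite mxE.
apply: Ck_mul => //; first exact: Ck_cst.
by apply: Ck_det => // i' j'; under eq_fun do rewrite !mxE.
Qed.

Lemma Ck_invmx E k (U : set E) m (A : E -> 'M[R]_m) : open U ->
  (forall x, U x -> A x \in unitmx) ->
  (forall i j, Ck k U (fun x => A x i j)) ->
  forall i j, Ck k U (fun x => (invmx (A x)) i j).
Proof.
move=> oU uA hA i j.
apply: (@Ck_ext _ _ _ _ (fun x => (\det (A x))^-1 * (\adj (A x)) i j)) => //.
  by move=> x Ux; rewrite /invmx uA // !mxE.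
apply: Ck_mul => //; last exact: Ck_adj.
apply: Ck_inv => //; last exact: Ck_det.
by move=> x Ux; have := uA x Ux; rewrite unitmxE unitfE.
Qed.

Lemma Ck_mulmx E k (U : set E) m p q (A : E -> 'M[R]_(m, p)) (B : E -> 'M[R]_(p, q)) : open U ->
  (forall i j, Ck k U (fun x => A x i j)) ->
  (forall i j, Ck k U (fun x => B x i j)) ->
  forall i j, Ck k U (fun x => (A x *m B x) i j).
Proof.
move=> oU hA hB i j; under eq_fun do rewrite mxE.
by apply: Ck_sum => // l; exact: Ck_mul.
Qed.

End Ck.

(** * The inverse function theorem *)

Section StrictDifferentiability.
Variables (R : realType).
Implicit Types (E F G : normedModType R).

Lemma linear_bound E F (L : E -> F) : linear L -> continuous L ->
  exists2 k : R, 0 < k & forall x, `|L x| <= k * `|x|.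
Proof.
move=> linL cL.
pose Lm := GRing.isLinear.Build R E F *:%R L linL.
pose L' : {linear E -> F} := HB.pack L Lm.
exact: (@linear_lipschitz _ _ _ L').
Qed.

(** For a C^1 map the directional derivatives along a frame are close to those
    at [z]; linearity makes the whole differential close in operator norm. *)
Lemma diff_close E F (f : E -> F) (U : set E) z : framed E -> open U ->
  Ck 1 U f -> U z -> forall e : R, 0 < e -> exists2 d : R, 0 < d &
  forall y, `|y - z| < d -> U y /\ forall u, `|'d f y u - 'd f z u| <= e * `|u|.
Proof.
move=> [m [b [c [linc cc yE]]]] oU [df cf] Uz e e0.
have {linc cc} /choice[K KP] i : exists k : R, 0 < k /\ forall x, `|c i x| <= k * `|x|.
  by have [k k0 kP] := linear_bound (linc i) (cc i); exists k.
(* The summand 1 keeps the denominator positive when the frame is empty. *)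
pose e' := e / (1 + \sum_i K i).
have S0 : 0 < 1 + \sum_i K i.
  by rewrite ltr_pwDl // sumr_ge0 // => i _; rewrite ltW //; case: (KP i).
have e'0 : 0 < e' by rewrite divr_gt0.
have nc : \forall y \near z, forall i, `|'D_(b i) f y - 'D_(b i) f z| < e'.
  apply: filter_forall => i.
  have /cvgrPdist_lt/(_ _ e'0) := cf (b i) z Uz.
  by apply: filterS => y; rewrite distrC.
have nU : \forall y \near z, U y by exact: open_nbhs_nbhs.
have /near_ballP[d d0 dP] : \forall y \near z, U y /\
    forall i, `|'D_(b i) f y - 'D_(b i) f z| < e' by exact: filterI.
exists d => // y /dP[Uy yP]; split=> // u.
have dE x : U x -> 'd f x u = \sum_i c i u *: 'D_(b i) f x.
  move=> Ux; rewrite {1}(yE u) linear_sum; apply: eq_bigr => i _.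
  by rewrite linearZ (deriveE _ (df x Ux)).
rewrite !dE // -sumrB.
under eq_bigr do rewrite -scalerBr.
apply: le_trans (ler_norm_sum _ _ _) _.
have -> : e = e' + \sum_i e' * K i.
  by rewrite -mulr_sumr -[X in X + _]mulr1 -mulrDr divfK // gt_eqF.
have e'u : 0 <= e' * `|u| by rewrite mulr_ge0 // ltW.
rewrite mulrDl mulr_suml ler_wpDl //.
apply: ler_sum => i _; rewrite normrZ -mulrA [leRHS]mulrC.
have [_ Ki] := KP i.
by apply: ler_pM => //; exact/ltW/yP.
Qed.

Lemma derive_segment E (f : E -> R) (a u : E) (t : R) :
  differentiable f (a + t *: u) ->
  is_derive t 1 (fun t => f (a + t *: u)) ('d f (a + t *: u) u).
Proof.
move=> df.
have dg : is_diff t (fun t => a + t *: u) ( *:%R^~ u).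
  apply: is_diff_eq; apply/funext => s /=.
  by rewrite !fctE add0r.
have dh : is_diff t (f \o (fun t => a + t *: u)) ('d f (a + t *: u) \o *:%R^~ u).
  by apply: is_diff_comp; exact: DiffDef.
have dd : differentiable (f \o (fun t => a + t *: u)) t by exact: ex_diff.
apply: DeriveDef; first exact: diff_derivable.
by rewrite deriveE // diff_val /= scale1r.
Qed.

Lemma mean_value E (f : E -> R) (a b : E) :
  (forall t, t \in `[0, 1] -> differentiable f (a + t *: (b - a))) ->
  exists2 t, t \in `[0, 1] & f b - f a = 'd f (a + t *: (b - a)) (b - a).
Proof.
move=> df; pose u := b - a.
have [||t t01] := @MVT_segment R (fun t => f (a + t *: u))
  (fun t => 'd f (a + t *: u) u) 0 1 ler01.
- move=> x /subset_itv_oo_cc x01; exact/derive_segment/df.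
- apply: derivable_within_continuous => x x01.
  by have [] := derive_segment (df x x01).
rewrite scale1r scale0r addr0 [a + u]addrC subrK subr0 mulr1 => fE.
by exists t.
Qed.

Lemma segment_ball E (z a b : E) (d t : R) : t \in `[0, 1] ->
  `|a - z| < d -> `|b - z| < d -> `|a + t *: (b - a) - z| < d.
Proof.
rewrite in_itv /= => /andP[t0 t1] az bz.
have -> : a + t *: (b - a) - z = (1 - t) *: (a - z) + t *: (b - z).
  have -> : b - a = (b - z) - (a - z) by rewrite opprB addrA subrK.
  rewrite scalerBr scalerBl scale1r [a + _]addrC -addrA [RHS]addrC.
  by rewrite -addrA [- _ + (a - z)]addrC.
apply: le_lt_trans (ler_normD _ _) _; rewrite !normrZ (ger0_norm t0) ger0_norm ?subr_ge0 //.
have : (1 - t) * `|a - z| <= (1 - t) * Num.max `|a - z| `|b - z|.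
  by rewrite ler_wpM2l ?subr_ge0 // le_max lexx.
have : t * `|b - z| <= t * Num.max `|a - z| `|b - z|.
  by rewrite ler_wpM2l // le_max lexx orbT.
have : Num.max `|a - z| `|b - z| < d by rewrite gt_max az bz.
lra.
Qed.

Lemma strict_diff_real E (f : E -> R) (U : set E) z : framed E -> open U ->
  Ck 1 U f -> U z -> forall e : R, 0 < e -> exists2 d : R, 0 < d &
  forall a b, `|a - z| < d -> `|b - z| < d ->
   `|f b - f a - 'd f z (b - a)| <= e * `|b - a|.
Proof.
move=> fE oU Cf Uz e e0; have [d d0 dP] := diff_close fE oU Cf Uz e0.
exists d => // a b az bz; have [df _] := Cf.
have [|t t01 ->] := @mean_value _ f a b.
  by move=> t t01; apply/df; have [] := dP _ (segment_ball t01 az bz).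
by have [_] := dP _ (segment_ball t01 az bz); exact.
Qed.

(** Strict differentiability follows coordinate by coordinate from the mean
    value theorem, which holds for real-valued maps only. *)
Lemma strict_diff E F (f : E -> F) (U : set E) z : framed E -> framed F -> open U ->
  Ck 1 U f -> U z -> forall e : R, 0 < e -> exists2 d : R, 0 < d &
  forall a b, `|a - z| < d -> `|b - z| < d ->
   `|f b - f a - 'd f z (b - a)| <= e * `|b - a|.
Proof.
move=> fE [m [v [c [linc cc yE]]]] oU Cf Uz e e0.
have df : differentiable f z by case: Cf => + _; exact.
pose S := 1 + \sum_i `|v i|.
have S0 : 0 < S by rewrite ltr_pwDl // sumr_ge0.
have e'0 : 0 < e / S by rewrite divr_gt0.
have dci i : 'd (c i \o f) z = c i \o 'd f z :> (E -> R).
  have [dc dcE] := diff_linear (f z) (linc i) (cc i).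
  by rewrite diff_comp // dcE.
have /choice[d dP] i : exists d : R, 0 < d /\
    forall a b, `|a - z| < d -> `|b - z| < d ->
     `|c i (f b) - c i (f a) - c i ('d f z (b - a))| <= e / S * `|b - a|.
  have Cci : Ck 1 U (c i \o f) by exact: Ck_comp_linear.
  have [d d0 dP] := strict_diff_real fE oU Cci Uz e'0.
  by exists d; split=> // a b az bz; have := dP a b az bz; rewrite dci.
have : \forall y \near z, forall i, `|y - z| < d i.
  apply: filter_forall => i; apply/near_ballP; exists (d i) => //.
  by case: (dP i).
move=> /near_ballP[d1 d10 d1P]; exists d1 => // a b az bz.
set w := f b - f a - _; rewrite (yE w).
apply: le_trans (ler_norm_sum _ _ _) _.
have -> : e = e / S + \sum_i e / S * `|v i|.
  by rewrite -mulr_sumr -[X in X + _]mulr1 -mulrDr divfK // gt_eqF.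
have eS : 0 <= e / S := ltW e'0.
have eSb : 0 <= e / S * `|b - a| by exact: mulr_ge0.
rewrite mulrDl mulr_suml ler_wpDl //.
apply: ler_sum => i _; rewrite normrZ mulrAC ler_wpM2r //.
have [_ /(_ a b (d1P _ az i) (d1P _ bz i))] := dP i.
rewrite (_ : c i w = c i (f b) - c i (f a) - c i ('d f z (b - a))) //.
by rewrite /w !(is_linearB (linc i)).
Qed.

End StrictDifferentiability.

(** Joins the completeness and the norm of matrices, for the fixed point
    theorem. *)
HB.instance Definition _ (R : realType) m n := Complete.on 'M[R]_(m, n).

(** The differential of [T] at [z] is the identity, so [T - id] is a contraction
    of ratio 1/2 on a ball. This gives injectivity with a Lipschitz inverse
    ([T_expand]), surjectivity by the fixed point theorem ([T_onto]), and
    invertibility of the Jacobian matrix ([uJ]). *)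
Section InverseFunction.
Variables (R : realType) (m : nat).
Local Notation E := 'rV[R]_m.
Variables (T : E -> E) (U : set E) (z : E).
Hypotheses (oU : open U) (Uz : U z) (sT : smooth U T) (dT : 'd T z = id :> (E -> E)).

Let g (x : E) : E := T x - x.

Let g_lip : exists2 d : R, 0 < d & (forall a, `|a - z| < d -> U a) /\
  forall a b, `|a - z| < d -> `|b - z| < d -> `|g b - g a| <= 2^-1 * `|b - a|.
Proof.
have fE := @framed_rV R m.
have [|d d0 dP] := strict_diff fE fE oU (sT 1) Uz (e := 2^-1); first by rewrite invr_gt0.
have /near_ballP[d' d'0 d'P] : \forall y \near z, U y by exact: open_nbhs_nbhs.
exists (Num.min d d'); first by rewrite lt_min d0.
split=> [a|a b]; rewrite !lt_min; first by move=> /andP[_ /d'P].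
move=> /andP[az _] /andP[bz _]; have := dP a b az bz.
rewrite dT (_ : T b - T a - id _ = g b - g a) //.
by apply/rowP => i; rewrite /g !mxE; ring.
Qed.

Let d := sval (cid2 g_lip).
Let d0 : 0 < d. Proof. by rewrite /d; case: cid2. Qed.
Let dU a : `|a - z| < d -> U a.
Proof. by rewrite /d; case: cid2 => /= d' _ [h _] /h. Qed.
Let dg a b : `|a - z| < d -> `|b - z| < d -> `|g b - g a| <= 2^-1 * `|b - a|.
Proof. by rewrite /d; case: cid2 => /= d' _ [_ h]; exact: h. Qed.

Let T_expand a b : `|a - z| < d -> `|b - z| < d -> `|b - a| <= 2 * `|T b - T a|.
Proof.
move=> az bz; have := dg az bz; have : `|b - a| <= `|T b - T a| + `|g b - g a|.
  apply: le_trans (ler_normB _ _); rewrite (_ : _ - (g b - g a) = b - a) //.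
  by apply/rowP => i; rewrite /g !mxE; ring.
lra.
Qed.

Let V : set E := [set y | `|y - T z| < d / 4].
Let U' : set E := [set x | `|x - z| < d /\ V (T x)].

Let T_onto y : V y -> exists2 x, `|x - z| < d & T x = y.
Proof.
move=> Vy; pose B := closed_ball z (d / 2).
have d20 : 0 < d / 2 by rewrite divr_gt0.
have BE x : B x <-> `|x - z| <= d / 2.
  by rewrite /B closed_ballE // /closed_ball_ /= distrC.
have Bd x : B x -> `|x - z| < d.
  by move=> /BE /le_lt_trans; apply; have := d0; lra.
pose f x := y - g x.
have fB : set_fun B B f.
  move=> x Bx; apply/BE; have xz := Bd x Bx.
  have zz : `|z - z| < d by rewrite subrr normr0.
  have -> : f x - z = (y - T z) - (g x - g z).
    by apply/rowP => i; rewrite /f /g !mxE; ring.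
  apply: le_trans (ler_normB _ _) _.
  have := dg zz xz; have /BE := Bx; have : `|y - T z| < d / 4 by [].
  lra.
pose fm := isFun.Build _ _ _ _ f fB.
pose ff : {fun B >-> B} := HB.pack f fm.
have [|||x Bx xE] := @banach_fixed_point R E B ff.
- exists (2^-1)%:nng; split; first by rewrite /= invf_lt1 // ltr1n.
  move=> [a b] [/= /Bd az /Bd bz]; have := dg bz az.
  rewrite (_ : f a - f b = - (g a - g b)) ?normrN //.
  by apply/rowP => i; rewrite /f /g !mxE; ring.
- exact: closed_ball_closed.
- by exists z; apply/BE; rewrite subrr normr0 ltW.
exists x; first exact: Bd.
move: xE; rewrite /= /f /g => xE; apply/rowP => i; move: xE => /rowP/(_ i).
by rewrite !mxE; lra.
Qed.

Let psi (y : E) : E := xget z [set x | `|x - z| < d /\ T x = y].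

Let psiP y : V y -> `|psi y - z| < d /\ T (psi y) = y.
Proof.
move=> Vy; have [x xz xy] := T_onto Vy.
exact: (@xgetPex _ z [set x | `|x - z| < d /\ T x = y] (ex_intro _ x (conj xz xy))).
Qed.

Let psiK x : U' x -> psi (T x) = x.
Proof.
move=> [xz VTx]; have [pz pE] := psiP VTx.
have := T_expand xz pz; rewrite pE subrr normr0 mulr0 normr_le0 subr_eq0.
by move=> /eqP.
Qed.

Let oV : open V.
Proof.
have -> : V = ball (T z) (d / 4).
  by rewrite -ball_normE; apply/seteqP; split=> y /=; rewrite /V /= distrC.
exact: ball_open.
Qed.

Let oU' : open U'.
Proof.
rewrite openE => x [xz VTx].
have cT : {for x, continuous T} by exact/(sT 0)/dU.
have := cT _ (open_nbhs_nbhs (conj oV VTx)).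
have : \forall y \near x, `|y - z| < d.
  have : open_nbhs x (ball z d).
    by split; [exact: ball_open|rewrite -ball_normE /= distrC].
  by move=> /open_nbhs_nbhs; apply: filterS => y; rewrite -ball_normE /= distrC.
by move=> h1 h2; exact: filterI h1 h2.
Qed.

Let J (x : E) : 'M[R]_m := \matrix_(i, j) ('D_(delta_mx 0 i) T x) 0 j.

Let JE x v : U x -> 'd T x v = v *m J x.
Proof.
move=> Ux; have [df _] := sT 1.
rewrite [v in LHS]row_sum_delta linear_sum /=; apply/rowP => j.
rewrite summxE !mxE; apply: eq_bigr => i _.
by rewrite linearZ !mxE (deriveE _ (df x Ux)).
Qed.

Let uJ x : `|x - z| < d -> J x \in unitmx.
Proof.
move=> xz; rewrite -row_free_unit; apply: inj_row_free => v vJ.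
have dTx : differentiable T x by have [+ _] := sT 1; apply; exact: dU.
have q0 : 0 < (4^-1 : R) by rewrite invr_gt0.
have nz : \forall y \near x, `|y - z| < d.
  have : open_nbhs x (ball z d).
    by split; [exact: ball_open|rewrite -ball_normE /= distrC].
  by move=> /open_nbhs_nbhs; apply: filterS => y; rewrite -ball_normE /= distrC.
have /near_ballP[r r0 rP] : \forall y \near x, `|y - z| < d /\
    `|T y - T x - 'd T x (y - x)| <= 4^-1 * `|y - x|.
  by apply: filterI nz (diff_near dTx q0).
apply/eqP; rewrite -normr_le0.
have [->|v0] := eqVneq v 0; first by rewrite normr0.
have nv : 0 < `|v| by rewrite normr_gt0.
(* A kernel vector of length r / 2 would be contracted by T, against T_expand. *)
pose t := r / (2 * `|v|); have t0 : 0 < t by rewrite divr_gt0 // mulr_gt0.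
have tv : `|t *: v| = r / 2.
  by rewrite normrZ gtr0_norm // /t; field; rewrite gt_eqF.
have [|yz] := rP (x + t *: v).
  by rewrite addrC addKr tv; lra.
have -> : x + t *: v - x = t *: v by rewrite addrC addKr.
rewrite linearZ /= JE ?vJ ?scaler0 ?subr0; last exact: dU.
have := T_expand xz yz; have -> : x + t *: v - x = t *: v by rewrite addrC addKr.
rewrite tv; lra.
Qed.

Let dpsi y : V y -> differentiable psi y /\
  'd psi y = (fun k => k *m invmx (J (psi y))) :> (E -> E).
Proof.
move=> Vy; have [pz pE] := psiP Vy; set x := psi y in pz pE *.
set L := fun k => _.
have linL : linear L by move=> a u v; rewrite /L mulmxDl scalemxAl.
have cL : continuous L by apply: framed_continuous => //; exact: framed_rV.
have [K K0 KP] := linear_bound linL cL.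
have dTx : differentiable T x by have [+ _] := sT 1; apply; exact: dU.
apply: diff_nearP => // e e0.
have e'0 : 0 < e / (2 * K) by rewrite divr_gt0 // mulr_gt0.
have /near_ballP[r r0 rP] := diff_near dTx e'0.
have nV : \forall y' \near y, V y' by exact: open_nbhs_nbhs.
have nr : \forall y' \near y, `|y' - y| < r / 2.
  by apply/near_ballP; exists (r / 2) => //; rewrite divr_gt0.
apply: filterS2 nV nr => y' Vy' y'r; have [pz' pE'] := psiP Vy'.
set x' := psi y' in pz' pE' *.
have := T_expand pz pz'; rewrite pE pE' => xy.
have := rP x'; rewrite pE' pE => /(_ _)/Wrap[|h]; first by lra.
rewrite -/x (_ : x' - x - L (y' - y) = - L (y' - y - 'd T x (x' - x))); last first.
  rewrite /L mulmxBl JE ?mulmxK ?uJ //; last exact: dU.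
  by rewrite [in RHS]mulmxBl (mulmxK (uJ pz)) [in RHS]mulmxBl [RHS]opprB.
rewrite normrN; apply: le_trans (KP _) _.
apply: (@le_trans _ _ (K * (e / (2 * K) * `|x' - x|))).
  by rewrite ler_wpM2l // ltW.
have -> : K * (e / (2 * K) * `|x' - x|) = e * (`|x' - x| / 2).
  by field; rewrite gt_eqF.
rewrite ler_wpM2l ?(ltW e0) //; lra.
Qed.

Let spsi : smooth V psi.
Proof.
have U'x y : V y -> U' (psi y).
  by move=> Vy; have [pz pE] := psiP Vy; split=> //; rewrite pE.
elim=> [|k IH].
  by move=> y /dpsi[dp _]; exact: differentiable_continuous.
split=> [y /dpsi[]//|v].
pose q (x : E) : E := v *m invmx (J x).
apply: (@Ck_ext _ _ _ _ _ (q \o psi)) => //.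
  by move=> y Vy; have [dp dpE] := dpsi Vy; rewrite deriveE // dpE.
apply: (@Ck_comp _ _ _ _ _ _ U') => //; first exact: framed_rV.
apply: Ck_rV => // j; rewrite /q.
apply: Ck_mulmx => //.
  by move=> i' j'; exact: Ck_cst.
apply: Ck_invmx => //; first by move=> x [xz _]; exact: uJ.
move=> i' j'; rewrite /J; under eq_fun do rewrite mxE.
apply: Ck_rV_coord => //.
have [_ /(_ (delta_mx 0 i'))] := sT k.+1.
by apply: CkW => x [xz _]; exact: dU.
Qed.

Lemma inverse_function_rV : exists (U1 V1 : set E) (psi1 : E -> E),
  [/\ U1 z, U1 `<=` U & smooth_diffeo U1 V1 T psi1].
Proof.
exists U', V, psi; split.
- by split; rewrite ?subrr ?normr0 //= /V /= subrr normr0 divr_gt0.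
- by move=> x [xz _]; exact: dU.
- split => //.
  + by move=> k; apply: CkW (sT k) => x [xz _]; exact: dU.
  + by move=> x Ux; split; [case: Ux|exact: psiK].
  + by move=> y Vy; have [pz pE] := psiP Vy; split=> //; split=> //; rewrite pE.
Qed.

End InverseFunction.

Section InverseFunctionFramed.
Variable R : realType.

(** With [co] the coordinates in a spanning family and [ev] the evaluation of
    a combination, [co \o ev] is an idempotent matrix; its row space, read in a
    row basis, is a faithful copy of [E]. *)
Lemma framed_iso (E : normedModType R) : framed E ->
  exists m (i : E -> 'rV[R]_m) (j : 'rV[R]_m -> E),
    [/\ linear i, linear j, cancel i j & cancel j i].
Proof.
move=> [p [e [c [linc _ yE]]]].
pose co x : 'rV[R]_p := \row_k c k x.
pose ev (v : 'rV[R]_p) : E := \sum_k v 0 k *: e k.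
have linco : linear co by move=> a u v; apply/rowP => k; rewrite !mxE linc.
have linev : linear ev.
  move=> a u v; rewrite /ev scaler_sumr -big_split; apply: eq_bigr => k _.
  by rewrite !mxE scalerDl scalerA.
have evco x : ev (co x) = x by rewrite [RHS]yE; apply: eq_bigr => k _; rewrite mxE.
pose Pi : 'M[R]_p := \matrix_k co (e k).
have coev v : co (ev v) = v *m Pi.
  apply/rowP => l; rewrite !mxE /ev.
  rewrite (is_linear_sum (linc l)); apply: eq_bigr => k _.
  by rewrite (is_linearZ (linc l)) !mxE.
have coPi x : (co x <= Pi)%MS.
  by rewrite -[x]evco coev submxMl.
pose B := row_base Pi.
have BPi (v : 'rV_(\rank Pi)) : (v *m B) *m Pi = v *m B.
  have /submxP[w ->] : (v *m B <= Pi)%MS.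
    by rewrite (submx_trans (submxMl _ _)) // eq_row_base.
  by rewrite -coev -[w *m Pi]coev evco.
exists (\rank Pi), (fun x => co x *m pinvmx B), (fun v => ev (v *m B)); split.
- by move=> a u v; rewrite linco mulmxDl scalemxAl.
- by move=> a u v; rewrite mulmxDl -scalemxAl linev.
- by move=> x; rewrite mulmxKpV ?evco // eq_row_base.
- by move=> v; rewrite coev BPi mulmxKp // row_base_free.
Qed.

Lemma inverse_function (E : normedModType R) (T : E -> E) (U : set E) (z : E) :
  framed E -> open U -> U z -> smooth U T -> 'd T z = id :> (E -> E) ->
  exists (U1 V1 : set E) (psi1 : E -> E),
    [/\ U1 z, U1 `<=` U & smooth_diffeo U1 V1 T psi1].
Proof.
move=> fE oU Uz sT dT; have [m [i [j [li lj ij ji]]]] := framed_iso fE.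
have fV := @framed_rV R m.
have ci : continuous i by exact: framed_continuous.
have cj : continuous j by exact: framed_continuous.
have [dj djE] := diff_linear (i z) lj cj.
have dTz : differentiable T z by have [+ _] := sT 1; exact.
have [di diE] := diff_linear (T z) li ci.
have oU' : open (j @^-1` U) by apply: open_comp => // x _; exact: cj.
have [|||U1 [V1 [psi [U1z U1U [[oU1 oV1] sT1 spsi T1 T2]]]]] :=
    @inverse_function_rV R m (i \o T \o j) (j @^-1` U) (i z) oU'.
- by rewrite /= ij.
- move=> k; apply: (@Ck_comp _ _ _ _ _ _ U) => //; first exact: Ck_linear.
  exact: Ck_comp_linear.
- have dTj : differentiable T (j (i z)) by rewrite ij.
  have dTij : differentiable (T \o j) (i z) by exact: differentiable_comp.
  have di' : differentiable i ((T \o j) (i z)) by rewrite /= ij.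
  rewrite -compA (diff_comp dTij di') (diff_comp dj dTj).
  by apply/funext => v /=; rewrite djE ij diE dT ji.
have oiU1 : open (i @^-1` U1) by apply: open_comp => // x _; exact: ci.
have oiV1 : open (i @^-1` V1) by apply: open_comp => // x _; exact: ci.
exists (i @^-1` U1), (i @^-1` V1), (j \o psi \o i).
have UU : i @^-1` U1 `<=` U by move=> x /= /U1U /=; rewrite ij.
split=> //; split=> //.
- by move=> k; exact: CkW (sT k).
- move=> k; apply: (@Ck_comp _ _ _ _ _ _ V1) => //; last exact: Ck_comp_linear.
  exact: Ck_linear.
- by move=> x /= /T1 /=; rewrite ij => -[? ->].
- by move=> y /= /T2[/= Up iT]; split; [rewrite /= ji|rewrite -[RHS]ij -[in RHS]iT ij].
Qed.

End InverseFunctionFramed.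

(** * Smooth division by a linear form *)

(** Integrals over the unit interval of continuous functions, which is all that
    the integral remainder of the division lemma requires. *)
Section UnitInterval.
Variable R : realType.
Implicit Types (f g : R -> R).

Definition cont01 f := forall s, s \in `[0, 1] -> {for s, continuous f}.

Definition int01 f : R := \int[@lebesgue_measure R]_(s in `[0, 1]%classic) f s.

Lemma cont01_within f : cont01 f -> {within `[0, 1], continuous f}.
Proof.
by move=> cf; apply: continuous_in_subspaceT => x; rewrite inE => /cf.
Qed.

Lemma cont01_integrable f : cont01 f ->
  (@lebesgue_measure R).-integrable `[0, 1]%classic (EFin \o f).
Proof.
move=> cf; apply: continuous_compact_integrable; first exact: segment_compact.
exact: cont01_within.
Qed.

Lemma int01P a f g : cont01 f -> cont01 g ->
  int01 (fun s => a * f s + g s) = a * int01 f + int01 g.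
Proof.
move=> cf cg.
have caf : cont01 (fun s => a * f s).
  by move=> s s01; apply: cvgM; [exact: cvg_cst|exact: cf].
rewrite /int01 RintegralD //; try exact: cont01_integrable.
by rewrite RintegralZl //; exact: cont01_integrable.
Qed.

Lemma cont01P a f g : cont01 f -> cont01 g -> cont01 (fun s => a * f s + g s).
Proof.
move=> cf cg s s01; apply: cvgD; last exact: cg.
by apply: cvgM; [exact: cvg_cst|exact: cf].
Qed.

Lemma cont01Z a f : cont01 f -> cont01 (fun s => a * f s).
Proof. by move=> cf s s01; apply: cvgM; [exact: cvg_cst|exact: cf]. Qed.

Lemma int01_cst a : int01 (cst a) = a.
Proof.
have m01 : @lebesgue_measure R `[0, 1]%classic = 1%:E.
  by rewrite lebesgue_measure_itv /= lte_fin ltr01 -EFinB subr0.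
by rewrite /int01 Rintegral_cst //= m01 mulr1.
Qed.

Lemma int01Z a f : cont01 f -> int01 (fun s => a * f s) = a * int01 f.
Proof. by move=> cf; rewrite /int01 RintegralZl //; exact: cont01_integrable. Qed.

Lemma int01_le f e : cont01 f -> (forall s, s \in `[0, 1] -> `|f s| <= e) ->
  `|int01 f| <= e.
Proof.
move=> cf fe.
have cnf : cont01 (fun s => `|f s|).
  by move=> s s01; apply: cvg_norm; exact: cf.
have cc : cont01 (cst e) by move=> s _; exact: cvg_cst.
apply: le_trans (le_normr_Rintegral _ _) _ => //; first exact: cont01_integrable.
rewrite -[leRHS]int01_cst; apply: le_Rintegral => //; exact: cont01_integrable.
Qed.

Lemma int01_FTC (f F : R -> R) : cont01 f ->
  (forall s : R, s \in `[0, 1] -> is_derive s 1 F (f s)) -> int01 f = F 1 - F 0.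
Proof.
move=> cf dF; rewrite /int01 /Rintegral (@continuous_FTC2 R f F 0 1) //.
- exact: cont01_within.
- have cF s : s \in `[0, 1] -> {for s, continuous F}.
    by move=> /dF[d _]; exact/differentiable_continuous/derivable1_diffP.
  split.
  + by move=> s /subset_itv_oo_cc /dF[].
  + by apply: cvg_at_right_filter; apply: cF; rewrite in_itv /= lexx ler01.
  + by apply: cvg_at_left_filter; apply: cF; rewrite in_itv /= lexx ler01.
- by move=> s /subset_itv_oo_cc /dF[_ <-]; rewrite derive1E.
Qed.

(** The tube lemma for the compact unit interval. *)
Lemma near01 (E : normedModType R) (x : E) (P : R -> E -> Prop) :
  (forall s : R, s \in `[0, 1] -> \forall p \near (s, x), P p.1 p.2) ->
  \forall y \near x, forall s : R, s \in `[0, 1] -> P s y.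
Proof.
move=> h; have /compact_near_coveringP ncov := @segment_compact R 0 1.
have := ncov E (nbhs x) (fun y s => P s y) _.
apply=> s s01.
exact: h.
Qed.

End UnitInterval.

Section ParametricIntegral.
Variables (R : realType) (E : normedModType R) (l : E -> R) (w : E).
Hypotheses (fE : framed E) (linl : linear l).

Let cl : continuous l. Proof. exact: framed_continuous. Qed.

(** The path from the projection of [x] on the kernel of [l] along [w], at
    [s = 0], to [x] itself, at [s = 1], when [l w = 1]. *)
Definition shear (s : R) (x : E) : E := x - ((1 - s) * l x) *: w.

(** The powers of [1 - s] make this family of integrals stable under
    differentiation: differentiating [phi (shear s x)] produces one more
    factor [1 - s] (see [shear_int_diff]). *)
Definition shear_int m (phi : E -> R) (x : E) : R :=
  int01 (fun s => (1 - s) ^+ m * phi (shear s x)).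

Lemma shear_linear s : linear (shear s).
Proof.
move=> a u v; rewrite /shear linl scalerBr scalerA mulrDr scalerDl opprD.
by rewrite [a *: l u]/(_ *: _) mulrCA addrACA.
Qed.

Lemma shear_continuous (p : R * E) :
  {for p, continuous (fun p : R * E => shear p.1 p.2)}.
Proof.
apply: cvgB; first exact: cvg_snd.
apply: cvgZr_tmp; apply: cvgM.
  by apply: cvgB; [exact: cvg_cst|exact: cvg_fst].
by apply: continuous_comp; [exact: cvg_snd|exact: cl].
Qed.

Lemma shear_bound : exists2 C : R, 0 < C &
  forall s x, s \in `[0, 1] -> `|shear s x| <= C * `|x|.
Proof.
have [K K0 KP] := linear_bound linl cl.
exists (1 + K * `|w|); first by rewrite ltr_pwDl // mulr_ge0 // ltW.
move=> s x; rewrite in_itv /= => /andP[s0 s1].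
rewrite mulrDl mul1r; apply: le_trans (ler_normB _ _) _; rewrite lerD2l.
rewrite normrZ mulrAC ler_wpM2r // normrM; apply: le_trans (KP x).
by rewrite ger0_norm ?subr_ge0 // ler_piMl //; lra.
Qed.

Variables (U W : set E).
Hypotheses (oU : open U) (oW : open W).
Hypothesis WU : forall x s, W x -> s \in `[0, 1] -> U (shear s x).

Lemma shear_int_cont m phi x s : Ck 0 U phi -> W x -> s \in `[0, 1] ->
  {for (s, x), continuous (fun p : R * E => (1 - p.1) ^+ m * phi (shear p.1 p.2))}.
Proof.
move=> cphi Wx s01; apply: cvgM.
  apply: (@continuous_comp _ _ _ (fun p : R * E => 1 - p.1) (fun t => t ^+ m)).
    by apply: cvgB; [exact: cvg_cst|exact: cvg_fst].
  exact: exprn_continuous.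
apply: (@continuous_comp _ _ _ (fun p : R * E => shear p.1 p.2) phi).
  exact: shear_continuous.
exact/cphi/WU.
Qed.

Lemma shear_int_cont01 m phi x : Ck 0 U phi -> W x ->
  cont01 (fun s => (1 - s) ^+ m * phi (shear s x)).
Proof.
move=> cphi Wx s s01.
apply: (@continuous_comp _ _ _ (fun s : R => (s, x))
  (fun p : R * E => (1 - p.1) ^+ m * phi (shear p.1 p.2))).
  have c2 : (fun s : R => (s, x)) @ s --> (s, x).
    by apply: (@cvg_pair _ _ _ _ (nbhs s) (nbhs x)); [exact: cvg_id|exact: cvg_cst].
  exact: c2.
exact: shear_int_cont.
Qed.

Lemma shear_int_C0 m phi : Ck 0 U phi -> Ck 0 W (shear_int m phi).
Proof.
move=> cphi x Wx; apply/cvgrPdist_le => e e0.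
have e20 : 0 < e / 2 by rewrite divr_gt0.
pose h (p : R * E) := (1 - p.1) ^+ m * phi (shear p.1 p.2).
have : \forall y \near x, forall s : R, s \in `[0, 1] -> `|h (s, x) - h (s, y)| <= e.
  apply: near01 => s s01.
  have ch := @shear_int_cont m phi x s cphi Wx s01.
  have /cvgrPdist_le/(_ _ e20) nh : h @ (s, x) --> h (s, x) by exact: ch.
  have c2 : (fun p : R * E => (p.1, x)) @ (s, x) --> (s, x).
    by apply: (@cvg_pair _ _ _ _ (nbhs s) (nbhs x)); [exact: cvg_fst|exact: cvg_cst].
  have nh2 := c2 _ nh.
  apply: filterS2 nh nh2 => -[s' y] /= h1 h2.
  rewrite (_ : h (s', x) - h (s', y) = (h (s, x) - h (s', y)) - (h (s, x) - h (s', x))).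
    by apply: le_trans (ler_normB _ _) _; lra.
  by rewrite opprB [RHS]addrC addrA subrK.
have nW : \forall y \near x, W y by exact: open_nbhs_nbhs.
apply: filterS2 nW => y Wy hy.
rewrite /shear_int -[int01 _ - _]addrC -mulN1r -int01P; try exact: shear_int_cont01.
apply: int01_le => [s s01|s s01].
  apply: cvgD; last exact: shear_int_cont01.
  by apply: cvgM; [exact: cvg_cst|exact: shear_int_cont01].
by rewrite mulN1r addrC; exact: hy.
Qed.

Let shear_diff phi s x v : Ck 1 U phi -> W x -> s \in `[0, 1] ->
  'd phi (shear s x) (shear s v) =
  'D_v phi (shear s x) - (1 - s) * l v * 'D_w phi (shear s x).
Proof.
move=> [dphi _] Wx s01; have d1 := dphi _ (WU Wx s01).
by rewrite !deriveE //; set z := shear s x; rewrite /shear linearB linearZ.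
Qed.

(** Differentiation under the integral sign, with
    [shear s v = v - (1 - s) (l v) w]. *)
Definition shear_int_diff m (phi : E -> R) (x v : E) : R :=
  shear_int m ('D_v phi) x - l v * shear_int m.+1 ('D_w phi) x.

Let cont01_D m phi x v : Ck 1 U phi -> W x ->
  cont01 (fun s => (1 - s) ^+ m * 'D_v phi (shear s x)).
Proof. by move=> [_ C1] Wx; exact: (@shear_int_cont01 m _ x (C1 v) Wx). Qed.

Let shear_int_D_linear m phi x a u v : Ck 1 U phi -> W x ->
  shear_int m ('D_(a *: u + v) phi) x =
  a * shear_int m ('D_u phi) x + shear_int m ('D_v phi) x.
Proof.
move=> Cphi Wx; rewrite -int01P; try exact: cont01_D.
apply: eq_Rintegral => s; rewrite inE => s01.
have [dphi _] := Cphi; have d1 := dphi _ (WU Wx s01).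
by rewrite !deriveE // linearP /= mulrDr mulrCA.
Qed.

(** By strict differentiability of [phi] at each point of the segment and the
    tube lemma, the first-order remainder of the integrand is small uniformly
    in [s]. *)
Lemma shear_int_differentiable m phi x : Ck 1 U phi -> W x ->
  differentiable (shear_int m phi) x /\
  'd (shear_int m phi) x = shear_int_diff m phi x :> (E -> R).
Proof.
move=> Cphi Wx; have [dphi C1] := Cphi; have C0 := CkS Cphi.
have lin : linear (shear_int_diff m phi x).
  move=> a u v; rewrite /shear_int_diff shear_int_D_linear // linl.
  have H (p q r lu lv : R) :
    a * p + q - (a *: lu + lv) * r = a *: (p - lu * r) + (q - lv * r).
    by rewrite -[a *: lu]/(a * lu) -[a *: (p - _)]/(a * (p - _)); ring.
  exact: H.
apply: diff_nearP => //; first exact: framed_continuous.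
move=> e e0; have [C C0' CP] := shear_bound.
have e'0 : 0 < e / (2 * C) by rewrite divr_gt0 // mulr_gt0.
have : \forall y \near x, forall s : R, s \in `[0, 1] -> s \in `[0, 1] ->
    `|phi (shear s y) - phi (shear s x) - 'd phi (shear s x) (shear s (y - x))|
    <= e * `|y - x|.
  apply: near01 => s0 s01; have Uz := WU Wx s01.
  have [d1 d10 d1P] := strict_diff fE (@framed_R R) oU Cphi Uz e'0.
  have [d2 d20 d2P] := diff_close fE oU Cphi Uz e'0.
  pose d := Num.min d1 d2; have d0 : 0 < d by rewrite lt_min d10.
  have cs : (fun p : R * E => shear p.1 p.2) @ (s0, x) --> shear s0 x.
    exact: (@shear_continuous (s0, x)).
  have /cvgrPdist_lt/(_ _ d0) nh := cs.
  have c2 : (fun p : R * E => (p.1, x)) @ (s0, x) --> (s0, x).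
    by apply: (@cvg_pair _ _ _ _ (nbhs s0) (nbhs x)); [exact: cvg_fst|exact: cvg_cst].
  have nh2 := c2 _ nh.
  apply: filterS2 nh nh2 => -[s y] /=; rewrite ![`|shear s0 x - _|]distrC.
  rewrite !lt_min => /andP[y1 y2] /andP[x1 x2] ss.
  have uE : shear s (y - x) = shear s y - shear s x.
    by rewrite -[y - x]addrC -scaleN1r shear_linear scaleN1r addrC.
  have := d1P _ _ x1 y1; have [_ /(_ (shear s (y - x)))] := d2P _ x2.
  rewrite -uE; set A := 'd phi (shear s x) _; set B := 'd phi (shear s0 x) _ => h1 h2.
  have -> : phi (shear s y) - phi (shear s x) - A =
    (phi (shear s y) - phi (shear s x) - B) - (A - B) by ring.
  apply: le_trans (ler_normB _ _) _.
  apply: (@le_trans _ _ (2 * (e / (2 * C) * (C * `|y - x|)))).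
    have : e / (2 * C) * `|shear s (y - x)| <= e / (2 * C) * (C * `|y - x|).
      by rewrite ler_wpM2l ?(ltW e'0) // CP.
    lra.
  rewrite le_eqVlt; apply/orP; left; apply/eqP; field; exact: lt0r_neq0.
have nW : \forall y \near x, W y by exact: open_nbhs_nbhs.
apply: filterS2 nW => y Wy hy.
have -> : shear_int m phi y - shear_int m phi x - shear_int_diff m phi x (y - x) =
  int01 (fun s => l (y - x) * ((1 - s) ^+ m.+1 * 'D_w phi (shear s x)) +
    (-1 * ((1 - s) ^+ m * 'D_(y - x) phi (shear s x)) +
     (-1 * ((1 - s) ^+ m * phi (shear s x)) + (1 - s) ^+ m * phi (shear s y)))).
  have c1 := @shear_int_cont01 m _ x C0 Wx; have c2 := @shear_int_cont01 m _ y C0 Wy.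
  have c3 := @cont01_D m _ x (y - x) Cphi Wx; have c4 := @cont01_D m.+1 _ x w Cphi Wx.
  rewrite !int01P //; try by do ?[exact: cont01P | apply: cont01P => //].
  have H (p q r t z : R) : p - q - (r - t * z) = t * z + (-1 * r + (-1 * q + p)).
    by ring.
  exact: H.
apply: int01_le => [|s s01].
  apply: cont01P; first exact: cont01_D.
  apply: cont01P; first exact: cont01_D.
  by apply: cont01P; exact: shear_int_cont01.
rewrite (_ : _ + _ = (1 - s) ^+ m * (phi (shear s y) - phi (shear s x)
    - 'd phi (shear s x) (shear s (y - x)))).
  rewrite normrM -[leRHS]mul1r; apply: ler_pM => //; last exact: hy.
  rewrite normrX exprn_ile1 //; move: s01; rewrite in_itv /= => /andP[s0 s1].
  by rewrite ger0_norm; lra.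
by rewrite shear_diff // exprS; ring.
Qed.

Lemma shear_int_Ck k m phi : Ck k U phi -> Ck k W (shear_int m phi).
Proof.
elim: k m phi => [|k IH] m phi; first exact: shear_int_C0.
move=> Cphi; have C1 : Ck 1 U phi.
  by elim: (k) Cphi => // k' IHk /CkS.
have [_ C2] := Cphi; split=> [x Wx|v].
  by have [] := shear_int_differentiable m C1 Wx.
apply: (@Ck_ext _ _ _ _ _ (fun x => shear_int m ('D_v phi) x - l v * shear_int m.+1 ('D_w phi) x)) => //.
  move=> x Wx; have [d dE] := shear_int_differentiable m C1 Wx.
  by rewrite deriveE // dE.
apply: Ck_sub => //; first exact/IH/C2.
apply: Ck_mul => //; first exact: Ck_cst.
exact/IH/C2.
Qed.

End ParametricIntegral.

(** Away from the kernel of [l] the quotient is smooth. Near a point of the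
    kernel it is the integral of the derivative of [phi] along [w] over the
    segment from the projection on the kernel to [x], by the fundamental
    theorem of calculus. These segments lie in [O] only near such a
    point, so the quotient is defined by cases and its smoothness is checked
    one point at a time. *)
Lemma smooth_division (R : realType) (E : normedModType R) (l : E -> R) (w : E)
    (O : set E) (phi : E -> R) :
  framed E -> linear l -> l w = 1 -> open O -> smooth O phi ->
  (forall x, O x -> l x = 0 -> phi x = 0) ->
  exists psi : E -> R, smooth O psi /\ forall x, O x -> phi x = l x * psi x.
Proof.
move=> fE linl lw oO sphi phi0; have cl := framed_continuous fE linl.
(* The derivative along w is the limit of the quotient on the kernel. *)
pose psi x := if l x == 0 then 'D_w phi x else phi x / l x.
exists psi; split; last first.
  move=> x Ox; rewrite /psi; case: eqP => [lx0|/eqP lx0].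
    by rewrite lx0 mul0r phi0.
  by rewrite mulrCA divff // mulr1.
move=> k; apply: Ck_pointwise => x0 Ox0; case: (eqVneq (l x0) 0) => lx0; last first.
  pose N := O `&` l @^-1` [set~ 0].
  have oN : open N.
    apply: openI => //; apply: open_comp => [x _|]; first exact: cl.
    exact/closed_openC/closed_eq.
  apply: (@CkW _ _ _ _ N); first by move=> _ ->; split => //; exact/eqP.
  apply: (@Ck_ext _ _ _ _ _ (fun x => phi x * (l x)^-1)) => //.
    by move=> x [_ /= /eqP lx]; rewrite /psi (negbTE lx).
  apply: Ck_mul => //; first by apply: CkW (sphi k) => x [].
  apply: Ck_inv => //; first by move=> x [_ /= /eqP].
  exact: Ck_linear.
have [C C0 CP] := shear_bound w fE linl.
have /near_ballP[r r0 rO] : \forall y \near x0, O y by exact: open_nbhs_nbhs.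
have oball d : open [set x | `|x - x0| < d].
  have -> : [set x | `|x - x0| < d] = ball x0 d.
    by rewrite -ball_normE; apply/seteqP; split=> y /=; rewrite distrC.
  exact: ball_open.
pose U := [set x | `|x - x0| < r]; pose W := [set x | `|x - x0| < r / C].
have WU x s : W x -> s \in `[0, 1] -> U (shear l w s x).
  move=> Wx s01; rewrite /U /=.
  have -> : shear l w s x - x0 = shear l w s (x - x0).
    have sx0 : shear l w s x0 = x0 by rewrite /shear lx0 mulr0 scale0r subr0.
    have := shear_linear w linl s 1 (x - x0) x0; rewrite !scale1r subrK sx0 => ->.
    by rewrite addrK.
  by apply: le_lt_trans (CP _ _ s01) _; rewrite mulrC -ltr_pdivlMr.
have UO : U `<=` O by move=> x /rO.
have s1 : 1 \in `[(0 : R), 1] by rewrite in_itv /= ler01 lexx.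
have s0 : 0 \in `[(0 : R), 1] by rewrite in_itv /= ler01 lexx.
have W0 : W x0 by rewrite /W /= subrr normr0 divr_gt0.
apply: (@CkW _ _ _ _ W); first by move=> _ ->.
have sU : smooth U phi by move=> k'; exact: CkW (sphi k').
have dphi x : U x -> differentiable phi x by move=> Ux; have [+ _] := sU 1; exact.
apply: (@Ck_ext _ _ _ _ _ (shear_int l w 0 ('D_w phi))) => [|x Wx|].
- exact: oball.
- have C1 := sU 1; have [_ /(_ w) cD] := C1.
  have cc := @shear_int_cont01 _ _ l w fE linl U W WU 0 _ x cD Wx.
  rewrite /psi; case: eqP => [lx|/eqP lx].
    rewrite -[RHS]int01_cst; apply: eq_Rintegral => s _.
    by rewrite expr0 mul1r /shear lx mulr0 scale0r subr0.
  apply: (mulIf lx); rewrite divfK // mulrC -int01Z //.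
  pose a := x - l x *: w; pose u := l x *: w.
  have sh s : shear l w s x = a + s *: u.
    rewrite /shear /a /u scalerA mulrBl mul1r scalerBl opprB addrA.
    by rewrite addrAC.
  have -> : int01 (fun s => l x * ((1 - s) ^+ 0 * 'D_w phi (shear l w s x))) =
      phi (a + 1 *: u) - phi (a + 0 *: u).
    apply: (@int01_FTC _ _ (fun s => phi (a + s *: u))).
      exact: cont01Z.
    move=> s s01; have := WU _ _ Wx s01; rewrite sh => /dphi d1.
    have -> : l x * ((1 - s) ^+ 0 * 'D_w phi (a + s *: u)) = 'd phi (a + s *: u) u.
      rewrite expr0 mul1r deriveE //; apply/esym.
      exact: linearZZ.
    exact: derive_segment.
  rewrite scale1r scale0r addr0 /a subrK [phi (_ - _)]phi0 ?subr0 //.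
    by have := UO _ (WU x 0 Wx s0); rewrite sh scale0r addr0.
  by rewrite addrC -scaleNr linl lw -[_ *: 1]/(_ * 1) mulr1 addNr.
- apply: (@shear_int_Ck _ _ _ _ fE linl U W) => //; try exact: oball.
  by have [_ /(_ w)] := sU k.+1.
Qed.

(** * Interpolation with symmetric coefficients *)

Section Interpolation.
Variables (R : realType).

Lemma vanish_line (E : normedModType R) (f : E -> R) (x v : E) :
  {for x, continuous f} -> (\forall t \near (0 : R)^', f (x + t *: v) = 0) ->
  f x = 0.
Proof.
move=> cf f0.
have c1 : (fun t : R => x + t *: v) @ (0 : R) --> x.
  rewrite -[X in _ --> X]addr0 -[X in _ --> _ + X](scale0r v).
  by apply: cvgD; [exact: cvg_cst|apply: cvgZr_tmp; exact: cvg_id].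
have c2 : (fun t : R => f (x + t *: v)) @ (0 : R)^' --> f x.
  by apply: cvg_within_filter; apply: (cvg_comp _ _ c1); exact: cf.
have c3 : (fun t : R => f (x + t *: v)) @ (0 : R)^' --> 0.
  exact: cvg_near_cst.
exact: (cvg_unique _ c2 c3).
Qed.

Lemma near_line (E : normedModType R) (O : set E) (x v : E) : open O -> O x ->
  \forall t \near (0 : R)^', O (x + t *: v).
Proof.
move=> oO Ox.
have c1 : (fun t : R => x + t *: v) @ (0 : R) --> x.
  rewrite -[X in _ --> X]addr0 -[X in _ --> _ + X](scale0r v).
  by apply: cvgD; [exact: cvg_cst|apply: cvgZr_tmp; exact: cvg_id].
by apply: cvg_within; apply: c1; exact: open_nbhs_nbhs.
Qed.

Variable n : nat.
Local Notation E := 'rV[R]_n.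

Let crd_linear (i j : 'I_n) : linear (fun x : E => x 0 i - x 0 j).
Proof.
move=> a u v; rewrite !mxE -[_ *: (_ - _)]/(a * _); ring.
Qed.

(** The factors are divided out one by one. After division by the factor of
    [p], the quotient must still vanish on the hyperplane of another pair [q].
    Off the hyperplane of [p] this is clear; at a point of both, one moves
    along a coordinate that belongs to [p] and not to [q], which leaves the
    first hyperplane but not the second, and concludes by continuity. *)
Lemma smooth_division_pairs (O : set E) (r : seq ('I_n * 'I_n)) (phi : E -> R) :
  open O -> uniq r -> all (fun p : 'I_n * 'I_n => (p.1 < p.2)%N) r -> smooth O phi ->
  (forall p x, p \in r -> O x -> x 0 p.1 = x 0 p.2 -> phi x = 0) ->
  exists psi : E -> R, smooth O psi /\
    forall x, O x -> phi x = (\prod_(p <- r) (x 0 p.2 - x 0 p.1)) * psi x.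
Proof.
move=> oO; elim: r phi => [|p r IH] phi.
  by move=> _ _ sphi _; exists phi; split=> // x _; rewrite big_nil mul1r.
move=> /= /andP[pr ur] /andP[p12 ar] sphi phi0.
have e12 : (p.1 == p.2) = false by rewrite -(inj_eq val_inj) (ltn_eqF p12).
have e21 : (p.2 == p.1) = false by rewrite eq_sym.
have [|x Ox px|psi1 [spsi1 psi1E]] := smooth_division (w := delta_mx 0 p.2)
    (@framed_rV R n) (@crd_linear p.2 p.1) _ oO sphi.
- by rewrite !mxE !eqxx /= e12 subr0.
- by apply: (phi0 p x) => //; [exact: mem_head|apply/esym/subr0_eq].
have [|psi [spsi psiE]] := IH psi1 ur ar spsi1.
- move=> q x qr Ox xq.
  have neq : q != p by apply: contraNneq pr => <-.
  have q12 : (q.1 < q.2)%N by exact: (allP ar).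
    (* A coordinate that moves the pair p and leaves the pair q alone. *)
  have [a ap aq] : exists2 a, (a == p.1) || (a == p.2) & (a != q.1) && (a != q.2).
    case: (boolP ((p.1 != q.1) && (p.1 != q.2))) => [h|].
      by exists p.1; rewrite ?eqxx.
    rewrite negb_and !negbK => h; exists p.2; first by rewrite eqxx orbT.
    case/orP: h => /eqP h; rewrite -?h.
      rewrite e21 /=.
      by apply: contraNneq neq => h'; rewrite [p]surjective_pairing h h' -surjective_pairing.
    have l1 : (q.1 < p.2)%N by apply: ltn_trans p12; rewrite h.
    by rewrite -!(inj_eq val_inj) (gtn_eqF l1) (gtn_eqF p12).
  have [xp|xp] := eqVneq (x 0 p.2) (x 0 p.1); last first.
    have := psi1E x Ox; rewrite (phi0 q) //; last by rewrite inE qr orbT.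
    by move=> /esym/eqP; rewrite mulf_eq0 subr_eq0 (negbTE xp) => /eqP.
  apply: (@vanish_line _ psi1 x (delta_mx 0 a)); first exact: (spsi1 0%N).
  have nO := near_line (delta_mx 0 a) oO Ox.
  have n0 : \forall t \near (0 : R)^', t != 0 by exact: nbhs_dnbhs_neq.
  apply: filterS2 nO n0 => t Ot t0.
  have := psi1E _ Ot; rewrite (phi0 q) //; first last.
  - case/andP: aq => a1 a2; rewrite !mxE !eqxx /= !(eq_sym _ a) (negbTE a1) (negbTE a2).
    by rewrite xq.
  - by rewrite inE qr orbT.
  move=> /esym/eqP; rewrite mulf_eq0 => /orP[|/eqP //].
  rewrite !mxE !eqxx /= xp opprD addrACA subrr add0r.
  case/orP: ap => /eqP ->.
    by rewrite eqxx e21 mulr0 mulr1 sub0r oppr_eq0 (negbTE t0).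
  by rewrite eqxx e12 mulr0 mulr1 subr0 (negbTE t0).
- by exists psi; split=> // x Ox; rewrite big_cons psi1E // psiE // mulrA.
Qed.

Definition distinct (x : E) := forall i j, x 0 i = x 0 j -> i = j.

(** Moving along the vector (0, 1, 2, ...) separates the coordinates, since the
    difference of two coordinates is an affine function of [t] whose slope is a
    nonzero integer. *)
Lemma near_distinct (x : E) :
  \forall t \near (0 : R)^', distinct (x + t *: \row_i (i : nat)%:R).
Proof.
have : \forall t \near (0 : R)^', forall p : 'I_n * 'I_n, p.1 != p.2 ->
    (x + t *: \row_i (i : nat)%:R) 0 p.1 != (x + t *: \row_i (i : nat)%:R) 0 p.2.
  apply: filter_forall => -[i j] /=.
  have [<-|ij] := eqVneq i j; first by apply: nearW => t; rewrite ?eqxx.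
  have [xij|xij] := eqVneq (x 0 i) (x 0 j).
    have n0 : \forall t \near (0 : R)^', t != 0 by exact: nbhs_dnbhs_neq.
    apply: filterS n0 => t t0 _; rewrite !mxE xij (inj_eq (addrI _)).
    by rewrite (inj_eq (mulfI t0)) eqr_nat.
  have oO : open [set y : E | y 0 i - y 0 j != 0].
    have cl := framed_continuous (@framed_rV R n) (@crd_linear i j).
    have -> : [set y : E | y 0 i - y 0 j != 0] =
        (fun y : E => y 0 i - y 0 j) @^-1` [set~ 0].
      by apply/seteqP; split=> y /= /eqP.
    apply: open_comp => [y _|]; first exact: cl.
    exact/closed_openC/closed_eq.
  have := @near_line _ _ x (\row_i (i : nat)%:R) oO _; rewrite /= subr_eq0 => /(_ xij).
  by apply: filterS => t; rewrite subr_eq0.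
apply: filterS => t h i j eij; apply/eqP; apply/negP => /negP ij.
by have := h (i, j) ij; rewrite /= eij eqxx.
Qed.

Lemma distinct_ext (O : set E) (f g : E -> R) : open O -> Ck 0 O f -> Ck 0 O g ->
  (forall x, O x -> distinct x -> f x = g x) -> forall x, O x -> f x = g x.
Proof.
move=> oO cf cg fg x Ox; apply/subr0_eq.
apply: (@vanish_line _ (f - g) x (\row_i (i : nat)%:R)).
  exact: (@Ck_sub _ _ _ 0 O f g oO cf cg).
apply: filterS2 (near_line (\row_i (i : nat)%:R) oO Ox) (near_distinct x) => t Ot dt.
by rewrite -[LHS]/(f _ - g _) (fg _ Ot dt) subrr.
Qed.

Let V (x : E) : 'M[R]_n := Vandermonde n x.

Let detV x : \det (V x) = \prod_(p <- [seq p : 'I_n * 'I_n <- index_enum _ | (p.1 < p.2)%N])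
  (x 0 p.2 - x 0 p.1).
Proof.
rewrite det_Vandermonde (pair_big_dep xpredT (fun i j : 'I_n => (i < j)%N)
  (fun i j => x 0 j - x 0 i)) /=.
by rewrite big_filter.
Qed.

Let detV_distinct x : distinct x -> V x \in unitmx.
Proof.
move=> dx; rewrite unitmxE unitfE detV prodf_seq_neq0; apply/allP => p.
rewrite mem_filter subr_eq0 /= => /andP[p12 _]; apply/negP => /eqP /dx h.
by rewrite h ltnn in p12.
Qed.

Lemma col_perm_linear s : linear (@col_perm R 1 n s).
Proof. by move=> a u v; apply/rowP => i; rewrite !mxE. Qed.

(** The coefficients solve a Vandermonde system. By Cramer's rule each is a
    quotient by the Vandermonde determinant, and the numerator [N j] is the
    determinant of the matrix in which a row is replaced by the values [g k x];
    it has two equal columns where two coordinates of [x] agree, so every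
    factor of the Vandermonde determinant divides it. The identity and the
    invariance hold by uniqueness of the solution where the coordinates are
    distinct, and everywhere by density. *)
Lemma smooth_interpolation (O : set E) (g : 'I_n -> E -> R) : open O ->
  (forall i, smooth O (g i)) ->
  (forall x i j, O x -> x 0 i = x 0 j -> g i x = g j x) ->
  exists a : 'I_n -> E -> R,
  [/\ forall j, smooth O (a j),
      forall x i, O x -> g i x = \sum_j a j x * x 0 i ^+ j &
      forall s : 'S_n, (forall x, O x -> O (col_perm s x)) ->
       (forall x i, O x -> g i (col_perm s x) = g (s i) x) ->
       forall j x, O x -> a j (col_perm s x) = a j x].
Proof.
move=> oO sg g0.
pose N j x := \sum_k g k x * (\adj (V x)) k j.
have sV k i j : Ck k O (fun x => V x i j).
  rewrite /V; under eq_fun do rewrite mxE.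
  apply: Ck_exp => //; exact: Ck_crd.
have sN j : smooth O (N j).
  move=> k; apply: Ck_sum => // i; apply: Ck_mul => //; first exact: sg.
  by apply: Ck_adj.
have N0 j x (p : 'I_n * 'I_n) : O x -> (p.1 < p.2)%N -> x 0 p.1 = x 0 p.2 -> N j x = 0.
  move=> Ox p12 xp.
  pose B : 'M[R]_n := \matrix_(i, k) (if i == j then g k x else V x i k).
  have -> : N j x = \det B.
    rewrite (expand_det_row B j); apply: eq_bigr => k _; rewrite [in RHS]mxE eqxx.
    congr (_ * _); rewrite mxE /cofactor; congr (_ * \det _).
    by apply/matrixP => i' j'; rewrite !mxE eq_sym (negbTE (neq_lift _ _)).
  rewrite -det_tr; apply: (@determinant_alternate _ _ _ p.1 p.2).
    by apply: contraTneq p12 => ->; rewrite ltnn.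
  by move=> i; rewrite !mxE xp (g0 x p.1 p.2).
have /choice[a aP] j : exists psi : E -> R, smooth O psi /\
    forall x, O x -> N j x = \det (V x) * psi x.
  pose r := [seq p : 'I_n * 'I_n <- index_enum _ | (p.1 < p.2)%N].
  have [|||psi [spsi psiE]] := @smooth_division_pairs O r (N j) oO _ _ (sN j).
  - by rewrite filter_uniq // index_enum_uniq.
  - by apply/allP => p; rewrite mem_filter => /andP[].
  - by move=> p x; rewrite mem_filter => /andP[p12 _] Ox; exact: N0.
  by exists psi; split=> // x Ox; rewrite detV psiE.
have gE x i : O x -> distinct x -> g i x = \sum_j a j x * x 0 i ^+ j.
  move=> Ox dx; have uV := detV_distinct dx.
  have dV : \det (V x) != 0 by move: uV; rewrite unitmxE unitfE.
  apply: (mulfI dV); rewrite mulr_sumr.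
  have : (\row_k g k x) *m (\adj (V x) *m V x) = \det (V x) *: \row_k g k x.
    by rewrite mul_adj_mx mul_mx_scalar.
  rewrite mulmxA => /rowP/(_ i); rewrite !mxE => <-.
  apply: eq_bigr => j _; have [_ aE] := aP j; rewrite mulrA -aE // !mxE; congr (_ * _).
  by apply: eq_bigr => k _; rewrite !mxE.
have Ca k j : Ck k O (a j) by have [+ _] := aP j; exact.
exists a; split.
- by move=> j; have [] := aP j.
- move=> x i Ox; move: x Ox; apply: (distinct_ext oO).
  + exact: sg.
  + apply: Ck_sum => // j; apply: Ck_mul => //; apply: Ck_exp => //.
    exact: Ck_crd.
  + by move=> x Ox dx; exact: gE.
- move=> s Os gs j; apply: (distinct_ext oO) => //.
    have Cs : Ck 0 O (fun x : E => col_perm s x : E).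
      by apply: framed_linear_Ck => //; [exact: framed_rV|exact: col_perm_linear].
    exact: (@Ck_comp R E E R 0 O O _ (a j) (@framed_rV R n) oO oO Os Cs (Ca 0%N j)).
  move=> x Ox dx.
  have dsx : distinct (col_perm s x).
    by move=> i k; rewrite !mxE => /dx /perm_inj.
  have : (\row_j a j (col_perm s x)) *m V x = (\row_j a j x) *m V x.
    apply/rowP => i; pose i' := (s^-1)%g i.
    have -> : i = s i' by rewrite permKV.
    transitivity (g i' (col_perm s x)).
      rewrite (gE _ i' (Os x Ox) dsx) mxE; apply: eq_bigr => k _.
      by rewrite !mxE.
    rewrite gs // (gE _ _ Ox dx) mxE; apply: eq_bigr => k _.
    by rewrite !mxE.
  move=> /(can_inj (mulmxK (detV_distinct dx))) /rowP/(_ j).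
  by rewrite !mxE.
Qed.

End Interpolation.

(** * Spectral theorem and perturbation of eigenvalues *)

Section Spectral.
Variable R : realType.

Definition orthmx n (U : 'M[R]_n) := U *m U^T = 1%:M.

Lemma orthmxT n (U : 'M[R]_n) : orthmx U -> U^T *m U = 1%:M.
Proof. exact: mulmx1C. Qed.

Lemma orthmx1 n : orthmx (1%:M : 'M[R]_n).
Proof. by rewrite /orthmx trmx1 mulmx1. Qed.

Lemma orthmxM n (U V : 'M[R]_n) : orthmx U -> orthmx V -> orthmx (U *m V).
Proof.
by move=> oU oV; rewrite /orthmx trmx_mul mulmxA -(mulmxA U) oV mulmx1.
Qed.

Definition sqnorm n (u : 'rV[R]_n) : R := \sum_i u 0 i ^+ 2.

Lemma sqnormE n (u : 'rV[R]_n) : u *m u^T = (sqnorm u)%:M.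
Proof.
rewrite [LHS]mx11_scalar mxE /sqnorm; congr (_%:M).
by apply: eq_bigr => i _; rewrite mxE expr2.
Qed.

Lemma sqnorm_gt0 n (u : 'rV[R]_n) : u != 0 -> 0 < sqnorm u.
Proof.
move=> u0; rewrite lt_def sumr_ge0 ?andbT => [|i _]; last exact: sqr_ge0.
apply: contra_neq u0; move/eqP; rewrite psumr_eq0 => [/allP h|i _]; last exact: sqr_ge0.
apply/rowP => i; rewrite mxE; apply/eqP; rewrite -sqrf_eq0.
by have := h i (mem_index_enum _).
Qed.

Lemma sqnorm_orth n (U : 'M[R]_n) (u : 'rV[R]_n) : orthmx U ->
  sqnorm (u *m U) = sqnorm u.
Proof.
move=> oU; suff : (sqnorm (u *m U))%:M = (sqnorm u)%:M :> 'M[R]_1.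
  by move=> /matrixP/(_ 0 0); rewrite !mxE eqxx.
by rewrite -!sqnormE trmx_mul mulmxA -(mulmxA u) oU mulmx1.
Qed.

(** The Householder reflection exchanging [v] and the first basis vector. *)
Lemma orthmx_first_row n (v : 'rV[R]_n.+1) : sqnorm v = 1 ->
  exists Q : 'M[R]_n.+1, [/\ orthmx Q, Q^T = Q & delta_mx 0 0 *m Q = v].
Proof.
move=> v1; pose w := v - delta_mx 0 0.
have [w0|w0] := eqVneq w 0.
  exists 1%:M; split; [exact: orthmx1|exact: trmx1|].
  by rewrite mulmx1; apply/esym/subr0_eq.
have sw := sqnorm_gt0 w0; have ew := sqnormE w.
have dw : (delta_mx 0 0 : 'rV[R]_n.+1) *m w^T = (- (sqnorm w / 2))%:M.
  have -> : (delta_mx 0 0 : 'rV[R]_n.+1) *m w^T = (v 0 0 - 1)%:M.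
    rewrite [LHS]mx11_scalar -rowE !mxE eqxx //=.
  congr (_%:M); rewrite /sqnorm /w big_ord_recl !mxE eqxx /=.
  under eq_bigr => i _ do rewrite !mxE /= subr0.
  move: v1; rewrite /sqnorm big_ord_recl.
  have h (a S : R) : a ^+ 2 + S = 1 -> a - 1 = - (((a - 1) ^+ 2 + S) / 2).
    by move=> h; have -> : S = 1 - a ^+ 2 by [rewrite -h; ring]; field.
  exact: h.
pose c := 2 / sqnorm w.
pose Q := 1%:M - c *: (w^T *m w).
have QT : Q^T = Q by rewrite /Q linearB /= trmx1 linearZ /= trmx_mul trmxK.
exists Q; split => //.
  rewrite /orthmx QT /Q mulmxBr mulmx1 mulmxBl mul1mx -scalemxAl -scalemxAr.
  rewrite mulmxA -(mulmxA w^T w w^T) ew mul_mx_scalar -scalemxAl !scalerA.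
  have -> : c * (c * sqnorm w) = c + c.
    by rewrite /c; field; exact: lt0r_neq0.
  by rewrite scalerDl opprB addrK subrK.
rewrite /Q mulmxBr mulmx1 -scalemxAr mulmxA dw mul_scalar_mx scalerA.
have -> : c * - (sqnorm w / 2) = -1 by rewrite /c; field; exact: lt0r_neq0.
by rewrite scaleN1r opprK /w addrC subrK.
Qed.

Lemma real_eigenvector n (X : 'M[R]_n.+1) : X^T = X ->
  exists a (v : 'rV[R]_n.+1), sqnorm v = 1 /\ v *m X = a *: v.
Proof.
move=> XT; have XS : X \is symmetricmx by rewrite symmetricE XT.
have [_] := eigvalsP (SymMatrix XS); move: (eigvals _) => d dE.
have : root (char_poly X) (d 0 0).
  by rewrite dE big_ord_recl rootM root_XsubC eqxx.
rewrite -eigenvalue_root_char => /eigenvalueP[v vX v0].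
have sv := sqnorm_gt0 v0; pose c := (Num.sqrt (sqnorm v))^-1.
exists (d 0 0), (c *: v); split; last by rewrite -scalemxAl vX !scalerA mulrC.
rewrite /sqnorm; under eq_bigr do rewrite mxE exprMn.
rewrite -mulr_sumr /c exprVn sqr_sqrtr ?(ltW sv) // mulVf //; exact: lt0r_neq0.
Qed.

(** A unit eigenvector is made the first basis vector by a reflection; symmetry
    leaves a block-diagonal matrix, and the induction applies to the second
    block. *)
Lemma real_spectral n (X : 'M[R]_n) : X^T = X ->
  exists (U : 'M[R]_n) (d : 'rV[R]_n), orthmx U /\ X = U^T *m diag_mx d *m U.
Proof.
elim: n X => [|n IH] X XT.
  exists 1%:M, 0; split; first exact: orthmx1.
  by apply/matrixP => -[].
have [a [v [v1 vX]]] := real_eigenvector XT.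
have [Q [oQ QT Qv]] := orthmx_first_row v1.
have QQ : Q *m Q = 1%:M by rewrite -[X in _ *m X]QT.
have [Y YQ] : exists Y : 'M[R]_(1 + n), Y = Q *m X *m Q by eexists.
have YT : Y^T = Y by rewrite YQ !trmx_mul QT XT mulmxA.
have Y0 : (delta_mx 0 0 : 'rV[R]_(1 + n)) *m Y = a *: delta_mx 0 0.
  rewrite YQ !mulmxA Qv vX -scalemxAl; congr (_ *: _).
  by rewrite -Qv -mulmxA QQ mulmx1.
have Yur : ursubmx Y = 0.
  apply/rowP => j; rewrite !mxE.
  move/rowP: Y0 => /(_ (rshift 1 j)); rewrite -rowE !mxE /= mulr0 => <-.
  by congr (Y _ _); apply/val_inj.
have Ydl : dlsubmx Y = 0 by rewrite -[Y]YT -trmx_ursub Yur trmx0.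
have YE : Y = block_mx (ulsubmx Y) 0 0 (drsubmx Y) by rewrite -{1}[Y]submxK Yur Ydl.
have [|U' [d' [oU' dE]]] := IH (drsubmx Y); first by rewrite trmx_drsub YT.
pose B : 'M[R]_(1 + n) := block_mx 1%:M 0 0 U'.
have oB : orthmx B.
  rewrite /orthmx tr_block_mx mulmx_block !trmx0 !mulmx0 !mul0mx !addr0 !add0r.
  by rewrite trmx1 mulmx1 oU' -scalar_mx_block.
exists (B *m Q), (row_mx (ulsubmx Y) d' : 'rV[R]_(1 + n)); split.
  exact: orthmxM.
rewrite trmx_mul QT -!mulmxA (mulmxA _ B) (mulmxA B^T).
have -> : B^T *m (diag_mx (row_mx (ulsubmx Y) d') *m B) = Y.
  rewrite mulmxA diag_mx_row /B tr_block_mx !mulmx_block.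
  rewrite !(mulmx0, mul0mx, trmx0, addr0, add0r).
  rewrite trmx1 mul1mx mulmx1 -dE [RHS]YE; congr (block_mx _ _ _ _).
  by rewrite [ulsubmx Y]mx11_scalar; apply/matrixP => i j; rewrite !mxE !ord1 eqxx.
by rewrite YQ !mulmxA QQ mul1mx -mulmxA QQ mulmx1.
Qed.

Lemma orthmx_unit n (U : 'M[R]_n) : orthmx U -> U \in unitmx.
Proof. by move=> /mulmx1_unit[]. Qed.

Lemma invmx_orth n (U : 'M[R]_n) : orthmx U -> invmx U = U^T.
Proof.
move=> oU; have uU := orthmx_unit oU.
by rewrite -[RHS]mulmx1 -(mulmxV uU) mulmxA orthmxT // mul1mx.
Qed.

Definition orthconj n (U X : 'M[R]_n) := U^T *m X *m U.

Lemma orthconj_char_poly n (U : 'M[R]_n) (d : 'rV[R]_n) : orthmx U ->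
  char_poly (orthconj U (diag_mx d)) = \prod_(i < n) ('X - (d 0 i)%:P).
Proof.
move=> oU; rewrite /orthconj -invmx_orth // char_poly_similar ?orthmx_unit //.
rewrite char_poly_trig ?diag_mx_is_trig //; apply: eq_bigr => i _.
by rewrite mxE eqxx.
Qed.

(** The ordered eigenvalues and [d] are the roots of the same characteristic
    polynomial. *)
Lemma eigvals_diag n (X : sym_matrix R n) (U : 'M[R]_n) (d : 'rV[R]_n) : orthmx U ->
  (X : 'M[R]_n) = orthconj U (diag_mx d) -> exists s : 'S_n, eigvals X = col_perm s d.
Proof.
move=> oU XE; have [_] := eigvalsP X; rewrite XE orthconj_char_poly //.
set v := eigvals X; move=> E.
have : perm_eq [tuple v 0 i | i < n] [tuple d 0 i | i < n].
  by apply: prod_XsubC_eq; rewrite !big_map -!enumT !big_enum.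
move=> /tuple_permP[s sE]; exists s; apply/rowP => i; rewrite mxE.
have := congr1 (fun s => nth 0 s i) sE.
by rewrite -!tnth_nth /= !tnth_mktuple.
Qed.

Lemma orthconj_perm n (U : 'M[R]_n) (d : 'rV[R]_n) (s : 'S_n) :
  orthconj (row_perm s U) (diag_mx (col_perm s d)) = orthconj U (diag_mx d).
Proof.
apply/matrixP => i j; rewrite /orthconj !mul_mx_diag !mxE [RHS](reindex_inj (@perm_inj _ s)).
by apply: eq_bigr => k _; rewrite !mxE.
Qed.

Lemma orthmx_row_perm n (U : 'M[R]_n) (s : 'S_n) : orthmx U -> orthmx (row_perm s U).
Proof.
move=> oU; rewrite row_permE; apply: orthmxM => //.
by rewrite /orthmx tr_perm_mx -perm_mxM mulgV perm_mx1.
Qed.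

Lemma sym_spectral n (X : sym_matrix R n) :
  exists2 U : 'M[R]_n, orthmx U & (X : 'M[R]_n) = orthconj U (diag_mx (eigvals X)).
Proof.
have [U [d [oU XE]]] := real_spectral (sym_tr X).
have [s sE] := eigvals_diag oU XE.
exists (row_perm s U); first exact: orthmx_row_perm.
by rewrite sE orthconj_perm.
Qed.

Lemma quad_orthconj n (U : 'M[R]_n) (d u : 'rV[R]_n) :
  u *m orthconj U (diag_mx d) *m u^T = (\sum_i d 0 i * (u *m U^T) 0 i ^+ 2)%:M.
Proof.
rewrite /orthconj !mulmxA -mulmxA -[U *m u^T]trmxK trmx_mul trmxK.
rewrite [LHS]mx11_scalar mxE; congr (_%:M); apply: eq_bigr => i _.
by rewrite mul_mx_diag !mxE expr2 mulrCA mulrA.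
Qed.

Lemma orthconjM n (U X Y : 'M[R]_n) : orthmx U ->
  orthconj U X *m orthconj U Y = orthconj U (X *m Y).
Proof.
by move=> oU; rewrite /orthconj !mulmxA -(mulmxA _ U) oU mulmx1 -(mulmxA _ X).
Qed.

Lemma mxtrace_orthconj n (U X : 'M[R]_n) : orthmx U -> \tr (orthconj U X) = \tr X.
Proof. by move=> oU; rewrite /orthconj mxtrace_mulC mulmxA oU mul1mx. Qed.

Lemma frob_diag n (X : sym_matrix R n) : frob X ^+ 2 = \sum_i eigvals X 0 i ^+ 2.
Proof.
have [U oU XE] := sym_spectral X; rewrite frob_sqr /trdot {1 2}XE orthconjM //.
rewrite mxtrace_orthconj // mulmx_diag mxtrace_diag.
by apply: eq_bigr => i _; rewrite mxE expr2.
Qed.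

Lemma eigvals_le_frob n (X : sym_matrix R n) i : `|eigvals X 0 i| <= frob X.
Proof.
rewrite -(@ler_pXn2r _ 2) ?nnegrE ?frob_ge0 // -normrX ger0_norm ?sqr_ge0 //.
rewrite frob_diag (bigD1 i) //= lerDl sumr_ge0 // => j _; exact: sqr_ge0.
Qed.

Lemma quad_le_frob n (X : sym_matrix R n) (u : 'rV[R]_n) :
  (u *m X *m u^T) 0 0 <= frob X * sqnorm u.
Proof.
have [U oU XE] := sym_spectral X; rewrite {1}XE quad_orthconj mxE eqxx mulr1n.
have oUT : orthmx U^T by rewrite /orthmx trmxK orthmxT.
rewrite -(sqnorm_orth u oUT) /sqnorm mulr_sumr; apply: ler_sum => i _.
rewrite ler_wpM2r ?sqr_ge0 //; apply: le_trans (eigvals_le_frob X i).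
exact: ler_norm.
Qed.

(** As in the theorem of Courant and Fischer: there is a nonzero vector [u]
    orthogonal to the eigenvectors of [X] of index greater than [i] and to
    those of [Y] of index less than [i], because these are [n - 1] conditions.
    The quadratic form of [X] at [u] is then at least the [i]-th eigenvalue of
    [X], that of [Y] at most the [i]-th eigenvalue of [Y]. *)
Lemma weyl_le n (X Y : sym_matrix R n) i :
  eigvals X 0 i <= eigvals Y 0 i + frob (X - Y).
Proof.
have [U oU XE] := sym_spectral X; have [V oV YE] := sym_spectral Y.
have [xs _] := eigvalsP X; have [ys _] := eigvalsP Y.
(* The i-th column is zero, so A is singular; the others state the conditions. *)
pose A : 'M[R]_n := \matrix_(r, k)
  (if (i < k)%N then U k r else if (k < i)%N then V k r else 0).
have /eqP/det0P[u u0 uA] : \det A = 0.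
  rewrite -det_tr (expand_det_row _ i) big1 // => k _.
  by rewrite !mxE ltnn mul0r.
have su := sqnorm_gt0 u0.
have oUT : orthmx U^T by rewrite /orthmx trmxK orthmxT.
have oVT : orthmx V^T by rewrite /orthmx trmxK orthmxT.
have uU (k : 'I_n) : (i < k)%N -> (u *m U^T) 0 k = 0.
  move=> ik; have /rowP/(_ k) := uA; rewrite [X in _ = X]mxE => h.
  rewrite -[RHS]h mxE [in RHS]mxE; by apply: eq_bigr => r _; rewrite !mxE ik.
have uV (k : 'I_n) : (k < i)%N -> (u *m V^T) 0 k = 0.
  move=> ki; have /rowP/(_ k) := uA; rewrite [X in _ = X]mxE => h.
  rewrite -[RHS]h mxE [in RHS]mxE; by apply: eq_bigr => r _; rewrite !mxE ltnNge (ltnW ki) ki.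
have qX : eigvals X 0 i * sqnorm u <= (u *m X *m u^T) 0 0.
  rewrite {1}XE quad_orthconj mxE eqxx mulr1n -(sqnorm_orth u oUT) /sqnorm mulr_sumr.
  apply: ler_sum => k _; case: (leqP k i) => ki.
    by rewrite ler_wpM2r ?sqr_ge0 // xs.
  by rewrite uU // expr0n !mulr0.
have qY : (u *m Y *m u^T) 0 0 <= eigvals Y 0 i * sqnorm u.
  rewrite {1}YE quad_orthconj mxE eqxx mulr1n -(sqnorm_orth u oVT) /sqnorm mulr_sumr.
  apply: ler_sum => k _; case: (leqP i k) => ki.
    by rewrite ler_wpM2r ?sqr_ge0 // ys.
  by rewrite uV // expr0n !mulr0.
have := quad_le_frob (X - Y) u.
rewrite /= mulmxBr mulmxBl !mxE => qXY.
rewrite -(ler_pM2r su) mulrDl.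
move: qX qY qXY; rewrite !mxE; lra.
Qed.

Lemma rV_norm_le n (v : 'rV[R]_n) (e : R) : 0 <= e ->
  (forall i, `|v 0 i| <= e) -> `|v| <= e.
Proof.
move=> e0 h; rewrite [leLHS]/Num.Def.normr /= mx_normrE; apply/bigmax_leP; split=> // -[i j] _ /=.
by rewrite ord1.
Qed.

Lemma coord_le_norm n (v : 'rV[R]_n) i : `|v 0 i| <= `|v|.
Proof.
rewrite [leRHS]/Num.Def.normr /= mx_normrE; apply/bigmax_geP; right.
by exists (0, i).
Qed.

Lemma nonexpansive_continuous (E F : normedModType R) (f : E -> F) :
  (forall x y, `|f x - f y| <= `|x - y|) -> continuous f.
Proof.
move=> fl x; apply/cvgrPdist_lt => e e0; apply/near_ballP; exists e => // y.
by rewrite distrC; apply: le_lt_trans.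
Qed.

Lemma weyl n (X Y : sym_matrix R n) : `|eigvals X - eigvals Y| <= `|X - Y|.
Proof.
apply: rV_norm_le => // i; rewrite !mxE ler_norml.
have h1 := weyl_le X Y i; have := weyl_le Y X i.
rewrite -[`|X - Y|]/(frob (X - Y)) -[Y - X]opprB -scaleN1r frobZ normrN1 mul1r.
have H (a b c : R) : a <= b + c -> b <= a + c -> - c <= a - b <= c.
  by move=> *; lra.
exact: H h1.
Qed.

Lemma eigvals_continuous n : continuous (@eigvals R n).
Proof. exact/nonexpansive_continuous/weyl. Qed.

Lemma orthconjX n (U : 'M[R]_n) (d : 'rV[R]_n) k : orthmx U ->
  orthconj U (diag_mx d) ^+ k = orthconj U (diag_mx (\row_i d 0 i ^+ k)).
Proof.
move=> oU; elim: k => [|k IH].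
  rewrite expr0 (_ : diag_mx _ = 1%:M) ?/orthconj ?mulmx1 ?orthmxT //.
  by apply/matrixP => i j; rewrite !mxE expr0.
rewrite exprS IH -[_ * _]/(_ *m _) orthconjM // mulmx_diag; congr (orthconj _ (diag_mx _)).
by apply/rowP => i; rewrite !mxE exprS.
Qed.

Lemma tr_power n (X : sym_matrix R n) k :
  \tr ((X : 'M[R]_n) ^+ k) = \sum_i eigvals X 0 i ^+ k.
Proof.
have [U oU XE] := sym_spectral X; rewrite {1}XE orthconjX // mxtrace_orthconj //.
by rewrite mxtrace_diag; apply: eq_bigr => i _; rewrite mxE.
Qed.

End Spectral.

(** * Coordinates on the space of symmetric matrices *)

Section SymCoordinates.
Variables (R : realType) (n : nat).
Local Notation S := (sym_matrix R n).

Lemma sym_inj (X Y : S) : (X : 'M[R]_n) = Y -> X = Y.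
Proof. exact: val_inj. Qed.

Lemma symmetricP (A : 'M[R]_n) : A^T = A -> A \is symmetricmx.
Proof. by move=> AT; rewrite symmetricE AT. Qed.

(** A total linear map onto the subtype of symmetric matrices. It serves to build
    elements of the subtype, even from a matrix known to be symmetric, because
    its linearity and smoothness do not refer to a proof of symmetry. *)
Definition sympart (A : 'M[R]_n) : S :=
  insubd (0 : S) (2^-1 *: (A + A^T)).

Lemma sympartE (A : 'M[R]_n) : sympart A = 2^-1 *: (A + A^T) :> 'M[R]_n.
Proof.
rewrite /sympart /insubd insubT //=.
by apply: symmetricP; rewrite linearZ linearD /= trmxK addrC.
Qed.

Lemma sympart_id (A : 'M[R]_n) : A^T = A -> sympart A = A :> 'M[R]_n.
Proof.
move=> AT; rewrite sympartE AT; by apply/matrixP => i j; rewrite !mxE; field.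
Qed.

Lemma sympartK (X : S) : sympart X = X.
Proof. by apply: sym_inj; rewrite sympart_id // sym_tr. Qed.

Lemma sympart_linear : linear sympart.
Proof.
move=> a A B; apply: sym_inj; rewrite /= !sympartE linearP /=.
by apply/matrixP => i j; rewrite !mxE; ring.
Qed.

Lemma entry_le_frob (X : S) i j : `|X i j| <= `|X|.
Proof.
rewrite -[`|X|]/(frob X) -(@ler_pXn2r _ 2) ?nnegrE ?frob_ge0 // -normrX ger0_norm ?sqr_ge0 //.
rewrite frob_sqr trdotE (bigD1 i) //= (bigD1 j) //= -expr2 -addrA lerDl.
rewrite addr_ge0 // ?sumr_ge0 // => k _; last apply: sumr_ge0 => l _;
  by rewrite -expr2 sqr_ge0.
Qed.

Lemma linear_bounded_continuous (E F : normedModType R) (L : E -> F) (k : R) :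
  linear L -> 0 < k -> (forall x, `|L x| <= k * `|x|) -> continuous L.
Proof.
move=> linL k0 Lk x; apply/cvgrPdist_lt => e e0; apply/near_ballP.
exists (e / k) => [|y yx]; first by rewrite divr_gt0.
by rewrite distrC -(is_linearB linL) (le_lt_trans (Lk _)) // mulrC -ltr_pdivlMr.
Qed.

Lemma entry_continuous i j : continuous (fun X : S => X i j).
Proof.
apply: (@linear_bounded_continuous S R _ 1) => //.
- by move=> a X Y; rewrite /= !mxE.
- by move=> X; rewrite mul1r; exact: entry_le_frob.
Qed.

Lemma framed_sym : framed S.
Proof.
pose T : finType := ('I_n * 'I_n)%type.
exists #|T|, (fun p => sympart (delta_mx (enum_val p).1 (enum_val p).2)),
  (fun p (X : S) => X (enum_val p).1 (enum_val p).2); split.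
- by move=> p a X Y; rewrite /= !mxE.
- by move=> p; exact: entry_continuous.
move=> X.
pose F (p : T) := (X p.1 p.2) *: sympart (delta_mx p.1 p.2).
rewrite -[RHS](big_enum_val F).
have -> : \sum_(p in T) F p = sympart (\sum_i \sum_j X i j *: delta_mx i j).
  rewrite pair_big /=; apply/esym.
  rewrite (is_linear_sum sympart_linear); apply: eq_bigr => p _.
  by rewrite (is_linearZ sympart_linear).
by rewrite -matrix_sum_delta sympartK.
Qed.

Lemma Ck_entry k (U : set S) i j : open U -> Ck k U (fun X : S => X i j).
Proof.
move=> oU; apply: framed_linear_Ck => //; first exact: framed_sym.
by move=> a X Y; rewrite /= !mxE.
Qed.

Lemma Ck_power k (U : set S) m i j : open U ->
  Ck k U (fun X : S => ((X : 'M[R]_n) ^+ m) i j).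
Proof.
move=> oU; elim: m i j => [|m IH] i j; first exact: Ck_cst.
under eq_fun do rewrite exprS.
by apply: (@Ck_mulmx _ _ _ _ _ _ _ (fun X : S => X : 'M[R]_n)) => // i' j'; exact: Ck_entry.
Qed.

Lemma Ck_sympart (E : normedModType R) k (U : set E) (A : E -> 'M[R]_n) : open U ->
  (forall i j, Ck k U (fun x => A x i j)) -> Ck k U (fun x => sympart (A x)).
Proof.
move=> oU CA.
have -> : (fun x => sympart (A x)) =
    (fun x => \sum_i \sum_j A x i j *: sympart (delta_mx i j)).
  apply/funext => x; rewrite {1}[A x]matrix_sum_delta !pair_big /=.
  rewrite (is_linear_sum sympart_linear); apply: eq_bigr => p _.
  by rewrite (is_linearZ sympart_linear).
apply: Ck_sum => // i; apply: Ck_sum => // j.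
apply: (@Ck_scale _ _ _ _ _ (fun x => A x i j) (cst _)) => //.
exact: Ck_cst.
Qed.

End SymCoordinates.

(** * Smooth spectral functions *)

Section PowerDerivative.
Variables (R : realType).

Lemma derive_bigsum (E F : normedModType R) (I : Type) (r : seq I)
    (f : I -> E -> F) x v : (forall i, differentiable (f i) x) ->
  'D_v (fun x => \sum_(i <- r) f i x) x = \sum_(i <- r) 'D_v (f i) x.
Proof.
move=> df; suff [d ->] : differentiable (fun x => \sum_(i <- r) f i x) x /\
  'D_v (fun x => \sum_(i <- r) f i x) x = \sum_(i <- r) 'D_v (f i) x by [].
elim: r => [|i r [d dE]].
  rewrite big_nil; under eq_fun do rewrite big_nil.
  by split; [exact: differentiable_cst|exact: derive_cst].
rewrite big_cons -dE; under eq_fun do rewrite big_cons.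
split; first exact: differentiableD.
by rewrite deriveD //; exact: diff_derivable.
Qed.

Lemma derive_linear (E F : normedModType R) (L : E -> F) x v :
  linear L -> continuous L -> 'D_v L x = L v.
Proof. by move=> linL cL; have [d dE] := diff_linear x linL cL; rewrite deriveE // dE. Qed.

Lemma derive_crd n (x v : 'rV[R]_n) i : 'D_v (fun x : 'rV[R]_n => x 0 i) x = v 0 i.
Proof.
apply: (@derive_linear _ R (fun x : 'rV[R]_n => x 0 i)); last exact: coord_continuous.
by move=> a y z; rewrite !mxE.
Qed.

Lemma derive_mul (E : normedModType R) (f g : E -> R) x v :
  differentiable f x -> differentiable g x ->
  'D_v (fun x => f x * g x) x = 'D_v f x * g x + f x * 'D_v g x.
Proof.
move=> df dg; rewrite [LHS]deriveM; [|exact: diff_derivable..].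
by rewrite -![_ *: _]/(_ * _) addrC [g x * _]mulrC.
Qed.

Lemma smooth_differentiable (E F : normedModType R) (f : E -> F) U x :
  Ck 1 U f -> U x -> differentiable f x.
Proof. by move=> [+ _]; exact. Qed.

Lemma derive_cstM (E : normedModType R) (c : R) (f : E -> R) x v :
  differentiable f x -> 'D_v (fun x => c * f x) x = c * 'D_v f x.
Proof.
move=> df; have dc := @differentiable_cst R E R c x.
rewrite (derive_mul v dc df).
by rewrite derive_cst mul0r add0r.
Qed.

Lemma differentiable_exp (E : normedModType R) (f : E -> R) x k :
  differentiable f x -> differentiable (fun x => f x ^+ k) x.
Proof.
move=> df; elim: k => [|k IH].
  by under eq_fun do rewrite expr0; exact: differentiable_cst.
by under eq_fun do rewrite exprS; exact: differentiableM.
Qed.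

Lemma derive_exp (E : normedModType R) (f : E -> R) x v k : differentiable f x ->
  'D_v (fun x => f x ^+ k.+1) x = k.+1%:R * (f x ^+ k * 'D_v f x).
Proof.
move=> df; elim: k => [|k IH].
  by under eq_fun do rewrite expr1; rewrite expr0 !mul1r.
under eq_fun do rewrite exprS.
rewrite derive_mul // ?IH; last exact: differentiable_exp.
by rewrite exprS -[in RHS]natr1; ring.
Qed.

Variable n : nat.
Local Notation S := (sym_matrix R n).
Local Notation M := 'M[R]_n.

(** The derivative of the [k]-th power at [X] in direction [H], that is the sum
    of [X ^ i * H * X ^ (k - 1 - i)] over [i < k]. *)
Fixpoint dpow k (X H : M) : M :=
  if k is k'.+1 then H *m X ^+ k' + X *m dpow k' X H else 0.

Lemma derive_power k (X H : S) i j :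
  'D_H (fun X : S => ((X : M) ^+ k) i j) X = dpow k X H i j.
Proof.
have dpw m i' j' : differentiable (fun X : S => ((X : M) ^+ m) i' j') X.
  exact: (smooth_differentiable (@Ck_power R n 1 setT m i' j' openT)).
have den i' j' : differentiable (fun X : S => X i' j') X.
  exact: (smooth_differentiable (@Ck_entry R n 1 setT i' j' openT)).
have De i' j' : 'D_H (fun X : S => X i' j') X = H i' j'.
  apply: (@derive_linear _ R (fun X : S => X i' j')); last exact: entry_continuous.
  by move=> a Y Z; rewrite /= !mxE.
elim: k i j => [|k IH] i j.
  by under eq_fun do rewrite expr0; rewrite derive_cst /= mxE.
have -> : (fun Y : S => ((Y : M) ^+ k.+1) i j) =
    (fun Y : S => \sum_l Y i l * ((Y : M) ^+ k) l j).
  by apply/funext => Y; rewrite exprS -[_ * _]/(_ *m _) mxE.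
rewrite derive_bigsum; last by move=> l; exact: differentiableM.
rewrite /= !mxE -big_split; apply: eq_bigr => l _.
by rewrite derive_mul // De IH.
Qed.

(** Cyclicity of the trace makes all terms of [dpow] equal under the trace; the
    factor [X ^+ m] is carried along for the induction. *)
Lemma tr_dpow k m (X H : M) :
  \tr (X ^+ m *m dpow k.+1 X H) = k.+1%:R * \tr (X ^+ (m + k) *m H).
Proof.
elim: k m => [|k IH] m.
  by rewrite /= expr0 mulmx1 mulmx0 addr0 addn0 mul1r.
rewrite -[dpow _ _ _]/(H *m X ^+ k.+1 + X *m dpow k.+1 X H) mulmxDr mxtraceD.
have -> : \tr (X ^+ m *m (H *m X ^+ k.+1)) = \tr (X ^+ (m + k.+1) *m H).
  by rewrite mulmxA mxtrace_mulC mulmxA -[X ^+ k.+1 *m _]exprD addnC.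
rewrite (mulmxA (X ^+ m) X) -[X ^+ m *m X]exprSr IH addSnnS.
by rewrite -[in RHS]natr1; ring.
Qed.

Lemma derive_tr_power k (X H : S) :
  'D_H (fun X : S => \tr ((X : M) ^+ k.+1)) X = k.+1%:R * \tr ((X : M) ^+ k *m H).
Proof.
rewrite /mxtrace derive_bigsum; last first.
  by move=> i; exact: (smooth_differentiable (@Ck_power R n 1 setT k.+1 i i openT)).
rewrite -[\sum_i (_ *m _) i i]/(\tr _) -(tr_dpow k 0) expr0 mul1mx.
by apply: eq_bigr => i _; rewrite derive_power.
Qed.

End PowerDerivative.

(** The set [O] plays the role of a small ball around a vector [xb], and [G]
    that of the permutations fixing [xb]: [O] is stable under [G], and meets
    none of its images under the other permutations. Consequently [G] contains
    the transposition of [i] and [j] as soon as some [x] in [O] has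
    [x_i = x_j]. *)
Section Transfer.
Variables (R : realType) (n : nat) (O : set 'rV[R]_n) (G : {set 'S_n}).
Local Notation E := 'rV[R]_n.
Local Notation S := (sym_matrix R n).
Local Notation M := 'M[R]_n.
Hypotheses (oO : open O) (GO : forall s x, s \in G -> O x -> O (col_perm s x)).
Hypothesis OO : forall s x, O x -> O (col_perm s x) -> s \in G.

Let OG x i j : O x -> x 0 i = x 0 j -> tperm i j \in G.
Proof.
move=> Ox xij; apply: (OO Ox); rewrite (_ : col_perm _ x = x) //.
by apply/rowP => k; rewrite !mxE; case: tpermP => [->|->|].
Qed.

Definition equivariant (g : 'I_n -> E -> R) :=
  forall s x i, s \in G -> O x -> g i (col_perm s x) = g (s i) x.

Definition invariant (f : E -> R) :=
  forall s x, s \in G -> O x -> f (col_perm s x) = f x.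

Lemma equivariant_interpolation (g : 'I_n -> E -> R) :
  (forall i, smooth O (g i)) -> equivariant g ->
  exists a : 'I_n -> E -> R, [/\ forall j, smooth O (a j), forall j, invariant (a j) &
    forall x i, O x -> g i x = \sum_j a j x * x 0 i ^+ j].
Proof.
move=> sg eg; have [|a [sa aE aG]] := smooth_interpolation oO sg.
  move=> x i j Ox xij; have tG := OG Ox xij.
  rewrite -[in LHS](_ : col_perm (tperm j i) x = x); last first.
    apply/rowP => k; rewrite !mxE; case: tpermP => [->|->|//]; exact/esym.
  by rewrite tpermC eg // tpermL.
exists a; split=> // j s x sG Ox; apply: aG => //; first by move=> y; exact: GO.
by move=> y i Oy; exact: eg.
Qed.

Lemma col_perm_delta (s : 'S_n) i : col_perm s (delta_mx 0 (s i) : E) = delta_mx 0 i.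
Proof. by apply/rowP => j; rewrite !mxE (inj_eq perm_inj). Qed.

(** Differentiate [f (s x) = f x] in the direction of a basis vector. *)
Lemma gradient_equivariant (f : E -> R) : smooth O f -> invariant f ->
  equivariant (fun i => 'D_(delta_mx 0 i) f).
Proof.
move=> sf invf s x i sG Ox.
have df y : O y -> differentiable f y by exact: smooth_differentiable.
have [ds dsE] : differentiable (fun y : E => col_perm s y : E) x /\
    'd (fun y : E => col_perm s y : E) x = (fun y : E => col_perm s y : E) :> (E -> E).
  apply: diff_linear; first exact: col_perm_linear.
  by apply: framed_continuous; [exact: framed_rV|exact: col_perm_linear].
have dfs := df _ (GO sG Ox).
have nf : \forall y \near x, (f \o (fun y : E => col_perm s y : E)) y = f y.
  by apply: filterS (open_nbhs_nbhs (conj oO Ox)) => y Oy; exact: invf.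
rewrite -(near_eq_derive (delta_mx 0 (s i)) nf).
rewrite [in RHS]deriveE; last exact: (differentiable_comp ds dfs).
by rewrite (diff_comp ds dfs) dsE /= col_perm_delta deriveE.
Qed.

(** Let [q] be the power sum polynomial, with coefficients frozen at the
    eigenvalues [x0] of [X], that has the gradient of [f] at [x0]. Then
    [q (lambda Y)] is a combination of traces of powers of [Y], which is a
    polynomial in [Y]. The difference [f - q] is of smaller order at [x0], and
    it remains so after composition with [lambda], which is Lipschitz. *)
Lemma spectral_diff (f : E -> R) (a : 'I_n -> E -> R) (X : S) : smooth O f ->
  (forall x i, O x -> 'D_(delta_mx 0 i) f x = \sum_j a j x * x 0 i ^+ j) ->
  O (eigvals X) ->
  differentiable (f \o @eigvals R n) X /\
  forall H, 'D_H (f \o @eigvals R n) X = \sum_j a j (eigvals X) * \tr ((X : M) ^+ j *m H).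
Proof.
move=> sf aE; set x0 := eigvals X => Ox0.
(* The j-th power sum has gradient entries j x_i ^ (j - 1), whence the shift. *)
pose q (x : E) := \sum_j (a j x0 / j.+1%:R) * \sum_i x 0 i ^+ j.+1.
pose h (Y : S) := \sum_j (a j x0 / j.+1%:R) * \tr ((Y : M) ^+ j.+1).
have hE Y : h Y = q (eigvals Y).
  by apply: eq_bigr => j _; rewrite tr_power.
have Cq : Ck 1 setT q.
  apply: Ck_sum; first exact: openT.
  move=> j; apply: Ck_mul; [exact: openT|exact: Ck_cst|].
  apply: Ck_sum; first exact: openT.
  by move=> i; apply: Ck_exp; [exact: openT|exact/Ck_crd/openT].
have Ct k : Ck 1 setT (fun Y : S => \tr ((Y : M) ^+ k)).
  rewrite /mxtrace; apply: Ck_sum; first exact: openT.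
  by move=> i; apply: Ck_power; exact: openT.
have Ch : Ck 1 setT h.
  apply: Ck_sum; first exact: openT.
  move=> j; apply: Ck_mul; [exact: openT|exact: Ck_cst|exact: Ct].
have dq : differentiable q x0 by exact: (smooth_differentiable Cq).
have dh : differentiable h X by exact: (smooth_differentiable Ch).
have df : differentiable f x0 by exact: (smooth_differentiable (sf 1%N)).
have DqE i : 'D_(delta_mx 0 i) q x0 = 'D_(delta_mx 0 i) f x0.
  have dx (k : nat) (l : 'I_n) : differentiable (fun x : E => x 0 l ^+ k) x0.
    by apply: differentiable_exp; exact: (smooth_differentiable (Ck_crd 1 l openT)).
  have dsx (k : nat) : differentiable (fun x : E => \sum_l x 0 l ^+ k) x0.
    have Cs : Ck 1 setT (fun x : E => \sum_l x 0 l ^+ k).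
      apply: Ck_sum; first exact: openT.
      by move=> l; apply: Ck_exp; [exact: openT|exact/Ck_crd/openT].
    exact: (smooth_differentiable Cs).
  rewrite aE // /q derive_bigsum => [|j]; last first.
    by apply: differentiableM; [exact: differentiable_cst|exact: dsx].
  apply: eq_bigr => j _; rewrite derive_cstM // derive_bigsum //.
  rewrite (bigD1 i) //= big1 => [|l li].
    rewrite derive_exp ?derive_crd; last exact: (dx 1%N).
    by rewrite mxE !eqxx addr0 mulr1 mulrA divfK // pnatr_eq0.
  rewrite derive_exp ?derive_crd; last exact: (dx 1%N).
  by rewrite mxE eqxx /= (negbTE li) !mulr0.
have dfq : differentiable (f - q) x0 by exact: differentiableB.
have dfq0 v : 'd (f - q) x0 v = 0.
  rewrite [v]row_sum_delta linear_sum big1 // => i _.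
  rewrite linearZ /= -deriveE // deriveB ?DqE ?subrr ?scaler0 //; exact: diff_derivable.
have [|||d1 d1E] := @diff_nearP R S R ((f - q) \o @eigvals R n) (cst 0) X.
- by move=> b u v; rewrite /= scaler0 addr0.
- exact: cst_continuous.
- move=> e e0; have /near_ballP[r r0 rP] := diff_near dfq e0.
  apply/near_ballP; exists r => // Y YX.
  have w := weyl Y X; have := rP (eigvals Y) (le_lt_trans w YX).
  rewrite dfq0 => /le_trans; apply.
  by rewrite ler_wpM2l // ltW.
have fE : f \o @eigvals R n = ((f - q) \o @eigvals R n) + h.
  by apply/funext => Y; apply/esym; rewrite -[LHS]/(f _ - q _ + h _) hE subrK.
rewrite fE; split; first exact: differentiableD.
move=> H; rewrite deriveD; [|exact: diff_derivable..].
rewrite deriveE // d1E add0r /h derive_bigsum => [|j].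
  apply: eq_bigr => j _; rewrite derive_cstM ?derive_tr_power.
    by rewrite mulrA divfK // pnatr_eq0.
  exact: (smooth_differentiable (Ct j.+1)).
apply: differentiableM; first exact: differentiable_cst.
exact: (smooth_differentiable (Ct j.+1)).
Qed.

(** By [spectral_diff] the derivatives of [f \o lambda] are combinations of
    polynomials in [X], with coefficients of the form [a \o lambda] where [a]
    is smooth and invariant again; induct on the order. *)
Lemma spectral_smooth (f : E -> R) : smooth O f -> invariant f ->
  smooth (@eigvals R n @^-1` O) (f \o @eigvals R n).
Proof.
have oP : open (@eigvals R n @^-1` O).
  by apply: open_comp => // X _; exact: eigvals_continuous.
move=> + + k; elim: k f => [|k IH] f sf invf.
  move=> X OX; apply: continuous_comp; first exact: eigvals_continuous.
  exact: (sf 0%N).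
have [||a [sa inva aE]] := @equivariant_interpolation (fun i => 'D_(delta_mx 0 i) f).
- by move=> i k'; have [_] := sf k'.+1; exact.
- exact: gradient_equivariant.
have dE X OX := @spectral_diff f a X sf aE OX.
split=> [X OX|H]; first by have [] := dE X OX.
apply: (@Ck_ext _ _ _ _ _ (fun X => \sum_j (a j \o @eigvals R n) X * \tr ((X : M) ^+ j *m H))) => //.
  by move=> X OX; have [_ ->] := dE X OX.
apply: Ck_sum => // j; apply: Ck_mul => //; first exact: IH.
rewrite /mxtrace; apply: Ck_sum => // i.
apply: (@Ck_mulmx _ _ _ _ _ _ _ (fun X : S => (X : M) ^+ j) (fun=> H : M)) => //.
  by move=> i' j'; exact: Ck_power.
by move=> i' j'; exact: Ck_cst.
Qed.

(** The lift is [X |-> sum_j a_j (lambda X) X ^ j], where [y_i(x)] is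
    interpolated as [sum_j a_j(x) x_i ^ j]. The spectral decomposition of [X]
    is not assumed to be ordered. *)
Lemma spectral_lift (y : E -> E) : smooth O y ->
  (forall s x, s \in G -> O x -> y (col_perm s x) = col_perm s (y x)) ->
  exists Y : S -> S, smooth (@eigvals R n @^-1` O) Y /\
    forall (X : S) (U : M) (d : E), O (eigvals X) -> orthmx U -> O d ->
      (X : M) = orthconj U (diag_mx d) -> (Y X : M) = orthconj U (diag_mx (y d)).
Proof.
move=> sy ey.
have oP : open (@eigvals R n @^-1` O).
  by apply: open_comp => // X _; exact: eigvals_continuous.
have [||a [sa inva aE]] := @equivariant_interpolation (fun i x => y x 0 i).
- by move=> i k; apply: Ck_rV_coord => //; exact: sy.
- by move=> s x i sG Ox; rewrite ey // mxE.
pose A (X : S) : M := \sum_j a j (eigvals X) *: (X : M) ^+ j.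
exists (fun X => sympart (A X)); split.
  move=> k; apply: Ck_sympart => // i j.
  have -> : (fun X => A X i j) =
      (fun X => \sum_l (a l \o @eigvals R n) X * ((X : M) ^+ l) i j).
    by apply/funext => X; rewrite /A summxE; apply: eq_bigr => l _; rewrite mxE.
  apply: Ck_sum => // l; apply: Ck_mul => //; last exact: Ck_power.
  by apply: spectral_smooth.
move=> X U d OX oU Od XE.
have [s sE] := eigvals_diag oU XE.
have sG : s \in G by apply: (OO Od); rewrite -sE.
have AE : A X = orthconj U (diag_mx (y d)).
  have -> : y d = \sum_j a j d *: \row_i d 0 i ^+ j.
    apply/rowP => i; rewrite aE // summxE; apply: eq_bigr => j _.
    by rewrite !mxE.
  rewrite /A linear_sum /orthconj mulmx_sumr mulmx_suml; apply: eq_bigr => j _.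
  rewrite sE inva // XE orthconjX // linearZ /= -scalemxAr -scalemxAl.
  by [].
rewrite sympart_id ?AE // /orthconj !trmx_mul trmxK tr_diag_mx.
by rewrite mulmxA.
Qed.

End Transfer.

(** * Local equations of manifolds *)

Section SubspaceProjector.
Variables (R : realType).

(** Take a matrix of maximal rank among those whose row space lies in [L]. *)
Lemma subspace_matrix m (L : set 'rV[R]_m) : linear_subspace L ->
  exists B : 'M[R]_m, forall u, L u <-> (u <= B)%MS.
Proof.
move=> [L0 LP].
pose P r := `[< exists B : 'M[R]_m, (forall u : 'rV[R]_m, (u <= B)%MS -> L u) /\ \rank B = r >].
have ex : exists r, P r.
  exists 0%N; apply/asboolP; exists 0; rewrite mxrank0; split=> // u.
  by rewrite submx0 => /eqP ->.
have ub r : P r -> (r <= m)%N.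
  by move=> /asboolP[B [_ <-]]; exact: rank_leq_row.
case: (ex_maxnP ex ub) => r /asboolP[B [BL Br]] rmax.
exists B => u; split=> [Lu|/BL //].
pose C := (B + u)%MS.
have CL v : (v <= C)%MS -> L v.
  move=> /sub_addsmxP[[w1 w2] /= ->].
  rewrite addrC [w2]mx11_scalar mul_scalar_mx; apply: LP => //.
  by apply: BL; exact: submxMl.
have Cr : P (\rank C) by apply/asboolP; exists C.
have := rmax _ Cr; rewrite -Br => rle.
have BC : (B <= C)%MS by exact: addsmxSl.
have /eqmxP CB : (B == C)%MS by rewrite -(geq_leqif (mxrank_leqif_eq BC)).
by rewrite CB addsmxSr.
Qed.

Lemma subspace_projector (E : normedModType R) (L : set E) : framed E ->
  linear_subspace L -> exists p : E -> E,
  [/\ linear p, forall v, p (p v) = p v & forall v, L v <-> p v = 0].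
Proof.
move=> fE [L0 LP]; have [m [i [j [li lj ij ji]]]] := framed_iso fE.
have [|B BP] := @subspace_matrix m (j @^-1` L).
  split=> [|a u v /= Lu Lv]; first by rewrite /= (is_linear0 lj).
  by rewrite lj; exact: LP.
pose q (u : 'rV[R]_m) := u *m pinvmx B *m B.
have qB u : (q u <= B)%MS by exact: submxMl.
have qid u : (u <= B)%MS -> q u = u by exact: mulmxKpV.
exists (fun v => j (i v - q (i v))); split.
- move=> a u v; rewrite /q li !mulmxDl -!scalemxAl -lj; congr j.
  by rewrite scalerBr opprD addrACA.
- move=> v; rewrite ji; set w := i v - _; congr j.
  have -> : q w = q (i v) - q (q (i v)) by rewrite /q /w !mulmxBl.
  by rewrite (qid _ (qB _)) subrr subr0.
- move=> v; rewrite -[v in L v]ij; split=> [/BP/qid ->|h].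
    by rewrite subrr (is_linear0 lj).
  apply/BP; have : i v - q (i v) = 0 by rewrite -[LHS]ji h (is_linear0 li).
  by move=> /subr0_eq ->.
Qed.

End SubspaceProjector.

Section Manifolds.
Variables (R : realType) (E : normedModType R).
Hypothesis fE : framed E.

(** If [y] takes values in the range of the projector [P] and has differential
    [P] at [z], this map has the identity as differential at [z], and it sends
    [y = 0] to the kernel of [P]. *)
Definition straighten (P : E -> E) (z : E) (y : E -> E) (x : E) : E :=
  (x - z) - P (x - z) + y x.

Lemma straighten_smooth P z y U : linear P -> open U -> smooth U y ->
  smooth U (straighten P z y).
Proof.
move=> lP oU sy k; apply: Ck_add => //.
have Cs : Ck k U (fun x => x - z).
  by apply: Ck_sub => //; [exact: Ck_id|exact: Ck_cst].
apply: Ck_sub => //; apply: (@Ck_comp_linear _ _ _ _ _ _ (fun x => x - z) P) => //.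
exact: framed_continuous.
Qed.

Lemma straighten_diff P z y : linear P -> differentiable y z ->
  'd y z = P :> (E -> E) -> 'd (straighten P z y) z = id :> (E -> E).
Proof.
move=> lP dy dyE; suff [_ ->] : differentiable (straighten P z y) z /\
  'd (straighten P z y) z = id :> (E -> E) by [].
apply: diff_nearP => [//|x|e e0]; first exact: cvg_id.
apply: filterS (diff_near dy e0) => x; rewrite dyE.
suff -> : straighten P z y x - straighten P z y z - (x - z) = y x - y z - P (x - z) by [].
rewrite /straighten subrr (is_linear0 lP) subrr add0r.
move: (P (x - z)) (x - z) (y x) (y z) => p a b c.
by rewrite [LHS]addrC !addrA addNr sub0r -addrA addrC.
Qed.

Lemma manifold_of_equation (P y : E -> E) (U Q : set E) z :
  open U -> U z -> linear P -> (forall v, P (P v) = P v) -> smooth U y ->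
  (forall x, U x -> P (y x) = y x) -> 'd y z = P :> (E -> E) ->
  (forall x, U x -> (Q x <-> y x = 0)) -> Q z -> manifold_around Q z.
Proof.
move=> oU Uz lP PP sy Py dy QE Qz.
have dyz : differentiable y z by exact: smooth_differentiable (sy 1%N) Uz.
have [U1 [V1 [psi [U1z U1U sd]]]] := inverse_function fE oU Uz
  (straighten_smooth z lP oU sy) (straighten_diff lP dyz dy).
split=> //; exists U1; split=> //; first by case: sd => -[].
exists [set v | P v = 0].
  split=> [|a u v /= Pu Pv]; first exact: is_linear0.
  by rewrite lP Pu Pv scaler0 addr0.
move=> z' [_ U1z']; exists U1, V1, (straighten P z y), psi; split=> // x U1x.
have -> : [set v | P v = 0] (straighten P z y x) = (y x = 0).
  rewrite /= /straighten (is_linearD lP) (is_linearB lP) PP subrr add0r Py //.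
  exact: U1U.
by rewrite -QE; [split=> [[]|]|exact: U1U].
Qed.

Lemma diff_vanish (F G : normedModType R) (f : F -> G) x w : differentiable f x ->
  (\forall t \near (0 : R)^', f (x + t *: w) = f x) -> 'd f x w = 0.
Proof.
move=> df f0; have [->|w0] := eqVneq w 0; first by rewrite linear0.
have nw : 0 < `|w| by rewrite normr_gt0.
apply/eqP; rewrite -normr_le0; apply/ler_addgt0Pr => e e0; rewrite add0r.
have e'0 : 0 < e / `|w| by rewrite divr_gt0.
have c1 : (fun t : R => x + t *: w) @ (0 : R)^' --> x.
  apply: cvg_within_filter; rewrite -[X in _ --> nbhs X]addr0 -[X in _ --> nbhs (_ + X)](scale0r w).
  by apply: cvgD; [exact: cvg_cst|apply: cvgZr_tmp; exact: cvg_id].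
have h1 : \forall t \near (0 : R)^', `|f (x + t *: w) - f x - 'd f x (x + t *: w - x)|
    <= e / `|w| * `|x + t *: w - x| := c1 _ (diff_near df e'0).
have n0 : \forall t \near (0 : R)^', t != 0 by exact: nbhs_dnbhs_neq.
have /filter_ex[t [h ft t0]] : \forall t \near (0 : R)^',
    [/\ `|f (x + t *: w) - f x - 'd f x (x + t *: w - x)|
    <= e / `|w| * `|x + t *: w - x|, f (x + t *: w) = f x & t != 0].
  by apply: filterS3 h1 f0 n0.
move: h; rewrite ft subrr sub0r normrN addrC addKr linearZ /= !normrZ mulrCA divfK ?gt_eqF //.
by rewrite ler_pM2l ?normr_gt0.
Qed.

Lemma diff_local_inverse (phi psi : E -> E) z v : differentiable phi z ->
  differentiable psi (phi z) -> (\forall x \near z, (psi \o phi) x = x) ->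
  'd psi (phi z) ('d phi z v) = v.
Proof.
move=> dphi dpsi nU.
have dc := differentiable_comp dphi dpsi.
have E1 : 'D_v (psi \o phi) z = 'd (psi \o phi) z v by exact: deriveE.
have E2 : 'd (psi \o phi) z v = 'd psi (phi z) ('d phi z v).
  exact: (congr1 (fun h : E -> E => h v) (diff_comp dphi dpsi)).
by rewrite -E2 -E1 (near_eq_derive v nU) derive_id.
Qed.

(** With [phi] a chart, [A] its differential at [z] and [p] a projector whose
    kernel is the model space, [y = A^-1 p phi] is an equation whose
    differential is the projector [P = A^-1 p A]. The kernel of [P] is the
    tangent space; the last clause says that a linear map that fixes [z] and
    preserves the manifold nearby preserves it. *)
Lemma equation_of_manifold (Q : set E) z : manifold_around Q z ->
  exists (U : set E) (P y : E -> E), [/\ open U, U z, linear P,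
    forall v, P (P v) = P v & [/\ smooth U y, forall x, U x -> P (y x) = y x,
     'd y z = P :> (E -> E), forall x, U x -> (Q x <-> y x = 0) &
     forall g : E -> E, linear g -> g z = z ->
       (\forall x \near z, Q x -> Q (g x)) -> forall v, P v = 0 -> P (g v) = 0]].
Proof.
move=> [Qz [U0 [oU0 U0z [L linL emb]]]].
have [U1 [V1 [phi [psi [U1z sd QL]]]]] := emb z (conj Qz U0z).
have [[oU1 oV1] sphi spsi phiK psiK] := sd.
have [V1z psiz] := phiK z U1z.
have dphi : differentiable phi z := smooth_differentiable (sphi 1%N) U1z.
have dpsi : differentiable psi (phi z) := smooth_differentiable (spsi 1%N) V1z.
pose A := 'd phi z : E -> E; pose B := 'd psi (phi z) : E -> E.
have lA : linear A by move=> a u v; rewrite /A linearP.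
have lB : linear B by move=> a u v; rewrite /B linearP.
have nU : \forall x \near z, (psi \o phi) x = id x.
  by apply: filterS (open_nbhs_nbhs (conj oU1 U1z)) => x /phiK[].
have nV : \forall w \near phi z, (phi \o psi) w = id w.
  by apply: filterS (open_nbhs_nbhs (conj oV1 V1z)) => x /psiK[].
have BA v : B (A v) = v by exact: diff_local_inverse.
have AB v : A (B v) = v.
  have dphi' : differentiable phi (psi (phi z)) by rewrite psiz.
  by have := diff_local_inverse v dpsi dphi' nV; rewrite psiz.
have [p [lp pp pL]] := subspace_projector fE linL.
pose P v := B (p (A v)); pose y x := B (p (phi x)).
have lP : linear P by move=> a u v; rewrite /P lA lp lB.
have PP v : P (P v) = P v by rewrite /P AB pp.
have cB : continuous B by exact: framed_continuous.
have cp : continuous p by exact: framed_continuous.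
have sy : smooth U1 y.
  move=> k; apply: (@Ck_comp_linear _ _ _ _ _ _ (p \o phi) B) => //.
  by apply: Ck_comp_linear.
have dyE : 'd y z = P :> (E -> E).
  have [dp dpE] := diff_linear (phi z) lp cp.
  have [dB dBE] := diff_linear (p (phi z)) lB cB.
  have dpphi : differentiable (p \o phi) z by exact: differentiable_comp.
  by rewrite (_ : y = B \o (p \o phi)) // diff_comp // dBE diff_comp // dpE.
exists (U0 `&` U1), P, y; split=> //; first exact: openI.
split.
- by move=> k; apply: CkW (sy k) => x [].
- by move=> x _; rewrite /P /y AB pp.
- exact: dyE.
- move=> x [U0x U1x]; have := QL x U1x.
  have -> : (Q `&` U0) x = Q x by rewrite propeqE; split=> [[]|].
  move=> ->; rewrite pL; split=> [h|h]; first by rewrite /y h is_linear0.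
  by rewrite -[p _]AB -/(y x) h is_linear0.
- move=> g lg gz Qg v Pv; have cg := framed_continuous fE lg.
  have pAv : p (A v) = 0 by rewrite -[LHS]AB -/(P v) Pv is_linear0.
  have pz : p (phi z) = 0.
    by apply/pL/(QL z U1z); split.
  have cpsi : psi @ phi z --> z by rewrite -[X in _ --> X]psiz; exact: (spsi 0%N).
  have cgz : g @ z --> z by rewrite -[X in _ --> X]gz; exact: cg.
  have nU01 : \forall x \near z, U0 x /\ U1 x.
    by apply: open_nbhs_nbhs; split; [exact: openI|].
  have nQ : \forall x \near z, [/\ U0 x, Q x -> Q (g x), U0 (g x) & U1 (g x)].
    have ngU := cgz _ nU01.
    apply: filterS2 (filterI nU01 Qg) ngU => x [[h1 h2] h3] [h4 h5]; by split.
  have nV1 : \forall u \near phi z, V1 u by exact: open_nbhs_nbhs.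
  have n1 : \forall u \near phi z, V1 u /\
      [/\ U0 (psi u), Q (psi u) -> Q (g (psi u)), U0 (g (psi u)) & U1 (g (psi u))].
    by apply: filterI nV1 (cpsi _ nQ).
  have ct : (fun t : R => phi z + t *: A v) @ (0 : R)^' --> phi z.
    apply: cvg_within_filter; rewrite -[X in _ --> nbhs X]addr0.
    rewrite -[X in _ --> nbhs (_ + X)](scale0r (A v)).
    by apply: cvgD; [exact: cvg_cst|apply: cvgZr_tmp; exact: cvg_id].
  have dg := diff_linear z lg cg; have [dgz dgE] := dg.
  have dy : differentiable y z := smooth_differentiable (sy 1%N) U1z.
  have dgpsi : differentiable g (psi (phi z)) by rewrite psiz.
  have dgp : differentiable (g \o psi) (phi z) by exact: differentiable_comp.
  have dygp : differentiable y ((g \o psi) (phi z)) by rewrite /= psiz gz.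
  have dF : differentiable (y \o (g \o psi)) (phi z) by exact: differentiable_comp.
  have y0 x : U0 x -> U1 x -> Q x -> y x = 0.
    move=> U0x U1x Qx; rewrite /y (_ : p (phi x) = 0) ?is_linear0 //.
    by apply/pL/(QL x U1x); split.
  have E1 : 'd (y \o (g \o psi)) (phi z) (A v) =
      'd y ((g \o psi) (phi z)) ('d (g \o psi) (phi z) (A v)).
    exact: (congr1 (fun h : E -> E => h (A v)) (diff_comp dgp dygp)).
  have E2 : 'd (g \o psi) (phi z) (A v) = 'd g (psi (phi z)) (B (A v)).
    exact: (congr1 (fun h : E -> E => h (A v)) (diff_comp dpsi dgpsi)).
  have -> : P (g v) = 'd (y \o (g \o psi)) (phi z) (A v).
    by rewrite E1 E2 BA /= psiz gz dgE dyE.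
  apply: diff_vanish => //=.
  have yz0 : y z = 0 by exact: y0.
  have n2 : \forall t \near (0 : R)^', V1 (phi z + t *: A v) /\
    [/\ U0 (psi (phi z + t *: A v)),
       Q (psi (phi z + t *: A v)) -> Q (g (psi (phi z + t *: A v))),
       U0 (g (psi (phi z + t *: A v))) & U1 (g (psi (phi z + t *: A v)))] := ct _ n1.
  rewrite psiz gz yz0; apply: filterS n2 => t [V1t [h1 h2 h3 h4]].
  apply: y0 => //; apply: h2.
  have [U1t phit] := psiK _ V1t.
  by have [] : (Q `&` U0) (psi (phi z + t *: A v)) by apply/(QL _ U1t)/pL;
    rewrite phit (is_linearD lp) (is_linearZ lp) pz pAv scaler0 addr0.
Qed.

Lemma derive_comp_linear (F G H : normedModType R) (L : G -> H) (f : F -> G) x v :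
  linear L -> continuous L -> differentiable f x ->
  differentiable (L \o f) x /\ 'D_v (L \o f) x = L ('D_v f x).
Proof.
move=> lL cL df; have [dL dLE] := diff_linear (f x) lL cL.
have dc : differentiable (L \o f) x by exact: differentiable_comp.
split=> //; rewrite (deriveE v dc) (deriveE v df).
by rewrite (diff_comp df dL) dLE.
Qed.

(** A finite group acting linearly on [E], given by its multiplication table on
    the index type. *)
Section Averaging.
Variables (I : finType) (A : I -> E -> E) (one : I) (inv : I -> I) (mul : I -> I -> I).
Hypotheses (lA : forall i, linear (A i)) (A1 : forall x, A one x = x).
Hypotheses (AV : forall i x, A (inv i) (A i x) = x) (AVr : forall i x, A i (A (inv i) x) = x).
Hypotheses (AM : forall i j x, A i (A j x) = A (mul i j) x).
Hypothesis mul_inj : forall j, injective (mul^~ j).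

(** The mean of the conjugates of [f] under the group. *)
Definition average (f : E -> E) (x : E) : E :=
  (#|I|%:R)^-1 *: \sum_i A (inv i) (f (A i x)).

Lemma card_index_neq0 : (#|I|%:R : R) != 0.
Proof. by rewrite pnatr_eq0 -lt0n; apply/card_gt0P; exists one. Qed.

Lemma average_cst f x y : (forall i, A (inv i) (f (A i x)) = y) -> average f x = y.
Proof.
move=> h; rewrite /average (eq_bigr (fun=> y)) // sumr_const -[y *+ _]scaler_nat scalerA.
by rewrite mulVf ?scale1r // card_index_neq0.
Qed.

Lemma average_equivariant f j x : average f (A j x) = A j (average f x).
Proof.
rewrite /average (is_linearZ (lA j)) (is_linear_sum (lA j)); congr (_ *: _).
rewrite [RHS](reindex_inj (@mul_inj j)) /=; apply: eq_bigr => i _.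
rewrite -AM; set w := f _; set u := A (inv (mul i j)) w.
by have -> : w = A i (A j u) by [rewrite AM AVr]; rewrite AV.
Qed.

Lemma average_linear f : linear f -> linear (average f).
Proof.
move=> lf a u v; rewrite /average scalerA mulrC -scalerA -scalerDr; congr (_ *: _).
rewrite scaler_sumr -big_split; apply: eq_bigr => i _.
by rewrite !lA lf lA.
Qed.

Let cA i : continuous (A i). Proof. exact: framed_continuous. Qed.

Lemma average_smooth (U : set E) f : (forall i x, U x -> U (A i x)) -> open U ->
  smooth U f -> smooth U (average f).
Proof.
move=> UA oU sf k; apply: Ck_scale_cst => //; apply: Ck_sum => // i.
apply: (@Ck_comp_linear _ _ _ _ _ _ (f \o A i) (A (inv i))) => //.
apply: (@Ck_comp _ _ _ _ _ U U (A i) f) => //; first exact: UA.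
exact: Ck_linear.
Qed.

Lemma open_saturation (U : set E) : open U -> open [set x | forall i, U (A i x)].
Proof.
move=> oU; rewrite openE => x Ux; rewrite /interior /=.
by apply: filter_forall => i; apply: cA; exact: open_nbhs_nbhs.
Qed.

(** Start from an equation [y0] with projector [P0]. All conjugates of [P0] are
    projectors with the same kernel, the tangent space, and so is their mean
    [P], which commutes with the group. The mean of the conjugates of [y0],
    projected by [P], is an equivariant [y] with differential [P] at [z], and it
    vanishes on [Q]. Conversely let [y x = 0]. The inverse function theorem for
    the equation [P (y0 _) = 0] gives a point [w] of [Q] with the same tangent
    coordinate as [x], and [y w = 0] too; but tangent coordinate and value of
    [y] together determine a point near [z], so [x = w]. *)
Lemma equivariant_equation (Q : set E) z : (forall i, A i z = z) ->
  (\forall x \near z, forall i, Q x <-> Q (A i x)) -> manifold_around Q z ->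
  exists (U : set E) (P y : E -> E),
  [/\ open U, U z, forall i x, U x -> U (A i x), linear P & forall v, P (P v) = P v] /\
  [/\ forall i v, P (A i v) = A i (P v), smooth U y,
     forall i x, y (A i x) = A i (y x), 'd y z = P :> (E -> E) &
     forall x, U x -> P (y x) = y x /\ (Q x <-> y x = 0)].
Proof.
move=> Az Qinv mQ.
have [U0 [P0 [y0 [oU0 U0z lP0 PP0 [sy0 Py0 dy0 Qy0 T0]]]]] := equation_of_manifold mQ.
have TA i v : P0 v = 0 -> P0 (A i v) = 0.
  by apply: T0 => //; apply: filterS Qinv => x /(_ i)[].
have P0A i v : P0 (A (inv i) (P0 (A i v))) = P0 v.
  apply/esym/subr0_eq; rewrite -(is_linearB lP0).
  have -> : v - A (inv i) (P0 (A i v)) = A (inv i) (A i v - P0 (A i v)).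
    by rewrite (is_linearB (lA _)) AV.
  by apply: TA; rewrite (is_linearB lP0) PP0 subrr.
pose P := average P0; pose y x := P (average y0 x).
have lP : linear P by exact: average_linear.
have P0P v : P0 (P v) = P0 v.
  rewrite /P /average (is_linearZ lP0) (is_linear_sum lP0).
  rewrite (eq_bigr (fun=> P0 v)) // sumr_const -[P0 v *+ _]scaler_nat scalerA.
  by rewrite mulVf ?scale1r // card_index_neq0.
have kerP v : P0 v = 0 -> P v = 0.
  by move=> Pv; apply: average_cst => i; rewrite TA // (is_linear0 (lA _)).
have PP0' v : P (P0 v) = P v.
  by apply/subr0_eq; rewrite -(is_linearB lP) kerP // (is_linearB lP0) PP0 subrr.
have PP v : P (P v) = P v.
  by apply/subr0_eq; rewrite -(is_linearB lP) kerP // (is_linearB lP0) P0P subrr.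
have eP i v : P (A i v) = A i (P v) by exact: average_equivariant.
have ey i x : y (A i x) = A i (y x) by rewrite /y average_equivariant eP.
pose W := [set x | forall i, U0 (A i x)].
have oW : open W by exact: open_saturation.
have Wz : W z by move=> i; rewrite Az.
have WU0 x : W x -> U0 x by move=> /(_ one); rewrite A1.
have WA i x : W x -> W (A i x) by move=> Wx j; rewrite AM; exact: Wx.
have cP := framed_continuous fE lP.
have sy : smooth W y.
  move=> k; apply: (@Ck_comp_linear _ _ _ _ _ _ (average y0) P) => //.
  by apply: average_smooth => // k'; apply: CkW (sy0 k') => x /WU0.
have y0z : y0 z = 0 by apply/(Qy0 z U0z); case: mQ.
have dy0z : differentiable y0 z := smooth_differentiable (sy0 1%N) U0z.
have dyz : differentiable y z := smooth_differentiable (sy 1%N) Wz.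
have dyE : 'd y z = P :> (E -> E).
  apply/funext => v; rewrite -(deriveE v dyz).
  pose g i x := A (inv i) (y0 (A i x)).
  have dyA i : differentiable (y0 \o A i) z /\ 'D_v (y0 \o A i) z = P0 (A i v).
    have [dA dAE] := diff_linear z (lA i) (@cA i).
    have dy0' : differentiable y0 (A i z) by rewrite Az.
    have dc : differentiable (y0 \o A i) z by exact: differentiable_comp.
    have E1 : 'd (y0 \o A i) z v = 'd y0 (A i z) ('d (A i) z v).
      exact: (congr1 (fun h : E -> E => h v) (diff_comp dA dy0')).
    by split=> //; rewrite (deriveE v dc) E1 dAE Az dy0.
  have dg i : differentiable (g i) z /\ 'D_v (g i) z = A (inv i) (P0 (A i v)).
    have [d1 d2] := dyA i.
    by have [] := derive_comp_linear v (lA (inv i)) (@cA (inv i)) d1; rewrite d2.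
  pose L w := P ((#|I|%:R)^-1 *: w).
  have lL : linear L.
    by move=> a u w; rewrite /L scalerDr scalerA mulrC -scalerA lP.
  have cL := framed_continuous fE lL.
  have dsum : differentiable (fun x => \sum_i g i x) z.
    elim: (index_enum I) => [|i r IH].
      by under eq_fun do rewrite big_nil; exact: differentiable_cst.
    by under eq_fun do rewrite big_cons; apply: differentiableD => //; case: (dg i).
  have [_ ->] := derive_comp_linear v lL cL dsum.
  rewrite derive_bigsum; last by move=> i; case: (dg i).
  rewrite -[RHS]PP /L; congr (P (_ *: _)); apply: eq_bigr => i _.
  by case: (dg i).
pose y1 x := P (y0 x).
have sy1 : smooth U0 y1.
  by move=> k; apply: (@Ck_comp_linear _ _ _ _ _ _ y0 P).
have dy1z : differentiable y1 z := smooth_differentiable (sy1 1%N) U0z.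
have dy1E : 'd y1 z = P :> (E -> E).
  apply/funext => v; rewrite -(deriveE v dy1z).
  have [_ ->] := derive_comp_linear v lP cP dy0z.
  by rewrite (deriveE v dy0z) dy0.
have fwd x : W x -> (forall i, Q x <-> Q (A i x)) -> Q x -> y x = 0.
  move=> Wx Qx Q1; rewrite /y (_ : average y0 x = 0) ?(is_linear0 lP) //.
  apply: average_cst => i; rewrite (_ : y0 _ = 0) ?(is_linear0 (lA _)) //.
  by apply/(Qy0 _ (Wx i))/Qx.
have [U2 [V2 [psi2 [U2z U2W sd2]]]] := inverse_function fE oW Wz
  (straighten_smooth z lP oW sy) (straighten_diff lP dyz dyE).
have [U3 [V3 [psi3 [U3z U3U sd3]]]] := inverse_function fE oU0 U0z
  (straighten_smooth z lP oU0 sy1) (straighten_diff lP dy1z dy1E).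
have [[oU2 oV2] _ _ psi2K _] := sd2.
have [[oU3 oV3] _ spsi3 psi3K psi3E] := sd3.
(* The tangent coordinate of x. *)
pose e x := (x - z) - P (x - z).
have ez : straighten P z y1 z = e z.
  by rewrite /straighten /y1 y0z (is_linear0 lP) addr0.
have [V3z psi3z] := psi3K _ U3z; rewrite ez in V3z psi3z.
have ce : {for z, continuous e}.
  apply: cvgB; first by apply: cvgB; [exact: cvg_id|exact: cvg_cst].
  apply: (@continuous_comp _ _ _ (fun x => x - z) P); last exact: cP.
  by apply: cvgB; [exact: cvg_id|exact: cvg_cst].
have ce' : e @ z --> e z by exact: ce.
have ne : \forall x \near z, V3 (e x) /\ (U2 (psi3 (e x)) /\
    forall i, Q (psi3 (e x)) <-> Q (A i (psi3 (e x)))).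
  have c3 : psi3 @ e z --> z by rewrite -[X in _ --> X]psi3z; exact: (spsi3 0%N).
  have n3 : \forall u \near e z, V3 u by exact: open_nbhs_nbhs.
  have n2 : \forall x \near z, U2 x by exact: open_nbhs_nbhs.
  have n4 : \forall x \near z, U2 x /\ forall i, Q x <-> Q (A i x) by exact: filterI.
  have n5 : \forall u \near e z, V3 u /\ (U2 (psi3 u) /\
    forall i, Q (psi3 u) <-> Q (A i (psi3 u))) by apply: filterI n3 (c3 _ n4).
  exact: (ce' _ n5).
have key : \forall x \near z, y x = 0 -> Q x.
  have n2 : \forall x \near z, U2 x by exact: open_nbhs_nbhs.
  apply: filterS2 n2 ne => x U2x [V3e [U2w Qw] yx].
  have [U3w wE] := psi3E _ V3e; set w := psi3 (e x) in U2w Qw U3w wE.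
  have Pe u : P (e u) = 0 by rewrite /e (is_linearB lP) PP subrr.
  have y1w : y1 w = 0.
    have := congr1 P wE; rewrite Pe /straighten (is_linearD lP) -/(e w) Pe add0r.
    by rewrite /y1 PP.
  have y0w : y0 w = 0.
    rewrite -(Py0 w (U3U _ U3w)) -P0P.
    have -> : P (y0 w) = 0 by exact: y1w.
    exact: is_linear0 lP0.
  have Q1 : Q w by apply/(Qy0 _ (U3U _ U3w)).
  have yw := fwd w (U2W _ U2w) Qw Q1.
  have ew : e w = e x by rewrite -wE /straighten y1w addr0.
  have [_ psx] := psi2K _ U2x; have [_ psw] := psi2K _ U2w.
  rewrite -psx (_ : straighten P z y x = straighten P z y w) ?psw //.
  by rewrite /straighten yx yw !addr0 -/(e x) -ew.
have nW : \forall x \near z, W x by exact: open_nbhs_nbhs.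
have /near_ballP[r r0 rP] : \forall x \near z, [/\ W x, forall i, Q x <-> Q (A i x) & y x = 0 -> Q x].
  by apply: filterS3 nW Qinv key.
pose N := [set x | `|x - z| < r].
have oN : open N.
  have -> : N = ball z r.
    by rewrite -ball_normE; apply/seteqP; split=> x /=; rewrite /N /= distrC.
  exact: ball_open.
exists [set x | forall i, N (A i x)], P, y; split.
  split=> //; first exact: open_saturation.
  - by move=> i; rewrite /N /= Az subrr normr0.
  - by move=> i x Nx j; rewrite AM; exact: Nx.
have NN x : (forall i, N (A i x)) -> N x by move=> /(_ one); rewrite A1.
split=> //.
- by move=> k; apply: CkW (sy k) => x /NN /rP[].
- move=> x /NN /rP[Wx Qx yQ]; split; first exact: PP.
  by split=> //; exact: fwd.
Qed.

End Averaging.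

End Manifolds.

(** * Orthogonal conjugation and the gap between eigenvalues *)

Section LinearTransfer.
Variables (R : realType) (E : normedModType R).
Hypothesis fE : framed E.

(** Charts are transported by conjugation with the isomorphism. *)
Lemma manifold_linear_iso (c c' : E -> E) (Q Q' : set E) z :
  linear c -> linear c' -> cancel c c' -> cancel c' c ->
  (forall x, Q' (c x) <-> Q x) -> manifold_around Q z -> manifold_around Q' (c z).
Proof.
move=> lc lc' cK c'K QQ [Qz [U0 [oU0 U0z [L linL emb]]]].
have cc := framed_continuous fE lc; have cc' := framed_continuous fE lc'.
have o' (U : set E) : open U -> open (c' @^-1` U).
  by move=> oU; apply: open_comp => // x _; exact: cc'.
split; first exact/QQ.
exists (c' @^-1` U0); split; [exact: o'|by rewrite /= cK|].
exists L => // z' [Q'z' U0z'].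
have [|U1 [V1 [phi [psi [U1z [[oU1 oV1] sphi spsi phiK psiK] QL]]]]] := emb (c' z').
  by split=> //; apply/QQ; rewrite c'K.
exists (c' @^-1` U1), V1, (phi \o c'), (c \o psi); split=> //.
  split.
  - by split=> //; exact: o'.
  - move=> k; apply: (@Ck_comp _ _ _ _ _ _ U1) => //; first exact: o'.
    exact: Ck_linear.
  - by move=> k; exact: Ck_comp_linear.
  - by move=> x /= /phiK[? ->].
  - by move=> y /psiK[? ?] /=; rewrite cK.
move=> x U1x; rewrite /= -QL //; split=> [[Q'x ?]|[Qx ?]]; split=> //.
  by apply/QQ; rewrite c'K.
by rewrite -[x]c'K; apply/QQ.
Qed.

End LinearTransfer.

Section SymmetricConjugation.
Variables (R : realType) (n : nat).
Local Notation S := (sym_matrix R n).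
Local Notation M := 'M[R]_n.
Local Notation E := 'rV[R]_n.

Lemma orthconj_linear (U : M) : linear (orthconj U).
Proof. by move=> a X Y; rewrite /orthconj linearP /= mulmxDl -scalemxAl. Qed.

Lemma trmx_orthconj (U X : M) : (orthconj U X)^T = orthconj U X^T.
Proof. by rewrite /orthconj !trmx_mul trmxK mulmxA. Qed.

Definition conjS (U : M) (X : S) : S := sympart (orthconj U X).

Lemma conjSE U X : conjS U X = orthconj U X :> M.
Proof. by rewrite sympart_id // trmx_orthconj sym_tr. Qed.

Lemma conjS_linear U : linear (conjS U).
Proof.
move=> a X Y; apply: sym_inj; rewrite conjSE /= !conjSE.
by rewrite -orthconj_linear.
Qed.

Lemma conjSK U : orthmx U -> cancel (conjS U) (conjS U^T).
Proof.
move=> oU X; apply: sym_inj; rewrite !conjSE /orthconj trmxK.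
by rewrite !mulmxA oU mul1mx -mulmxA oU mulmx1.
Qed.

Lemma trmx_orthmx (U : M) : orthmx U -> orthmx U^T.
Proof. by move=> oU; rewrite /orthmx trmxK orthmxT. Qed.

Lemma eigvals_eq (X Y : S) : char_poly X = char_poly Y -> eigvals X = eigvals Y.
Proof.
move=> XY; have [xs xE] := eigvalsP X; apply: (@is_eigvals_inj _ _ Y).
  by split; rewrite // -XY.
exact: eigvalsP.
Qed.

Lemma eigvals_conjS U X : orthmx U -> eigvals (conjS U X) = eigvals X.
Proof.
move=> oU; apply: eigvals_eq; rewrite conjSE /orthconj -invmx_orth //.
by rewrite char_poly_similar // orthmx_unit.
Qed.

Definition diagS (x : E) : S := sympart (diag_mx x).

Lemma diagSE x : diagS x = diag_mx x :> M.
Proof. by rewrite sympart_id // tr_diag_mx. Qed.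

Lemma diagS_linear : linear diagS.
Proof. by move=> a x y; apply: sym_inj; rewrite /= !diagSE linearP. Qed.

Lemma orthconj1 (X : M) : orthconj 1%:M X = X.
Proof. by rewrite /orthconj trmx1 mul1mx mulmx1. Qed.

Lemma eigvals_diagS x : exists s : 'S_n, eigvals (diagS x) = col_perm s x.
Proof.
by apply: (@eigvals_diag _ _ _ 1%:M); [exact: orthmx1|rewrite orthconj1 diagSE].
Qed.

Definition nonincreasing (x : E) := forall i j : 'I_n, (i <= j)%N -> x 0 j <= x 0 i.

Lemma eigvals_diagS_sorted x : nonincreasing x -> eigvals (diagS x) = x.
Proof.
move=> xs; apply: (@is_eigvals_inj _ _ (diagS x)); first exact: eigvalsP.
split=> //; rewrite diagSE -[diag_mx x]orthconj1 orthconj_char_poly //.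
exact: orthmx1.
Qed.

Lemma norm_col_perm (s : 'S_n) (x : E) : `|col_perm s x| <= `|x|.
Proof. by apply: rV_norm_le => // i; rewrite mxE coord_le_norm. Qed.

End SymmetricConjugation.

Section Gap.
Variables (R : realType) (n : nat) (xb : 'rV[R]_n).
Local Notation E := 'rV[R]_n.

Lemma exists_gap : exists2 e : R, 0 < e &
  forall i j, `|xb 0 i - xb 0 j| < 2 * e -> xb 0 i = xb 0 j.
Proof.
pose d (p : 'I_n * 'I_n) := if xb 0 p.1 == xb 0 p.2 then 1 else `|xb 0 p.1 - xb 0 p.2|.
have d0 p : 0 < d p.
  by rewrite /d; case: eqP => // /eqP h; rewrite normr_gt0 subr_eq0.
have /near_ballP[e e0 eP] : \forall t \near (0 : R), forall p, t < d p.
  have h p : \forall t \near (0 : R), t < d p.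
    apply/near_ballP; exists (d p) => // t; rewrite subr0.
    by apply: le_lt_trans; exact: ler_norm.
  exact: (@filter_forall _ _ (fun p t => t < d p) _ _ h).
exists (e / 4) => [|i j h]; first by rewrite divr_gt0.
have := eP (e / 2); rewrite subr0 gtr0_norm ?divr_gt0 // => /(_ _ (i, j)).
rewrite /d /=; case: eqP => // _; have : e / 2 < e by lra.
by move=> h1 /(_ h1); move: h; lra.
Qed.

(** Half a lower bound for the distance between distinct values of [xb]. *)
Definition gap : R := projT1 (cid2 exists_gap).
Lemma gap_gt0 : 0 < gap. Proof. by rewrite /gap; case: cid2. Qed.
Lemma gapP i j : `|xb 0 i - xb 0 j| < 2 * gap -> xb 0 i = xb 0 j.
Proof. by rewrite /gap; case: cid2 => /= e _; exact. Qed.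

(** If both [x] and [s x] are close to [xb] then [xb] and [s xb] have close
    entries, hence equal ones. *)
Lemma gap_perm (s : 'S_n) (x : E) : `|x - xb| < gap -> `|col_perm s x - xb| < gap ->
  s \in Fix xb.
Proof.
move=> h1 h2; rewrite inE; apply/eqP/rowP => i; rewrite mxE; apply: gapP.
have : `|(x - xb) 0 (s i)| < gap by apply: le_lt_trans h1; exact: coord_le_norm.
have : `|(col_perm s x - xb) 0 i| < gap by apply: le_lt_trans h2; exact: coord_le_norm.
rewrite !mxE !ltr_norml; set a := x _ _; lra.
Qed.

Lemma ball_col_perm (s : 'S_n) (x : E) r : s \in Fix xb -> `|x - xb| < r ->
  `|col_perm s x - xb| < r.
Proof.
rewrite inE => /eqP sb; apply: le_lt_trans.
by rewrite -{1}sb -(is_linearB (@col_perm_linear R n s)) norm_col_perm.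
Qed.

End Gap.

(** * From the spectral set to the set of eigenvalues *)

Section LinearSandwich.
Variables (R : realType) (E F G H : normedModType R).

Lemma diff_sandwich (a : E -> F) (f : F -> G) (L : G -> H) x v :
  linear a -> continuous a -> linear L -> continuous L -> differentiable f (a x) ->
  'd (L \o (f \o a)) x v = L ('d f (a x) (a v)).
Proof.
move=> la ca lL cL df; have [da daE] := diff_linear x la ca.
have dfa : differentiable (f \o a) x by exact: differentiable_comp.
have [dc dcE] := derive_comp_linear v lL cL dfa.
rewrite -(deriveE v dc) dcE (deriveE v dfa); congr L.
have -> : 'd (f \o a) x v = 'd f (a x) ('d a x v).
  exact: (congr1 (fun h : E -> G => h v) (diff_comp da df)).
by rewrite daE.
Qed.

End LinearSandwich.

Section Restriction.
Variables (R : realType) (n : nat).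
Local Notation S := (sym_matrix R n).
Local Notation M := 'M[R]_n.
Local Notation E := 'rV[R]_n.

Definition signmx (f : {ffun 'I_n -> bool}) : M := diag_mx (\row_i (-1) ^+ f i).

Lemma signmx_orth f : orthmx (signmx f).
Proof.
rewrite /orthmx /signmx tr_diag_mx mulmx_diag -[RHS]diag_const_mx; congr diag_mx.
by apply/rowP => i; rewrite !mxE -expr2 sqrr_sign.
Qed.

Lemma conj_signmxE f X i j :
  (conjS (signmx f) X : M) i j = (-1) ^+ f i * (X : M) i j * (-1) ^+ f j.
Proof. by rewrite conjSE /orthconj tr_diag_mx mul_mx_diag mul_diag_mx !mxE. Qed.

Definition diagpart (X : S) : E := \row_i (X : M) i i.

Lemma diagpart_linear : linear diagpart.
Proof. by move=> a X Y; apply/rowP => i; rewrite !mxE. Qed.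

Lemma diagSK x : diagpart (diagS x) = x.
Proof. by apply/rowP => i; rewrite !mxE diagSE mxE eqxx mulr1n. Qed.

Lemma conjS_conjS (U V : M) X : conjS U (conjS V X) = conjS (V *m U) X.
Proof. by apply: sym_inj; rewrite !conjSE /orthconj trmx_mul !mulmxA. Qed.

Lemma signmxM f g : signmx f *m signmx g = signmx [ffun i => g i (+) f i].
Proof.
rewrite mulmx_diag; congr diag_mx; apply/rowP => i.
by rewrite !mxE ffunE signr_addb mulrC.
Qed.

Lemma conj_signmx_diagS f x : conjS (signmx f) (diagS x) = diagS x.
Proof.
apply: sym_inj; apply/matrixP => i j; rewrite conj_signmxE diagSE !mxE.
have [->|ij] := eqVneq i j; last by rewrite mulr0n mulr0 mul0r.
by rewrite mulrC mulrA -expr2 sqrr_sign mul1r.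
Qed.

Lemma sign_invariant_diagonal (X : S) :
  (forall f, conjS (signmx f) X = X) -> X = diagS (diagpart X).
Proof.
move=> h; apply: sym_inj; rewrite diagSE; apply/matrixP => i j; rewrite !mxE.
have [->|ij] := eqVneq i j; first by rewrite mulr1n.
have := conj_signmxE [ffun k => k == i] X i j.
rewrite h !ffunE eqxx eq_sym (negPf ij) expr1 expr0 mulr1 mulr0n => Xij.
lra.
Qed.

(** The group is that of sign conjugations, under which the spectral set is
    invariant everywhere; diagonal matrices are its fixed points, so an
    equivariant equation restricts to them. *)
Lemma manifold_of_spectral (A : set E) xb : nonincreasing xb ->
  locally_symmetric A xb ->
  manifold_around (@eigvals R n @^-1` A) (diagS xb) -> manifold_around A xb.
Proof.
move=> xbs symA mQ; have exb := eigvals_diagS_sorted xbs.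
have fS := @framed_sym R n; have fE := @framed_rV R n.
have cdS := framed_continuous fE (@diagS_linear R n).
have cdg := framed_continuous fS diagpart_linear.
pose mul (f g : {ffun 'I_n -> bool}) := [ffun i => f i (+) g i].
pose a f (X : S) := conjS (signmx f) X.
have aa f g X : a f (a g X) = a (mul f g) X.
  by rewrite /a conjS_conjS signmxM.
have a1 X : a [ffun=> false] X = X.
  apply: sym_inj; apply/matrixP => i j; rewrite conj_signmxE !ffunE.
  by rewrite mulr1 mul1r.
have aV f X : a f (a f X) = X.
  by rewrite aa -[RHS]a1; congr (a _ X); apply/ffunP => i; rewrite !ffunE addbb.
have [|||||||||U [P [y [[oU Uz aU lP PP] [aP sy ay dy yE]]]]] :=
  @equivariant_equation R S fS {ffun 'I_n -> bool} a [ffun=> false] id mul _ _ _ _ _ _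
    (@eigvals R n @^-1` A) (diagS xb).
- by move=> f; exact: conjS_linear.
- exact: a1.
- exact: aV.
- exact: aV.
- exact: aa.
- by move=> f g h /ffunP e; apply/ffunP => i; have := e i; rewrite !ffunE => /addIb.
- by move=> f; exact: conj_signmx_diagS.
- apply/near_ballP; exists 1 => // X _ f.
  by rewrite /= eigvals_conjS //; exact: signmx_orth.
- exact: mQ.
(* The equation restricted to diagonal matrices. *)
pose Pn h := diagpart (P (diagS h)); pose yn x := diagpart (y (diagS x)).
have PnE h : P (diagS h) = diagS (Pn h).
  by apply: sign_invariant_diagonal => f; rewrite -[LHS]aP [a _ _]conj_signmx_diagS.
have ynE x : y (diagS x) = diagS (yn x).
  by apply: sign_invariant_diagonal => f; rewrite -[LHS]ay [a _ _]conj_signmx_diagS.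
have nx : \forall x \near xb, (forall s, s \in Fix xb -> (A x <-> A (col_perm s x))) /\
    (`|x - xb| < gap xb /\ `|diagS x - diagS xb| < gap xb).
  have n1 : \forall x \near xb, `|x - xb| < gap xb.
    by apply/near_ballP; exists (gap xb) => //; exact: gap_gt0.
  have n2 : \forall X \near diagS xb, `|X - diagS xb| < gap xb.
    by apply/near_ballP; exists (gap xb) => //; exact: gap_gt0.
  exact: (filterI symA (filterI n1 (cdS xb _ n2))).
have /near_ballP[r r0 rP] := nx.
pose Un := ball xb r `&` @diagS R n @^-1` U.
have oUn : open Un.
  apply: openI; first exact: ball_open.
  by apply: open_comp => // x _; exact: cdS.
have Pnl : linear Pn by move=> b u v; rewrite /Pn diagS_linear lP diagpart_linear.
apply: (@manifold_of_equation R E fE Pn yn Un) => //.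
- by split=> //; exact: ballxx.
- by move=> v; rewrite {1}/Pn -PnE PP.
- move=> k; apply: (@Ck_comp_linear _ _ _ _ _ _ (y \o @diagS R n) diagpart) => //.
    exact: diagpart_linear.
  apply: (@Ck_comp _ _ _ _ _ Un U (@diagS R n) y) => //; first by move=> x [].
  by apply: Ck_linear => //; exact: diagS_linear.
- by move=> x [_ Ux]; rewrite /Pn -ynE; have [-> _] := yE _ Ux.
- apply/funext => v; have dyz := smooth_differentiable (sy 1%N) Uz.
  rewrite (diff_sandwich v (@diagS_linear R n) cdS diagpart_linear cdg dyz).
  by rewrite dy.
- move=> x [xr Ux]; have [|sx [h1 h2]] := rP x.
    by move: xr; rewrite -ball_normE /= distrC.
  have [s sE] := eigvals_diagS x.
  have sF : s \in Fix xb.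
    have := weyl (diagS x) (diagS xb); rewrite exb sE => /le_lt_trans/(_ h2).
    exact: gap_perm h1.
  have [_ QE] := yE _ Ux; rewrite (sx s sF) -sE.
  apply: (iff_trans QE); rewrite ynE; split=> [h|->].
    by rewrite -[yn x]diagSK h (is_linear0 diagpart_linear).
  by rewrite (is_linear0 (@diagS_linear R n)).
- by rewrite -exb; case: mQ.
Qed.

End Restriction.

(** * Moving a symmetric matrix to a block-diagonal one *)

Section MatrixDerivative.
Variables (R : realType) (E : normedModType R).

Definition dmx m p (A : E -> 'M[R]_(m, p)) (x v : E) : 'M[R]_(m, p) :=
  \matrix_(i, j) 'D_v (fun z => A z i j) x.

Definition differentiable_mx m p (A : E -> 'M[R]_(m, p)) (x : E) :=
  forall i j, differentiable (fun z => A z i j) x.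

Lemma dmxM m p q (A : E -> 'M[R]_(m, p)) (B : E -> 'M[R]_(p, q)) x v :
  differentiable_mx A x -> differentiable_mx B x ->
  differentiable_mx (fun z => A z *m B z) x /\
  dmx (fun z => A z *m B z) x v = dmx A x v *m B x + A x *m dmx B x v.
Proof.
move=> dA dB.
have E1 i j : (fun z => (A z *m B z) i j) = (fun z => \sum_k A z i k * B z k j).
  by apply/funext => z; rewrite mxE.
have dAB i j k : differentiable (fun z => A z i k * B z k j) x.
  exact: differentiableM.
split=> [i j|].
  rewrite E1; elim: (index_enum _) => [|k r IH].
    by under eq_fun do rewrite big_nil; exact: differentiable_cst.
  by under eq_fun do rewrite big_cons; exact: differentiableD.
apply/matrixP => i j; rewrite !mxE E1 derive_bigsum // -big_split /=.
by apply: eq_bigr => k _; rewrite derive_mul // !mxE.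
Qed.

Lemma dmx_affine m p (c : 'M[R]_(m, p)) (L : E -> 'M[R]_(m, p)) x v :
  framed E -> linear L ->
  differentiable_mx (fun z => c + L z) x /\ dmx (fun z => c + L z) x v = L v.
Proof.
move=> fE lL.
have E1 i j : (fun z => (c + L z) i j) = (cst (c i j) + (fun z => L z i j) : E -> R).
  by apply/funext => z; rewrite mxE.
have lij i j : linear (fun z => L z i j : R) by move=> a u w; rewrite /= lL !mxE.
have cij i j : continuous (fun z => L z i j : R) by exact: framed_continuous.
have dij i j := (diff_linear x (lij i j) (@cij i j)).1.
split=> [i j|]; first by rewrite E1; apply: differentiableD.
apply/matrixP => i j; rewrite mxE E1 deriveD; [|exact: diff_derivable..].
rewrite derive_cst add0r; exact: derive_linear.
Qed.

End MatrixDerivative.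

Section Cayley.
Variables (R : realType) (n : nat).
Local Notation M := 'M[R]_n.

(** If [u = u A] then [u u^T = u A u^T], which vanishes for antisymmetric [A]. *)
Lemma antisym_unitmx (A : M) : A^T = - A -> 1%:M - A \in unitmx.
Proof.
move=> AT; rewrite -row_free_unit -kermx_eq0; apply/negPn/negP => /rowV0Pn[u /sub_kermxP uA].
have uE : u *m A = u by move: uA; rewrite mulmxBr mulmx1 => /subr0_eq.
have q : u *m u^T = - (u *m u^T).
  by rewrite -{1}uE -mulmxA -[A]opprK -AT mulNmx -trmx_mul uE mulmxN.
move=> /sqnorm_gt0; have := congr1 (fun B : 'M[R]_1 => B 0 0) q.
rewrite sqnormE !mxE eqxx mulr1n; lra.
Qed.

(** Unlike the exponential, a rational parametrisation of orthogonal matrices by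
    antisymmetric ones. *)
Definition cayley (A : M) : M := invmx (1%:M - A) *m (1%:M + A).

Lemma cayley_orth A : A^T = - A -> orthmx (cayley A).
Proof.
move=> AT; have u1 := antisym_unitmx AT.
have AT' : (- A)^T = - - A by rewrite linearN /= AT.
have := antisym_unitmx AT'; rewrite opprK => u2.
have PT : (1%:M + A)^T = 1%:M - A by rewrite linearD /= trmx1 AT.
have NT : (1%:M - A)^T = 1%:M + A by rewrite linearB /= trmx1 AT opprK.
rewrite /orthmx /cayley trmx_mul trmx_inv NT PT.
have C : (1%:M + A) *m (1%:M - A) = (1%:M - A) *m (1%:M + A).
  rewrite !mulmxDl !mulmxDr !mulmx1 !mul1mx !mulmxN !mulNmx -!addrA.
  by congr (_ + _); rewrite addrCA.
rewrite mulmxA -(mulmxA (invmx _)) C (mulmxA (invmx _)) mulVmx // mul1mx.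
by rewrite mulmxV.
Qed.

(** An identity without inverses, which can be differentiated by the product
    rule. *)
Lemma cayley_conj A B : A^T = - A ->
  (1%:M - A) *m orthconj (cayley A)^T B *m (1%:M + A) = (1%:M + A) *m B *m (1%:M - A).
Proof.
move=> AT; have u1 := antisym_unitmx AT.
have AT' : (- A)^T = - - A by rewrite linearN /= AT.
have := antisym_unitmx AT'; rewrite opprK => u2.
have PT : (1%:M + A)^T = 1%:M - A by rewrite linearD /= trmx1 AT.
have NT : (1%:M - A)^T = 1%:M + A by rewrite linearB /= trmx1 AT opprK.
rewrite /orthconj trmxK /cayley trmx_mul trmx_inv NT PT.
by rewrite !mulmxA mulmxV // mul1mx -!mulmxA mulVmx // mulmx1.
Qed.

End Cayley.

Section Blocks.
Variables (R : realType) (n : nat) (xb : 'rV[R]_n).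
Local Notation S := (sym_matrix R n).
Local Notation M := 'M[R]_n.
Local Notation E := 'rV[R]_n.

(** Blocks are the classes of indices at which [xb] takes the same value. *)
Definition block_diagonal (X : M) := forall i j, xb 0 i != xb 0 j -> X i j = 0.

Lemma block_diagonalP X : block_diagonal X <-> diag_mx xb *m X = X *m diag_mx xb.
Proof.
split=> [h|/matrixP h i j ij]; last first.
  have := h i j; rewrite mul_diag_mx mul_mx_diag !mxE => e.
  have : (xb 0 i - xb 0 j) * X i j = 0 by rewrite mulrBl e mulrC subrr.
  by move=> /eqP; rewrite mulf_eq0 subr_eq0 (negPf ij) => /eqP.
apply/matrixP => i j; rewrite mul_diag_mx mul_mx_diag !mxE mulrC.
by have [->|/h ->] := eqVneq (xb 0 i) (xb 0 j); rewrite ?mul0r.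
Qed.

Lemma block_diagonal_orthconj V h : orthmx V -> block_diagonal V ->
  block_diagonal (orthconj V (diag_mx h)).
Proof.
move=> oV /block_diagonalP cV; apply/block_diagonalP.
have cVT : diag_mx xb *m V^T = V^T *m diag_mx xb.
  by rewrite -[in LHS](tr_diag_mx xb) -trmx_mul -cV trmx_mul tr_diag_mx.
rewrite /orthconj !mulmxA cVT -!mulmxA -cV; congr (_ *m _); rewrite !mulmxA.
by rewrite diag_mxC.
Qed.

Lemma block_diagonal_fix V : orthmx V -> block_diagonal V ->
  conjS V (diagS xb) = diagS xb.
Proof.
move=> oV /block_diagonalP cV; apply: sym_inj.
by rewrite conjSE diagSE /orthconj -mulmxA cV mulmxA orthmxT // mul1mx.
Qed.

Definition blockpart (Z : S) : S :=
  sympart (\matrix_(i, j) if xb 0 i == xb 0 j then (Z : M) i j else 0).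

Lemma blockpartE Z i j :
  (blockpart Z : M) i j = if xb 0 i == xb 0 j then (Z : M) i j else 0.
Proof.
rewrite sympart_id ?mxE //; apply/matrixP => k l; rewrite !mxE eq_sym.
by rewrite -{1}[Z : M]sym_tr mxE.
Qed.

Lemma blockpart_linear : linear blockpart.
Proof.
move=> a X Y; apply: sym_inj; apply/matrixP => i j.
by rewrite blockpartE /= !mxE !blockpartE; case: ifP => // _; rewrite mulr0 addr0.
Qed.

Lemma blockpart_block_diagonal Z : block_diagonal (blockpart Z).
Proof. by move=> i j /negPf ij; rewrite blockpartE ij. Qed.

Lemma blockpart_id (Z : S) : block_diagonal Z -> blockpart Z = Z.
Proof.
move=> h; apply: sym_inj; apply/matrixP => i j; rewrite blockpartE.
by case: eqP => // /eqP /h ->.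
Qed.

Lemma diagS_block_diagonal x : block_diagonal (diagS x).
Proof.
move=> i j; rewrite diagSE mxE; have [->|_ _] := eqVneq i j; last exact: mulr0n.
by rewrite eqxx.
Qed.

(** The infinitesimal rotation that produces the off-diagonal blocks of [Z]: for
    [A = offpart Z] the commutator of [A] with [diag xb] is half of them, and
    the Cayley transform of [A] is the identity plus [2 A] to first order. *)
Definition offpart (Z : S) : M := \matrix_(i, j)
  if xb 0 i == xb 0 j then 0 else (Z : M) i j / (2 * (xb 0 j - xb 0 i)).

Lemma offpart_linear : linear offpart.
Proof.
move=> a X Y; apply/matrixP => i j; rewrite !mxE; case: eqP => _.
  by rewrite mulr0 addr0.
by rewrite mulrDl mulrA.
Qed.

Lemma offpart_antisym Z : (offpart Z)^T = - offpart Z.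
Proof.
apply/matrixP => i j; rewrite !mxE eq_sym; case: eqP => _; first by rewrite oppr0.
by rewrite -{1}[Z : M]sym_tr mxE -mulrN -invrN -mulrN opprB.
Qed.

Lemma offpart_diagS x : offpart (diagS x) = 0.
Proof.
apply/matrixP => i j; rewrite !mxE diagSE mxE; case: eqP => // h.
have [ij|_] := eqVneq i j; first by rewrite ij in h.
by rewrite mulr0n mul0r.
Qed.

(** Diagonal blocks are taken from [Z], and the off-diagonal ones are turned into
    a rotation. The eigenvalues are those of the diagonal blocks, and the
    differential at [diag xb] is the identity. *)
Definition kappa (Z : S) : S := conjS (cayley (offpart Z))^T (blockpart Z).

Lemma eigvals_kappa Z : eigvals (kappa Z) = eigvals (blockpart Z).
Proof. by apply/eigvals_conjS/trmx_orthmx/cayley_orth/offpart_antisym. Qed.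

Lemma kappa_diagS x : kappa (diagS x) = diagS x.
Proof.
rewrite /kappa offpart_diagS blockpart_id ?diagS_block_diagonal //; last exact: diagS_block_diagonal.
apply: sym_inj; rewrite conjSE /cayley subr0 addr0 invmx1 mulmx1 trmx1.
exact: orthconj1.
Qed.

Lemma kappa_smooth : smooth setT kappa.
Proof.
move=> k; have oT : open (setT : set S) := openT.
have C1 (a : R) i j : Ck k setT (fun Z => (1%:M + a *: offpart Z) i j).
  have -> : (fun Z => (1%:M + a *: offpart Z) i j) =
      (fun Z => (1%:M : M) i j + a * offpart Z i j).
    by apply/funext => Z; rewrite mxE; congr (_ + _); rewrite mxE.
  apply: Ck_add => //; first exact: Ck_cst.
  apply: (@framed_linear_Ck _ _ R) => //; first exact: framed_sym.
  by move=> b X Y; rewrite /= offpart_linear !mxE mulrDr; congr (_ + _); rewrite mulrCA.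
have C2 i j : Ck k setT (fun Z => cayley (offpart Z) i j).
  apply: Ck_mulmx => // i' j'.
    apply: Ck_invmx => // [Z _|i2 j2]; first exact/antisym_unitmx/offpart_antisym.
    by have := C1 (-1) i2 j2; under eq_fun do rewrite scaleN1r.
  by have := C1 1 i' j'; under eq_fun do rewrite scale1r.
apply: Ck_sympart => // i j; rewrite /orthconj.
apply: Ck_mulmx => // i' j'; last first.
  by under eq_fun do rewrite mxE; exact: C2.
apply: Ck_mulmx => // i2 j2.
  by under eq_fun do rewrite trmxK; exact: C2.
have CB : Ck k setT blockpart.
  by apply: framed_linear_Ck => //; [exact: framed_sym|exact: blockpart_linear].
apply: (@Ck_comp_linear _ _ _ R _ _ blockpart (fun X : S => (X : M) i2 j2)) => //.
- by move=> a X Y; rewrite /= !mxE.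
- exact: entry_continuous.
Qed.

(** Differentiate [(1 - A) (kappa Z) (1 + A) = (1 + A) (blockpart Z) (1 - A)] at
    [diag xb], where [A = offpart Z] vanishes. With [D = diag xb] the derivative
    in direction [H] is [blockpart H + 2 (A D - D A)] for [A = offpart H], whose
    entries are those of [H]. *)
Lemma kappa_diff : 'd kappa (diagS xb) = id :> (S -> S).
Proof.
have fS := @framed_sym R n.
have dk : differentiable kappa (diagS xb).
  exact: (smooth_differentiable (kappa_smooth 1%N)).
apply/funext => H; rewrite -(deriveE H dk).
pose Km (Z : S) : M := kappa Z; pose Bm (Z : S) : M := blockpart Z.
have entry_lin i j : linear (fun X : S => (X : M) i j).
  by move=> a X Y; rewrite /= !mxE.
have dKm i j : differentiable (fun Z => Km Z i j) (diagS xb) /\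
    'D_H (fun Z => Km Z i j) (diagS xb) = ('D_H kappa (diagS xb) : M) i j.
  exact: (derive_comp_linear H (entry_lin i j) (@entry_continuous R n i j) dk).
have dKmE : dmx Km (diagS xb) H = 'D_H kappa (diagS xb) :> M.
  by apply/matrixP => i j; rewrite mxE; case: (dKm i j).
have dKm' : differentiable_mx Km (diagS xb) by move=> i j; case: (dKm i j).
have lN : linear (fun Z => - offpart Z).
  by move=> a X Y; rewrite offpart_linear opprD scalerN.
have lB : linear Bm by move=> a X Y; rewrite /Bm blockpart_linear.
have [dN dNE] := dmx_affine (1%:M : M) (diagS xb) H fS lN.
have [dP dPE] := dmx_affine (1%:M : M) (diagS xb) H fS offpart_linear.
have [dB dBE] := dmx_affine (0 : M) (diagS xb) H fS lB.
have E1 : (fun Z => (1%:M + - offpart Z) *m Km Z *m (1%:M + offpart Z)) =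
          (fun Z => (1%:M + offpart Z) *m (0 + Bm Z) *m (1%:M + - offpart Z)).
  apply/funext => Z; rewrite add0r /Km conjSE; exact/cayley_conj/offpart_antisym.
have [dl1 dl1E] := dmxM H dN dKm'; have [dl2 dl2E] := dmxM H dl1 dP.
have [dr1 dr1E] := dmxM H dP dB; have [dr2 dr2E] := dmxM H dr1 dN.
have := congr1 (fun f => dmx f (diagS xb) H) E1.
rewrite dl2E dr2E dl1E dr1E dNE dPE dBE dKmE.
rewrite /Km /Bm kappa_diagS offpart_diagS blockpart_id; last exact: diagS_block_diagonal.
rewrite oppr0 !addr0 add0r !mulmx1 !mul1mx diagSE => e.
apply: sym_inj; apply/matrixP => i j; move/matrixP: e => /(_ i j).
rewrite mulNmx !(mul_diag_mx, mul_mx_diag) !mxE blockpartE.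
move: ((H : M) i j) => h; case: eqP => [_|/eqP ij].
  by rewrite !(mul0r, mulr0, oppr0, addr0, add0r).
have d0 : xb 0 j - xb 0 i != 0 by rewrite subr_eq0 eq_sym.
have hE : h = 2 * (xb 0 j - xb 0 i) * (h / (2 * (xb 0 j - xb 0 i))) by field.
by move: hE; move: (h / _) => q ->; lra.
Qed.

End Blocks.

(** * From the set of eigenvalues to the spectral set *)

Section DiffLocalInverse.
Variables (R : realType) (E F : normedModType R).

(** A local inverse of a map tangent to the identity is tangent to the
    identity. *)
Lemma diff_comp_local_inverse (f : E -> F) (phi psi : E -> E) z :
  phi z = z -> 'd phi z = id :> (E -> E) -> differentiable phi z ->
  differentiable psi z -> differentiable f z ->
  (\forall x \near z, (psi \o phi) x = x) -> 'd (f \o psi) z = 'd f z :> (E -> F).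
Proof.
move=> phiz dphiE dphi dpsi df nU; have psiz : psi z = z.
  by have := nbhs_singleton nU; rewrite /= phiz.
have dpsi' : differentiable psi (phi z) by rewrite phiz.
have df' : differentiable f (psi z) by rewrite psiz.
apply/funext => v; have := diff_local_inverse v dphi dpsi' nU.
have -> : 'd phi z v = v by rewrite dphiE.
have -> : 'd (f \o psi) z v = 'd f (psi z) ('d psi z v).
  exact: (congr1 (fun h : E -> F => h v) (diff_comp dpsi df')).
by rewrite phiz psiz => ->.
Qed.

End DiffLocalInverse.

Section BlockDiagonalization.
Variables (R : realType) (n : nat) (xb : 'rV[R]_n).
Hypothesis xbs : nonincreasing xb.
Local Notation S := (sym_matrix R n).
Local Notation M := 'M[R]_n.
Local Notation E := 'rV[R]_n.

Lemma quad_abs_le_frob (X : S) (u : E) : `|(u *m X *m u^T) 0 0| <= `|X| * sqnorm u.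
Proof.
rewrite ler_norml quad_le_frob andbT -normrN.
have := quad_le_frob (- X) u; rewrite /= mulmxN mulNmx mxE.
by rewrite lerNl.
Qed.

(** Let [mu] be the [i]-th eigenvalue and [u] the part of its eigenvector in the
    block of [j]. Then [u (X - diag xb) = (mu - xb_j) u], so [u = 0] or [mu] is
    close to [xb_j]; but [mu] is close to [xb_i] by Weyl's inequality, so
    [u = 0] unless [j] is in the block of [i]. *)
Lemma block_eigenvectors (X : S) (U : M) : block_diagonal xb X ->
  `|X - diagS xb| < gap xb -> orthmx U ->
  (X : M) = orthconj U (diag_mx (eigvals X)) -> block_diagonal xb U.
Proof.
move=> cX Xxb oU XE i j ij.
(* The projection on the block of j, which commutes with X. *)
pose p : M := diag_mx (\row_k (xb 0 k == xb 0 j)%:R).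
pose u : E := row i U *m p; pose mu := eigvals X 0 i.
have uk k : u 0 k = U i k * (xb 0 k == xb 0 j)%:R.
  by rewrite /u mul_mx_diag !mxE.
have pX : p *m X = (X : M) *m p.
  apply/matrixP => k l; rewrite mul_diag_mx mul_mx_diag !mxE.
  have [kl|/cX ->] := eqVneq (xb 0 k) (xb 0 l); last by rewrite mulr0 mul0r.
  by rewrite kl mulrC.
have uX : u *m X = mu *: u.
  rewrite /u -mulmxA pX mulmxA -row_mul XE /orthconj !mulmxA oU mul1mx.
  rewrite scalemxAl; congr (_ *m p); apply/rowP => k.
  by rewrite mul_diag_mx !mxE.
have uD : u *m diag_mx xb = xb 0 j *: u.
  move: u uk {uX} => w wk; apply/rowP => k; rewrite mul_mx_diag !mxE wk mulrC.
  by case: eqP => [->|_] //; rewrite !mulr0.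
have uK : u *m (X - diagS xb : S) = (mu - xb 0 j) *: u.
  by rewrite /= diagSE mulmxBr uX uD scalerBl.
have [u0|/sqnorm_gt0 su] := eqVneq u 0.
  by have := uk j; rewrite u0 mxE eqxx mulr1.
have := quad_abs_le_frob (X - diagS xb) u.
rewrite uK -scalemxAl sqnormE mxE [_%:M 0 0]mxE eqxx mulr1n normrM (gtr0_norm su).
rewrite ler_pM2r // => h1; have := weyl X (diagS xb).
rewrite eigvals_diagS_sorted // => h2.
have h3 : `|mu - xb 0 i| <= `|X - diagS xb|.
  by apply: le_trans h2; have := coord_le_norm (eigvals X - xb) i; rewrite !mxE.
case/negP: ij; apply/eqP/gapP; apply: le_lt_trans (ler_distD mu _ _) _.
by rewrite [`|xb 0 i - _|]distrC; lra.
Qed.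

Lemma block_spectral (X : S) : block_diagonal xb X -> `|X - diagS xb| < gap xb ->
  exists U : M, [/\ orthmx U, block_diagonal xb U & X = conjS U (diagS (eigvals X))].
Proof.
move=> cX Xxb; have [U oU XE] := sym_spectral X; exists U; split=> //.
  exact: block_eigenvectors XE.
by apply: sym_inj; rewrite conjSE diagSE.
Qed.

(** Apply the previous lemma to [diag xb + e H] for a small [e > 0]. *)
Lemma block_spectral_all (H : S) : block_diagonal xb H ->
  exists (U : M) (h : E), [/\ orthmx U, block_diagonal xb U & H = conjS U (diagS h)].
Proof.
move=> cH; pose e := gap xb / (2 * (1 + `|H|)).
have H1 : 0 < 1 + `|H| by rewrite ltr_pwDl.
have e0 : 0 < e by rewrite divr_gt0 ?gap_gt0 // mulr_gt0.
have [||U [oU cU XE]] := @block_spectral (diagS xb + e *: H).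
- by move=> i j ij; rewrite /= !mxE cH // (@diagS_block_diagonal _ _ xb xb) // mulr0 addr0.
- have n0 : 2 * (1 + `|H|) != 0 by rewrite gt_eqF // mulr_gt0.
  rewrite addrC addKr normrZ gtr0_norm // -[ltRHS](divfK n0) ltr_pM2l //.
  by have := normr_ge0 H; lra.
move: XE; set d := eigvals _ => XE; exists U, (e^-1 *: (d - xb)).
split; [exact: oU|exact: cU|].
have xE : diagS xb = conjS U (diagS xb) by rewrite block_diagonal_fix.
rewrite (is_linearZ (@diagS_linear R n)) (is_linearB (@diagS_linear R n)).
rewrite (is_linearZ (@conjS_linear R n U)) (is_linearB (@conjS_linear R n U)).
by rewrite -XE -xE addrC addKr scalerA mulVf ?gt_eqF // scale1r.
Qed.

End BlockDiagonalization.

Section Lifting.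
Variables (R : realType) (n : nat) (xb : 'rV[R]_n).
Hypothesis xbs : nonincreasing xb.
Local Notation S := (sym_matrix R n).
Local Notation M := 'M[R]_n.
Local Notation E := 'rV[R]_n.

(** The equation is [Y (blockpart Z)], where [Y] is the lift of an equivariant
    equation [y] of [A], composed with the inverse of [kappa]. If [V] is an
    orthogonal block-diagonal matrix then [V^T diag(x) V] is sent to
    [V^T diag(y x) V], so the differential at [diag xb] sends [V^T diag(h) V] to
    [V^T diag(P h) V]. Since every block-diagonal matrix has this form, the
    differential is a projector that fixes the values of the equation. *)
Lemma spectral_of_manifold (A : set E) : locally_symmetric A xb ->
  manifold_around A xb -> manifold_around (@eigvals R n @^-1` A) (diagS xb).
Proof.
move=> symA mA; have exb := eigvals_diagS_sorted xbs.
have fS := @framed_sym R n; have fE := @framed_rV R n.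
have cdS := framed_continuous fE (@diagS_linear R n).
pose I : finType := {s : 'S_n | s \in Fix xb}.
pose a (s : I) (x : E) := col_perm (val s) x.
have F1 : (1%g : 'S_n) \in Fix xb by rewrite inE col_perm1.
have FM (s t : 'S_n) : s \in Fix xb -> t \in Fix xb -> (s * t)%g \in Fix xb.
  by rewrite !inE col_permM => /eqP h1 /eqP h2; rewrite h2 h1.
have FV (s : 'S_n) : s \in Fix xb -> (s^-1)%g \in Fix xb.
  by rewrite !inE => /eqP h; rewrite -{1}h -col_permM mulVg col_perm1.
pose one : I := exist _ 1%g F1.
pose mul (s t : I) : I := exist _ (val s * val t)%g (FM _ _ (valP s) (valP t)).
pose inv (s : I) : I := exist _ (val s)^-1%g (FV _ (valP s)).
have [||||||||| U [P [y [[oU Uz aU lP PP] [aP sy ay dy yE]]]]] :=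
  @equivariant_equation R E fE I a one inv mul _ _ _ _ _ _ A xb.
- by move=> s; exact: col_perm_linear.
- by move=> x; rewrite /a col_perm1.
- by move=> s x; rewrite /a /= -col_permM mulVg col_perm1.
- by move=> s x; rewrite /a /= -col_permM mulgV col_perm1.
- by move=> s t x; rewrite /a /= col_permM.
- by move=> s t t' /(congr1 val) /= /mulIg h; exact: val_inj.
- by move=> s; apply/eqP; have := valP s; rewrite inE.
- apply: filterS symA => x xs s; apply: xs; exact: valP.
- exact: mA.
pose O := ball xb (gap xb) `&` U.
have OP x : O x <-> `|x - xb| < gap xb /\ U x.
  by rewrite /O /= -ball_normE /= distrC.
have [|||||Y [sY YE]] := @spectral_lift R n O (Fix xb) _ _ _ y.
- by apply: openI => //; exact: ball_open.
- move=> s x sF /OP[xg Ux]; apply/OP; split; first exact: ball_col_perm.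
  exact: (aU (exist _ s sF)).
- by move=> s x /OP[h1 _] /OP[h2 _]; exact: gap_perm h1 h2.
- by move=> k; apply: CkW (sy k) => x /OP[].
- by move=> s x sF _; exact: (ay (exist _ s sF)).
have oO : open O by apply: openI => //; exact: ball_open.
have Oxb : O xb by apply/OP; rewrite subrr normr0; split; [exact: gap_gt0|].
pose B := @blockpart R n xb; pose z := diagS xb.
have lB : linear B by exact: blockpart_linear.
have cB : continuous B by exact: framed_continuous.
have Bz : B z = z by rewrite /B blockpart_id //; exact: diagS_block_diagonal.
pose OS := @eigvals R n @^-1` O.
have oOS : open OS by apply: open_comp => // X _; exact: eigvals_continuous.
pose W := B @^-1` (OS `&` ball z (gap xb)).
have oW : open W.
  by apply: open_comp => [X _|]; [exact: cB|apply: openI => //; exact: ball_open].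
have Wz : W z.
  rewrite /W /= Bz; split; first by rewrite /OS /= /z exb.
  by apply: ballxx; exact: gap_gt0.
pose y0 := Y \o B.
have sy0 : smooth W y0.
  move=> k; apply: (@Ck_comp _ _ _ _ _ W OS B Y) => //; first by move=> X [].
  exact: Ck_linear.
have dy0 : differentiable y0 z := smooth_differentiable (sy0 1%N) Wz.
pose P0 := 'd y0 z : S -> S.
have lP0 : linear P0 by move=> b u v; rewrite /P0 linearP.
have YcE V x : orthmx V -> O (eigvals (conjS V (diagS x))) -> O x ->
    Y (conjS V (diagS x)) = conjS V (diagS (y x)).
  move=> oV h1 h2; apply: sym_inj; rewrite conjSE diagSE.
  by apply: YE => //; rewrite conjSE diagSE.
have P0E V h : orthmx V -> block_diagonal xb V ->
    P0 (conjS V (diagS h)) = conjS V (diagS (P h)).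
  move=> oV cV; pose c x := conjS V (diagS x) : S.
  have lc : linear c by move=> b u v; rewrite /c diagS_linear conjS_linear.
  have cc := framed_continuous fE lc.
  have cz : c xb = z by exact: block_diagonal_fix.
  have Bc x : B (c x) = c x.
    rewrite /B blockpart_id // /c => i j; rewrite conjSE diagSE.
    exact: block_diagonal_orthconj.
  have n1 : \forall x \near xb, O x by exact: open_nbhs_nbhs.
  have n2 : \forall X \near c xb, OS X.
    by apply: open_nbhs_nbhs; split=> //; rewrite cz /OS /= exb.
  have nE : \forall x \near xb, (y0 \o c) x = (c \o y) x.
    apply: filterS2 n1 (cc xb _ n2) => x Ox Ocx.
    by rewrite /y0 /= Bc; exact: YcE.
  have dyxb : differentiable y xb := smooth_differentiable (sy 1%N) Uz.
  have [dc dcE] := derive_comp_linear h lc cc dyxb.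
  rewrite -[RHS]/(c (P h)) -dy -(deriveE h dyxb) -dcE -(near_eq_derive h nE).
  have dy0' : differentiable y0 (c xb) by rewrite cz.
  have cid : continuous (@id S) by move=> x; exact: cvg_id.
  have lid : linear (@id S) by [].
  have [dlc _] := diff_linear xb lc cc.
  have d0 : differentiable (y0 \o c) xb by exact: differentiable_comp.
  rewrite (deriveE h d0) -[LHS]/(P0 (c h)) -[RHS]/('d (id \o (y0 \o c)) xb h).
  by rewrite (diff_sandwich h lc cc lid cid dy0') cz.
have y0B X : y0 (B X) = y0 X.
  rewrite /y0 /= (_ : B (B X) = B X) //; apply: blockpart_id.
  exact: blockpart_block_diagonal.
have P0B X : P0 (B X) = P0 X.
  have cid : continuous (@id S) by move=> x; exact: cvg_id.
  have lid : linear (@id S) by [].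
  have dy0' : differentiable y0 (B z) by rewrite Bz.
  have FE : id \o (y0 \o B) = y0 by apply/funext => V; exact: y0B.
  by have := diff_sandwich X lB cB lid cid dy0'; rewrite FE Bz => /esym.
have PP0 X : P0 (P0 X) = P0 X.
  have [V [h [oV cV BX]]] := block_spectral_all xbs (@blockpart_block_diagonal R n xb X).
  rewrite -/(B X) in BX; rewrite -(P0B X) BX (P0E _ _ oV cV).
  rewrite (P0E _ _ oV cV) PP; exact: erefl.
have y0E X : W X -> exists V, [/\ orthmx V, block_diagonal xb V, U (eigvals (B X)) &
    y0 X = conjS V (diagS (y (eigvals (B X))))].
  move=> [OX]; have [_ UX] := OX; rewrite -ball_normE /= distrC => Xz.
  have [V [oV cV BX]] := block_spectral xbs (@blockpart_block_diagonal R n xb X) Xz.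
  exists V; split; [exact: oV|exact: cV|exact: UX|].
  have YBX := YcE V (eigvals (B X)) oV; rewrite -/(B X) in BX; rewrite -BX in YBX.
  exact: (YBX OX OX).
have [U1 [V1 [chi [U1z U1W sd]]]] :=
  inverse_function fS oW Wz (fun k => CkW (@subsetT _ W) (@kappa_smooth R n xb k)) (@kappa_diff R n xb).
have [[oU1 oV1] skap schi kapK chiK] := sd.
have kz : kappa xb z = z by exact: kappa_diagS.
have [V1z chiz] := kapK _ U1z; rewrite kz in V1z chiz.
apply: (@manifold_of_equation R S fS P0 (y0 \o chi) V1).
- exact: oV1.
- exact: V1z.
- exact: lP0.
- exact: PP0.
- move=> k; apply: (@Ck_comp _ _ _ _ _ V1 W chi y0 fS oV1 oW).
  + by move=> X /chiK[/U1W].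
  + exact: schi.
  + exact: sy0.
- move=> X /chiK[/U1W /y0E[V [oV cV Umu E1]] _].
  have [yP _] := yE _ Umu; rewrite /= E1 (P0E _ _ oV cV) yP; exact: erefl.
- have nK : \forall X \near z, (chi \o kappa xb) X = X.
    by apply: filterS (open_nbhs_nbhs (conj oU1 U1z)) => X /kapK[].
  have dkap : differentiable (kappa xb) z := smooth_differentiable (skap 1%N) U1z.
  have dchi : differentiable chi z := smooth_differentiable (schi 1%N) V1z.
  exact: (diff_comp_local_inverse kz (@kappa_diff R n xb) dkap dchi dy0 nK).
- move=> X /chiK[/U1W /y0E[V [oV cV Umu E1]] XE]; have [_ QE] := yE _ Umu.
  rewrite -{1}XE /= eigvals_kappa; apply: (iff_trans QE); rewrite E1.
  have lD := @diagS_linear R n; have lC := @conjS_linear R n.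
  split=> [->|h]; first by rewrite (is_linear0 lD) (is_linear0 (lC V)).
  rewrite -[LHS]diagSK -(conjSK oV (diagS _)) h (is_linear0 (lC _)).
  by rewrite (is_linear0 (@diagpart_linear R n)).
- by rewrite /= exb; case: mA.
Qed.

End Lifting.

Theorem theorem2p7 (R : realType) (n : nat) (Xbar : sym_matrix R n)
    (M : set 'rV[R]_n) :
  locally_symmetric M (eigvals Xbar) ->
  (manifold_around M (eigvals Xbar) <->
   manifold_around (@eigvals R n @^-1` M) Xbar).
Proof.
move=> symM; have [U oU XE] := sym_spectral Xbar.
pose xb := eigvals Xbar.
have xbs : nonincreasing xb by have [] := eigvalsP Xbar.
have fS := @framed_sym R n.
have oUT := trmx_orthmx oU.
have conj_diag : conjS U (diagS xb) = Xbar.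
  by apply: sym_inj; rewrite conjSE diagSE -XE.
have conj_Xbar : conjS U^T Xbar = diagS xb by rewrite -conj_diag conjSK.
have conjTK : cancel (conjS U^T) (@conjS R n U).
  by move=> X; have := conjSK oUT X; rewrite trmxK.
have eig_conj V X : orthmx V ->
    (@eigvals R n @^-1` M) (conjS V X) <-> (@eigvals R n @^-1` M) X.
  by move=> oV; rewrite /= eigvals_conjS.
split=> [mM|mQ].
- rewrite -conj_diag.
  apply: (manifold_linear_iso fS (@conjS_linear R n U) (@conjS_linear R n U^T)
    (conjSK oU) conjTK (fun X => eig_conj U X oU)).
  exact: spectral_of_manifold.
- apply: (manifold_of_spectral xbs symM); rewrite -conj_Xbar.
  exact: (manifold_linear_iso fS (@conjS_linear R n U^T) (@conjS_linear R n U)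
    conjTK (conjSK oU) (fun X => eig_conj U^T X oUT)).
Qed.
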